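(* Let $M$ be a $\Lambda$-module with top $T = \bigoplus_{i=1}^n S_i^{t_i}$ and dimension vector $\mathbf d$. Then the following conditions (1)--(3) are equivalent: (1) $M$ has no proper top-stable degeneration of torus type, that is, $\overline{\mathcal T.C} \subseteq \mathrm{Aut}_\Lambda(P).C$ for all torus subgroups $\mathcal T$ of $\mathrm{Aut}_\Lambda(P)$ and all points $C$ in the $\mathrm{Aut}_\Lambda(P)$-orbit of $\mathfrak{Grass}^T_{\mathbf d}$ corresponding to $M$. (2) $M \cong \bigoplus_{i=1}^n \bigoplus_{j=1}^{t_i} \Lambda e_i / C_{ij}$, where the $C_{ij}$ are left ideals contained in $\Lambda e_i$ such that (2.a) $C_{i1} \supseteq C_{i2} \supseteq \cdots \supseteq C_{it_i}$ for all $i$, and (2.b) $(i,j) \ne (k,l)$ implies $f(C_{ij}) \subseteq C_{kl}$ for all $f \in \mathrm{Hom}_\Lambda(\Lambda e_i, J e_k)$. (3) $M \cong \bigoplus_{i=1}^n M_i$, where each $M_i$ has top $S_i^{t_i}$, say $M_i \cong P_i/ \mathbf C_i$ with $P_i = \bigoplus_{r:\, z_r = e_i z_r} \Lambda z_r$ and $\mathbf C_i \subseteq JP_i$, such that (3.a) if $t_i \ge 2$, then $M_i$ does not have any proper top-stable degeneration, and (3.b) $i \ne k$ implies $f(\mathbf C_i) \subseteq \mathbf C_k$ for all $f \in \mathrm{Hom}_\Lambda(P_i, P_k)$.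
   Context: $K$ is an algebraically closed field and $\Lambda$ is a basic finite dimensional $K$-algebra with Jacobson radical $J$ and full sequence $e_1,\dots,e_n$ of primitive idempotents; $S_i=\Lambda e_i/Je_i$. Modules are finite dimensional left $\Lambda$-modules; the top of $M$ is $M/JM$. $P$ is a projective cover of $T$ with a fixed distinguished sequence $z_1,\dots,z_t$ of top elements, $t=\sum_i t_i$: $P=\bigoplus_{r=1}^t\Lambda z_r$ with $z_r=e(r)z_r$, $e(r)\in\{e_1,\dots,e_n\}$, $\Lambda z_r\cong\Lambda e(r)$. With $|\mathbf d|$ the sum of the entries of $\mathbf d$, $\mathfrak{Grass}^T_{\mathbf d}$ is the closed subvariety of the Grassmannian $\mathrm{Gr}(\dim P-|\mathbf d|,P)$ consisting of those subspaces $C$ that are $\Lambda$-submodules of $JP$ with $P/C$ of dimension vector $\mathbf d$; $\mathrm{Aut}_\Lambda(P)$ acts on it and its orbits correspond bijectively, via $C\mapsto P/C$, to the isomorphism classes of modules with top $T$ and dimension vector $\mathbf d$. Closures are taken in $\mathfrak{Grass}^T_{\mathbf d}$. A degeneration of $M$ is a module represented by a point in the closure of the $\mathrm{GL}(\mathbf d)$-orbit of $M$ in the classical affine variety of modules with dimension vector $\mathbf d$; it is proper if not isomorphic to $M$, top-stable if it has the same top as $M$. The top-stable degenerations of $P/C$ are the modules $P/C'$ with $C'\in\overline{\mathrm{Aut}_\Lambda(P).C}$. A top-stable degeneration of torus type of $M\cong P/C$ is a module isomorphic to $P/C'$ with $C'\in\overline{\mathcal T.C}$ for some maximal torus $\mathcal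 T$ of $\mathrm{Aut}_\Lambda(P)$. *)

(* Defs.v *)
From HB Require Import structures.
From mathcomp Require Import all_boot all_order all_algebra all_field.
From mathcomp Require Import mpoly.

Set Implicit Arguments.
Unset Strict Implicit.
Unset Printing Implicit Defensive.

Import GRing.Theory.
Local Open Scope ring_scope.

(* The K-structure of a module is carried by its [vectType]; the A-action is a
   separate operation, since MathComp does not support two scalings at once. *)
Record fdmod (K : fieldType) (A : falgType K) := FdMod {
  mcar :> vectType K;
  mact : A -> mcar -> mcar;
  mact_linear : forall a, linear (mact a);
  mact_linearl : forall x, linear (mact^~ x);
  mact1 : forall x, mact 1 x = x;
  mactM : forall a b x, mact (a * b) x = mact a (mact b x) }.

Section FdModTheory.
Variables (K : fieldType) (A : falgType K).
Implicit Types M N : fdmod A.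

HB.instance Definition _ M a := GRing.isSemilinear.Build K M M _ (@mact K A M a)
  (GRing.semilinear_linear (mact_linear a)).

Definition mactl M (a : A) : 'End(M) := linfun (mact (f:=M) a).

Lemma mactlE M a x : mactl M a x = mact a x.
Proof. by rewrite lfunE. Qed.

Definition mactr M (x : M) (a : A) : M := mact a x.
Fact mactr_linear M (x : M) : linear (mactr x).
Proof. exact: mact_linearl. Qed.
HB.instance Definition _ M x := GRing.isSemilinear.Build K A M _ (@mactr M x)
  (GRing.semilinear_linear (mactr_linear x)).

Definition mod_hom M N (f : 'Hom(M, N)) : Prop :=
  forall a x, f (mact a x) = mact a (f x).

Definition mod_iso M N : Prop :=
  exists f : 'Hom(M, N), mod_hom f /\ bijective f.

Definition mod_aut M (f : 'End(M)) : Prop := mod_hom f /\ bijective f.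

Record submod M := SubMod {
  sub_vs :> {vspace M};
  sub_stable : forall a x, x \in sub_vs -> mact a x \in sub_vs }.

Fact reg_linear a : linear (fun x : A => a * x).
Proof. by move=> k x y; rewrite mulrDr scalerAr. Qed.
Fact reg_linearl x : linear (fun a : A => a * x).
Proof. by move=> k a b; rewrite mulrDl scalerAl. Qed.
Fact reg1 (x : A) : 1 * x = x. Proof. exact: mul1r. Qed.
Fact regM (a b x : A) : a * b * x = a * (b * x).
Proof. by rewrite mulrA. Qed.
Definition regular : fdmod A := FdMod reg_linear reg_linearl reg1 regM.

Definition left_ideal := submod regular.

Section SubModule.
Variables (M : fdmod A) (U : submod M).
Definition sub_act (a : A) (u : subvs_of U) : subvs_of U :=
  vsproj U (mact a (vsval u)).
Lemma sub_actE a u : vsval (sub_act a u) = mact a (vsval u).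
Proof. by rewrite /sub_act vsprojK //; apply: sub_stable; apply: subvsP. Qed.
Fact sub_act_linear a : linear (sub_act a).
Proof. by move=> k u v; rewrite /sub_act !linearP. Qed.
Fact sub_act_linearl u : linear (sub_act^~ u).
Proof. by move=> k a b; rewrite /sub_act (mact_linearl (vsval u)) linearP. Qed.
Fact sub_act1 u : sub_act 1 u = u.
Proof. by apply: val_inj; rewrite /= sub_actE mact1. Qed.
Fact sub_actM a b u : sub_act (a * b) u = sub_act a (sub_act b u).
Proof. by apply: val_inj; rewrite /= !sub_actE mactM. Qed.
Definition sub_mod : fdmod A :=
  FdMod sub_act_linear sub_act_linearl sub_act1 sub_actM.
End SubModule.

(* The quotient vector space M/C is realized on the linear complement C^C, with
   the projection along C as canonical surjection; see [quo_piP]. *)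
Section QuotientModule.
Variables (M : fdmod A) (C : submod M).

Definition quo_pi : 'Hom(M, subvs_of (C^C)%VS) :=
  (linfun (vsproj (C^C)%VS) \o daddv_pi (C^C)%VS C)%VF.
Let disj : ((C^C)%VS :&: C = 0)%VS.
Proof. by rewrite capvC capv_compl. Qed.
Lemma quo_piE x : vsval (quo_pi x) = daddv_pi (C^C)%VS C x.
Proof. by rewrite comp_lfunE lfunE /= vsprojK // memv_pi. Qed.
Lemma quo_pi_ker x : (quo_pi x == 0) = (x \in (C : {vspace M})).
Proof.
have Dx : daddv_pi (C^C)%VS C x + daddv_pi C (C^C)%VS x = x.
  by apply: daddv_pi_add => //; rewrite addvC addv_complf memvf.
rewrite -(inj_eq val_inj) /= -[val (quo_pi x)]/(vsval _) quo_piE.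
apply/eqP/idP => [x0|xC]; first by rewrite -Dx x0 add0r memv_pi.
have: daddv_pi (C^C)%VS C x \in ((C^C)%VS :&: C)%VS.
  rewrite memv_cap memv_pi /=.
  by rewrite -[X in X \in _](addrK (daddv_pi C (C^C)%VS x)) Dx rpredB ?memv_pi.
by rewrite disj memv0 => /eqP.
Qed.
Lemma quo_piK (u : subvs_of (C^C)%VS) : quo_pi (vsval u) = u.
Proof.
by apply: val_inj; rewrite /= -[LHS]/(vsval _) quo_piE daddv_pi_id // subvsP.
Qed.

Definition quo_act (a : A) (u : subvs_of (C^C)%VS) : subvs_of (C^C)%VS :=
  quo_pi (mact a (vsval u)).
Lemma quo_act_pi a x : quo_act a (quo_pi x) = quo_pi (mact a x).
Proof.
apply/eqP; rewrite /quo_act -subr_eq0 -linearB quo_pi_ker -linearB.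
by apply: sub_stable; rewrite -quo_pi_ker linearB /= quo_piK subrr.
Qed.
Fact quo_act_linear a : linear (quo_act a).
Proof. by move=> k u v; rewrite /quo_act !linearP. Qed.
Fact quo_act_linearl u : linear (quo_act^~ u).
Proof. by move=> k a b; rewrite /quo_act (mact_linearl (vsval u)) linearP. Qed.
Fact quo_act1 u : quo_act 1 u = u.
Proof. by rewrite /quo_act mact1 quo_piK. Qed.
Fact quo_actM a b u : quo_act (a * b) u = quo_act a (quo_act b u).
Proof. by rewrite {1 3}/quo_act mactM quo_act_pi. Qed.
Definition quo : fdmod A :=
  FdMod quo_act_linear quo_act_linearl quo_act1 quo_actM.

Lemma quo_piP : exists f : 'Hom(M, quo),
  [/\ mod_hom f, limg f = fullv & lker f = C :> {vspace M}].
Proof.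
exists quo_pi; split; first by move=> a x; rewrite -quo_act_pi.
  by apply/vspaceP => u; rewrite memvf -[u]quo_piK memv_img ?memvf.
by apply/vspaceP => x; rewrite memv_ker quo_pi_ker.
Qed.
End QuotientModule.

(* The finite direct sum of a family is [\big[dsum2/zero_mod]_i M i]. *)
Section DirectSum.

Fact zero_act_linear (a : A) : linear (fun x : 'rV[K]_0 => x).
Proof. by []. Qed.
Fact zero_act_linearl (x : 'rV[K]_0) : linear (fun a : A => x).
Proof. by move=> k a b; rewrite !thinmx0. Qed.
Definition zero_mod : fdmod A := FdMod zero_act_linear zero_act_linearl
  (fun x => erefl) (fun a b x => erefl).

Variables M N : fdmod A.
Definition prod_act (a : A) (p : M * N) : M * N := (mact a p.1, mact a p.2).
Fact prod_act_linear a : linear (prod_act a).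
Proof. by move=> k p q; rewrite /prod_act /= !linearP. Qed.
Fact prod_act_linearl p : linear (prod_act^~ p).
Proof.
by move=> k a b; rewrite /prod_act (mact_linearl p.1) (mact_linearl p.2).
Qed.
Fact prod_act1 p : prod_act 1 p = p.
Proof. by case: p => x y; rewrite /prod_act /= !mact1. Qed.
Fact prod_actM a b p : prod_act (a * b) p = prod_act a (prod_act b p).
Proof. by rewrite /prod_act !mactM. Qed.
Definition dsum2 : fdmod A :=
  FdMod prod_act_linear prod_act_linearl prod_act1 prod_actM.
End DirectSum.

Section Cyclic.
Variables (M : fdmod A) (x : M).
Definition cyc_vs : {vspace M} := limg (linfun (mactr x)).
Lemma cyc_vsP y : reflect (exists a, y = mact a x) (y \in cyc_vs).
Proof.
apply: (iffP memv_imgP) => [[a _ ->]|[a ->]]; exists a; rewrite ?lfunE //.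
exact: memvf.
Qed.
Fact cyc_stable a y : y \in cyc_vs -> mact a y \in cyc_vs.
Proof.
by move=> /cyc_vsP[b ->]; apply/cyc_vsP; exists (a * b); rewrite mactM.
Qed.
Definition cyc : submod M := SubMod cyc_stable.
End Cyclic.

Section SumSub.
Variables (M : fdmod A) (I : finType) (Q : pred I) (U : I -> submod M).
Fact sum_sub_stable a y :
  y \in (\sum_(i | Q i) (U i : {vspace M}))%VS ->
  mact a y \in (\sum_(i | Q i) (U i : {vspace M}))%VS.
Proof.
move=> /memv_sumP[u Uu ->]; rewrite linear_sum /=; apply: memv_sumr => i Qi.
by apply: sub_stable; apply: Uu.
Qed.
Definition sum_sub : submod M := SubMod sum_sub_stable.
End SumSub.

Definition maximal_left_ideal (L : left_ideal) : Prop :=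
  (L : {vspace A}) <> fullv /\
  forall L' : left_ideal, (L <= L')%VS ->
    L' = L :> {vspace A} \/ L' = fullv :> {vspace A}.

Definition is_jacobson (J : left_ideal) : Prop :=
  forall x : A, x \in (J : {vspace A}) <->
    forall L : left_ideal, maximal_left_ideal L -> x \in (L : {vspace A}).

Section Radical.
Variables (J : left_ideal) (M : fdmod A).
Definition rad_vs : {vspace M} :=
  (\sum_(k < \dim (J : {vspace A})) limg (mactl M (vbasis J)`_k))%VS.
Lemma mem_rad j x : j \in (J : {vspace A}) -> mact j x \in rad_vs.
Proof.
move=> Jj; rewrite (coord_vbasis Jj) -/(mactr x _) linear_sum /=.
apply: rpred_sum => k _; rewrite linearZ /=; apply: rpredZ.
apply: (subvP (sumv_sup k isT (subvv _))).
by rewrite /mactr -mactlE memv_img ?memvf.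
Qed.
Fact rad_stable a y : y \in rad_vs -> mact a y \in rad_vs.
Proof.
move=> /memv_sumP[u Uu ->]; rewrite linear_sum /=; apply: rpred_sum => k _.
have /memv_imgP[x _ ->] := Uu k isT; rewrite mactlE -mactM.
apply: mem_rad; apply: (sub_stable (s:=J)); apply: vbasis_mem.
by rewrite mem_nth // size_tuple.
Qed.
Definition rad : submod M := SubMod rad_stable.
Definition top : fdmod A := quo rad.
End Radical.

Definition dimvec n (e : 'I_n -> A) (M : fdmod A) (i : 'I_n) : nat :=
  \dim (limg (mactl M (e i))).

Definition orthogonal_idempotents n (e : 'I_n -> A) : Prop :=
  forall i j, e i * e j = if i == j then e i else 0.

Definition primitive_idempotent (f : A) : Prop :=
  [/\ f * f = f, f <> 0 &
    forall g h : A, g * g = g -> h * h = h -> g * h = 0 -> h * g = 0 ->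
      f = g + h -> g = 0 \/ h = 0].

Definition full_primitive_idempotents n (e : 'I_n -> A) : Prop :=
  [/\ orthogonal_idempotents e, forall i, primitive_idempotent (e i)
    & \sum_i e i = 1].

Definition Lam_ideal (f : A) : left_ideal := cyc (f : regular).
Definition Lam (f : A) : fdmod A := sub_mod (Lam_ideal f).

Definition basic_with n (e : 'I_n -> A) : Prop :=
  full_primitive_idempotents e /\
  forall i j, mod_iso (Lam (e i)) (Lam (e j)) -> i = j.

(* A f / J f; here J (A f) = J f since J is a two-sided ideal *)
Definition Simple (J : left_ideal) (f : A) : fdmod A := top J (Lam f).

Definition semisimple_of n (J : left_ideal) (e : 'I_n -> A) (t : 'I_n -> nat) :=
  \big[dsum2/zero_mod]_(i < n) \big[dsum2/zero_mod]_(j < t i) Simple J (e i).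

Definition projective (P : fdmod A) : Prop :=
  forall (M N : fdmod A) (g : 'Hom(M, N)) (f : 'Hom(P, N)),
    mod_hom g -> limg g = fullv -> mod_hom f ->
    exists h : 'Hom(P, M), mod_hom h /\ (g \o h)%VF = f.

Definition projective_cover (P T : fdmod A) : Prop :=
  projective P /\
  exists f : 'Hom(P, T), [/\ mod_hom f, limg f = fullv &
    forall U : submod P, (U + lker f)%VS = fullv ->
      U = fullv :> {vspace P}].

(* e(r) is e (idx r) *)
Definition distinguished_sequence n (e : 'I_n -> A) (P : fdmod A) m
    (idx : 'I_m -> 'I_n) (z : 'I_m -> P) : Prop :=
  [/\ forall r, z r = mact (e (idx r)) (z r),
      forall r, mod_iso (sub_mod (cyc (z r))) (Lam (e (idx r))),
      directv (\sum_r (cyc (z r) : {vspace P}))%VS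
    & (\sum_r (cyc (z r) : {vspace P}))%VS = fullv].

Definition P_part n (e : 'I_n -> A) (P : fdmod A) m (z : 'I_m -> P)
    (i : 'I_n) : fdmod A :=
  sub_mod (sum_sub (fun r => z r == mact (e i) (z r)) (fun r => cyc (z r))).

End FdModTheory.

Section Zariski.
Variable K : fieldType.

(* Affine space with coordinates indexed by a finite type I *)
Definition coord_poly (I : finType) := {mpoly K[#|I|]}.
Definition evalp (I : finType) (p : coord_poly I) (x : I -> K) : K :=
  p.@[fun k => x (enum_val k)].

(* Closed subsets of the affine space of a type X with coordinates c *)
Definition aff_closed (X : Type) (I : finType) (c : X -> I -> K)
    (Z : X -> Prop) : Prop :=
  exists F : coord_poly I -> Prop,
    forall x, Z x <-> forall p, F p -> evalp p (c x) = 0.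

(* Pluecker coordinates of an m-dimensional subspace, indexed by all m-tuples of
   columns (the entries at non-increasing tuples are redundant) *)
Definition pluecker (V : vectType K) m (C : {vspace V})
    (s : {ffun 'I_m -> 'I_(\dim {:V})}) : K :=
  \det (\matrix_(i < m, j < m) coord (vbasis {:V}) (s j) (vbasis C)`_i).

Definition Gr (V : vectType K) m (C : {vspace V}) : Prop := \dim C = m.

Definition Gr_closed (V : vectType K) m (Z : {vspace V} -> Prop) : Prop :=
  exists F : coord_poly {ffun 'I_m -> 'I_(\dim {:V})} -> Prop,
    (forall p, F p -> exists k, p \is k.-homog) /\
    forall C, Gr m C ->
      (Z C <-> forall p, F p -> evalp p (@pluecker V m C) = 0).

End Zariski.

Section Grass.
Variables (K : fieldType) (A : falgType K) (n : nat).
Variables (J : left_ideal A) (e : 'I_n -> A) (d : 'I_n -> nat) (P : fdmod A).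

Definition Grass (C : submod P) : Prop :=
  [/\ Gr (\dim {:P} - \sum_i d i)%N C, (C <= rad J P)%VS
    & forall i, dimvec e (quo C) i = d i].

(* closure for the topology induced on Grass by that of Gr *)
Definition Grass_closure (Y : {vspace P} -> Prop) (C' : submod P) : Prop :=
  Grass C' /\
  forall Z, Gr_closed (\dim {:P} - \sum_i d i)%N Z ->
    (forall C, Y C -> Z C) -> Z C'.

Definition orbit_of (G : 'End(P) -> Prop) (C D : {vspace P}) : Prop :=
  exists g, G g /\ D = (g @: C)%VS.

(* The coordinate ring of GL(P) is generated by the matrix entries and the
   inverse of the determinant. *)
Definition entry (f : 'End(P)) (ij : 'I_(\dim {:P}) * 'I_(\dim {:P})) : K :=
  coord (vbasis {:P}) ij.1 (f (vbasis {:P})`_(ij.2)).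
Definition GL_coord (f : 'End(P))
    (o : option ('I_(\dim {:P}) * 'I_(\dim {:P}))) : K :=
  if o is Some ij then entry f ij else (\det (\matrix_(i, j) entry f (i, j)))^-1.

Definition algebraic_subgroup (G : 'End(P) -> Prop) : Prop :=
  [/\ forall f, G f -> mod_aut f,
      G \1%VF,
      forall f g, G f -> G g -> G (f \o g)%VF,
      forall f, G f -> G (f^-1)%VF
    & exists Z, aff_closed entry Z /\ forall f, mod_aut f -> (G f <-> Z f)].

(* (K^* )^r, whose regular functions are the Laurent polynomials *)
Definition Gm r (x : {ffun 'I_r -> K}) : Prop := forall i, x i != 0.
Definition Gm_coord r (x : {ffun 'I_r -> K}) (k : 'I_r + 'I_r) : K :=
  match k with inl i => x i | inr i => (x i)^-1 end.

(* phi, restricted to the points of (K^* )^r, is an isomorphism of algebraic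
   groups onto G: both phi and its inverse psi are given by regular functions. *)
Definition Gm_iso r (phi : {ffun 'I_r -> K} -> 'End(P)) (G : 'End(P) -> Prop) :
    Prop :=
  [/\ forall x, Gm x -> G (phi x),
      forall x y, Gm x -> Gm y ->
        phi [ffun i => x i * y i] = (phi x \o phi y)%VF,
      forall ij, exists p : coord_poly K ('I_r + 'I_r)%type,
        forall x, Gm x -> entry (phi x) ij = evalp p (Gm_coord x)
    & exists psi : 'End(P) -> {ffun 'I_r -> K},
      [/\ forall f, G f -> Gm (psi f) /\ phi (psi f) = f,
          forall x, Gm x -> psi (phi x) = x
        & forall i, exists p : coord_poly K
              (option ('I_(\dim {:P}) * 'I_(\dim {:P}))),
            forall f, G f -> psi f i = evalp p (GL_coord f)]].

Definition torus (G : 'End(P) -> Prop) : Prop :=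
  algebraic_subgroup G /\ exists r phi, @Gm_iso r phi G.

Definition maximal_torus (G : 'End(P) -> Prop) : Prop :=
  torus G /\
  forall G' : 'End(P) -> Prop, torus G' ->
    (forall f, G f -> G' f) -> forall f, G' f -> G f.

Definition torus_degeneration (M M' : fdmod A) : Prop :=
  exists (C C' : submod P) (G : 'End(P) -> Prop),
    [/\ Grass C, mod_iso M (quo C), maximal_torus G,
        Grass_closure (orbit_of G C) C' & mod_iso M' (quo C')].

Definition no_proper_torus_degeneration (M : fdmod A) : Prop :=
  forall M', torus_degeneration M M' -> mod_iso M' M.

Definition torus_closures_in_orbit (M : fdmod A) : Prop :=
  forall G, torus G ->
  forall C : submod P, Grass C -> mod_iso M (quo C) ->
  forall C' : submod P, Grass_closure (orbit_of G C) C' ->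
    orbit_of (@mod_aut K A P) C C'.

End Grass.

Section ModVariety.
Variables (K : fieldType) (A : falgType K) (n : nat) (e : 'I_n -> A).
Variable d : 'I_n -> nat.
Let N := (\sum_i d i)%N.

(* A point is a module structure on column vectors K^N = (+)_i K^(d i) for which
   e i acts as the projection onto the i-th block; GL(d) is the product of the
   GL_(d i), embedded block-diagonally. *)
Definition block_proj (i : 'I_n) : 'M[K]_N :=
  \mxdiag_(k < n) ((k == i)%:R)%:M.

Definition mod_point (rho : 'Hom(A, 'M[K]_N)) : Prop :=
  [/\ rho 1 = 1%:M, forall a b, rho (a * b) = rho a *m rho b
    & forall i, rho (e i) = block_proj i].

Definition represents (rho : 'Hom(A, 'M[K]_N)) (M : fdmod A) : Prop :=
  exists phi : 'Hom(M, 'cV[K]_N),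
    bijective phi /\ forall a x, phi (mact a x) = rho a *m phi x.

Definition GLd_orbit (rho sigma : 'Hom(A, 'M[K]_N)) : Prop :=
  exists g : forall i, 'M[K]_(d i), (forall i, g i \in unitmx) /\
    forall a, sigma a = (\mxdiag_i g i) *m rho a *m invmx (\mxdiag_i g i).

Definition mod_coord (rho : 'Hom(A, 'M[K]_N))
    (k : 'I_(\dim {:A}) * ('I_N * 'I_N)) : K :=
  rho (vbasis {:A})`_(k.1) k.2.1 k.2.2.

Definition mod_closure (Y : 'Hom(A, 'M[K]_N) -> Prop)
    (sigma : 'Hom(A, 'M[K]_N)) : Prop :=
  mod_point sigma /\
  forall Z, aff_closed mod_coord Z -> (forall rho, Y rho -> Z rho) -> Z sigma.

Definition degeneration_in (M M' : fdmod A) : Prop :=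
  exists rho sigma, [/\ mod_point rho, represents rho M,
    mod_closure (GLd_orbit rho) sigma & represents sigma M'].

End ModVariety.

Section Degenerations.
Variables (K : fieldType) (A : falgType K) (n : nat).
Variables (J : left_ideal A) (e : 'I_n -> A).

Definition degeneration (M M' : fdmod A) : Prop :=
  degeneration_in e (dimvec e M) M M'.

Definition no_proper_top_stable_degeneration (M : fdmod A) : Prop :=
  forall M', degeneration M M' -> mod_iso (top J M') (top J M) ->
    mod_iso M' M.

End Degenerations.

Section Conditions.
Variables (K : fieldType) (A : falgType K) (n : nat).
Variables (J : left_ideal A) (e : 'I_n -> A) (t : 'I_n -> nat).

Definition nested_decomposition (M : fdmod A) : Prop :=
  exists C : forall i : 'I_n, 'I_(t i) -> submod (Lam (e i)),
  [/\ mod_iso M (\big[@dsum2 K A/zero_mod A]_(i < n)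
                   \big[@dsum2 K A/zero_mod A]_(j < t i) quo (C i j)),
      forall i (j l : 'I_(t i)), (j <= l)%N -> (C i l <= C i j)%VS
    & forall i j k l, existT (fun i => 'I_(t i)) i j <> existT _ k l ->
      forall f : 'Hom(Lam (e i), Lam (e k)), mod_hom f ->
        (limg f <= rad J (Lam (e k)))%VS -> (f @: C i j <= C k l)%VS].

Definition isotypic_decomposition (P : fdmod A) m (z : 'I_m -> P)
    (M : fdmod A) : Prop :=
  exists (Mi : 'I_n -> fdmod A) (C : forall i : 'I_n, submod (P_part e z i)),
  [/\ mod_iso M (\big[@dsum2 K A/zero_mod A]_(i < n) Mi i),
      forall i, mod_iso (top J (Mi i))
        (\big[@dsum2 K A/zero_mod A]_(j < t i) Simple J (e i)),
      forall i, (C i <= rad J (P_part e z i))%VS /\ mod_iso (Mi i) (quo (C i)),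
      forall i, (2 <= t i)%N -> no_proper_top_stable_degeneration J e (Mi i)
    & forall i k, i <> k ->
      forall f : 'Hom(P_part e z i, P_part e z k), mod_hom f ->
        (f @: C i <= C k)%VS].

End Conditions.

(* Main.v *)
From HB Require Import structures.
From mathcomp Require Import all_boot all_order all_fingroup all_algebra all_field.
From mathcomp Require Import cyclic mpoly.
From Stdlib Require Import Classical.
Require Import Defs.

Set Implicit Arguments.
Unset Strict Implicit.
Unset Printing Implicit Defensive.

Import GRing.Theory.
Local Open Scope ring_scope.

(** Let z be a basis of top elements of P. A module M with the top of P is P / C for
    some C in JP, and a nested decomposition of M means that C can be chosen as the
    direct sum D of left ideals C_(i,j) z_(i,j) satisfying the conditions in
    [nested_ideals].

    If M has no proper torus degeneration, then it is nested. The automorphisms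
    diagonal in z form a maximal torus ([diag_torus_maximal]), and the limit of C for
    s -> 0 under scaling z_r by s is lim_r C = f(C) + (C meet A z_r), with f the
    projection killing z_r ([lim_Gr_closed]). By hypothesis P / lim_r C is isomorphic
    to M, for each C with P / C isomorphic to M. Taking the limits for all r makes C a
    direct sum of the C_r z_r ([lim_gen_diag]). For r = p and for the image of this
    sum under the automorphism z_p |-> z_p + x z_q, the limit is again a direct sum,
    with C_p and C_q replaced by C_p meet C_q x^(-1) and C_p x + C_q ([lim_twist]).
    By the Krull-Schmidt theorem ([krull_schmidt]) either C_p x <= C_q, or these two
    ideals are C_q and C_p up to units. For x = e_i it follows that C_p and C_q are
    comparable ([comparable]), and for x in J the second case is impossible
    ([radical_sub]).

    If M is nested, then the closures of torus orbits of C stay in the orbit of C. A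
    torus is diagonal in some basis z ([torus_diag]), and C = g D for an automorphism
    g. Each point of the torus orbit contains s + 1 independent combinations over K,
    in j, of the C_(i,s) z_(i,j), up to a unit ([torus_incidence]). This is a closed
    condition ([incidence_closed]), and for a point C' of the closure it provides an
    automorphism carrying D onto C' ([closure_orbit]).

    A nested module with top a power of S_i has no proper top-stable degeneration,
    because the dimensions of the subspaces killed by the C_(i,j) do not decrease under
    degeneration ([nested_no_degeneration]); so a nested decomposition yields an
    isotypic one. Conversely, the modules P / lim_r C are top-stable degenerations of
    P / C ([lim_degeneration]), so that the argument of the second paragraph applies
    to each isotypic summand M_i with t_i >= 2, and trivially for t_i <= 1; the
    condition on homomorphisms between different summands takes care of the rest, as
    e_i A e_k is contained in J for i <> k. *)

(** * Submodules, homomorphisms and Nakayama's lemma *)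

Section Modules.
Variables (K : fieldType) (A : falgType K).
Implicit Types M N L : fdmod A.

Lemma mact0l M (x : M) : mact 0 x = 0.
Proof. exact: (linear0 (mactr x)). Qed.
Lemma mactDl M (x : M) a b : mact (a + b) x = mact a x + mact b x.
Proof. exact: (linearD (mactr x)). Qed.
Lemma mactBl M (x : M) a b : mact (a - b) x = mact a x - mact b x.
Proof. exact: (linearB (mactr x)). Qed.
Lemma mactZl M (x : M) k a : mact (k *: a) x = k *: mact a x.
Proof. exact: (linearZZ (mactr x)). Qed.
Lemma mact_suml M (x : M) I r (Q : pred I) (F : I -> A) :
  mact (\sum_(i <- r | Q i) F i) x = \sum_(i <- r | Q i) mact (F i) x.
Proof. exact: (linear_sum (mactr x)). Qed.

Lemma idealM (L : left_ideal A) a x :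
  x \in (L : {vspace A}) -> a * x \in (L : {vspace A}).
Proof. exact: (@sub_stable K A (regular A) L). Qed.

Lemma hom_id M : mod_hom (\1%VF : 'End(M)).
Proof. by move=> a x; rewrite !id_lfunE. Qed.

Lemma hom_comp M N L (g : 'Hom(N, L)) (f : 'Hom(M, N)) :
  mod_hom g -> mod_hom f -> mod_hom (g \o f)%VF.
Proof. by move=> hg hf a x; rewrite !comp_lfunE hf hg. Qed.

Lemma hom_add M N (f g : 'Hom(M, N)) :
  mod_hom f -> mod_hom g -> mod_hom (f + g).
Proof. by move=> hf hg a x; rewrite !add_lfunE hf hg linearD. Qed.

Lemma hom_scale M N (f : 'Hom(M, N)) k : mod_hom f -> mod_hom (k *: f).
Proof. by move=> hf a x; rewrite !scale_lfunE hf linearZ. Qed.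

Lemma hom_sum M N (I : finType) (f : I -> 'Hom(M, N)) :
  (forall i, mod_hom (f i)) -> mod_hom (\sum_i f i).
Proof.
move=> hf a x; rewrite !sum_lfunE linear_sum; apply: eq_bigr => i _.
exact: hf.
Qed.

Lemma sub_limgP (V W : vectType K) (f : 'Hom(V, W)) (U : {vspace V})
    (U' : {vspace W}) : (f @: U <= U')%VS = (U <= f @^-1: U')%VS.
Proof.
apply/subvP/subvP => [sub x Ux|sub _ /memv_imgP[x Ux ->]].
  by rewrite -memv_preim sub ?memv_img.
by rewrite memv_preim sub.
Qed.

Lemma lker0_bij (V W : vectType K) (f : 'Hom(V, W)) :
  lker f = 0%VS -> limg f = fullv -> bijective f.
Proof.
move=> /eqP kf imf; exists (f^-1)%VF; first exact: lker0_lfunK.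
by move=> y; apply: limg_lfunVK; rewrite imf memvf.
Qed.

Lemma bij_lker0 (V W : vectType K) (f : 'Hom(V, W)) :
  bijective f -> lker f = 0%VS /\ limg f = fullv.
Proof.
move=> [g fK gK]; split; first by apply/eqP/lker0P/(can_inj fK).
by apply/vspaceP => y; rewrite memvf -[y]gK memv_img ?memvf.
Qed.

Lemma bij_lfunK (V W : vectType K) (f : 'Hom(V, W)) :
  bijective f -> cancel f (f^-1)%VF /\ cancel (f^-1)%VF f.
Proof.
move=> /bij_lker0[kf imf]; split; first by apply: lker0_lfunK; apply/eqP.
by move=> y; apply: limg_lfunVK; rewrite imf memvf.
Qed.

Lemma bij_lfunV (V W : vectType K) (f : 'Hom(V, W)) :
  bijective f -> bijective (f^-1)%VF.
Proof. by move=> /bij_lfunK[fK gK]; exists f. Qed.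

Lemma bij_dim (V W : vectType K) (f : 'Hom(V, W)) (U : {vspace V}) :
  bijective f -> \dim (f @: U) = \dim U.
Proof.
by move=> /bij_lker0[kf _]; apply: limg_dim_eq; rewrite kf capv0.
Qed.

Lemma hom_inv M N (f : 'Hom(M, N)) :
  mod_hom f -> bijective f -> mod_hom (f^-1)%VF.
Proof.
move=> hf /bij_lfunK[fK gK] a y.
by apply: (can_inj fK); rewrite hf !gK.
Qed.

Lemma surj_bij M (f : 'End(M)) : limg f = fullv -> bijective f.
Proof.
move=> imf; apply: lker0_bij => //; apply/eqP.
have := limg_ker_dim f fullv; rewrite capfv imf => /eqP.
by rewrite -[X in _ == X]add0n eqn_add2r dimv_eq0.
Qed.

Lemma mod_iso_refl M : mod_iso M M.
Proof.
exists \1%VF; split; first exact: hom_id.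
by exists \1%VF => x; rewrite !id_lfunE.
Qed.

Lemma mod_iso_sym M N : mod_iso M N -> mod_iso N M.
Proof.
move=> [f [hf bf]]; exists (f^-1)%VF; split; first exact: hom_inv.
exact: bij_lfunV.
Qed.

Lemma mod_iso_trans M N L : mod_iso M N -> mod_iso N L -> mod_iso M L.
Proof.
move=> [f [hf bf]] [g [hg bg]]; exists (g \o f)%VF; split.
  exact: hom_comp.
by apply: (eq_bij (bij_comp bg bf)) => x; rewrite comp_lfunE.
Qed.

Lemma mod_iso_dim M N : mod_iso M N -> \dim {:M} = \dim {:N}.
Proof.
move=> [f [_ bf]]; rewrite -(bij_dim fullv bf).
by have [_ ->] := bij_lker0 bf.
Qed.

Section SubmodConstr.
Variables (M N : fdmod A).

Fact full_stable a (x : M) : x \in fullv -> mact a x \in fullv.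
Proof. by rewrite !memvf. Qed.
Definition full_sub : submod M := SubMod full_stable.

Fact add_stable (U V : submod M) a (x : M) :
  x \in (U + V)%VS -> mact a x \in (U + V)%VS.
Proof.
move=> /memv_addP[u Uu [v Vv ->]]; rewrite linearD.
by apply: memv_add; apply: sub_stable.
Qed.
Definition add_sub (U V : submod M) : submod M := SubMod (@add_stable U V).

Fact cap_stable (U V : submod M) a (x : M) :
  x \in (U :&: V)%VS -> mact a x \in (U :&: V)%VS.
Proof. by rewrite !memv_cap => /andP[Ux Vx]; rewrite !sub_stable. Qed.
Definition cap_sub (U V : submod M) : submod M := SubMod (@cap_stable U V).

Variables (f : 'Hom(M, N)) (hf : mod_hom f).

Fact img_stable (U : submod M) a y :
  y \in (f @: U)%VS -> mact a y \in (f @: U)%VS.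
Proof.
by move=> /memv_imgP[x Ux ->]; rewrite -hf memv_img // sub_stable.
Qed.
Definition img_sub (U : submod M) : submod N := SubMod (@img_stable U).

Fact ker_stable a x : x \in lker f -> mact a x \in lker f.
Proof. by rewrite !memv_ker hf => /eqP->; rewrite linear0. Qed.
Definition ker_sub : submod M := SubMod ker_stable.

Fact preim_stable (U : submod N) a x :
  x \in (f @^-1: U)%VS -> mact a x \in (f @^-1: U)%VS.
Proof. by rewrite -!memv_preim hf; apply: sub_stable. Qed.
Definition preim_sub (U : submod N) : submod M := SubMod (@preim_stable U).

End SubmodConstr.

(** The inclusion of a submodule and the projection onto a quotient, as maps of
    modules. *)
Definition sub_incl M (U : submod M) : 'Hom(sub_mod U, M) := linfun vsval.

Lemma sub_inclE M (U : submod M) (u : sub_mod U) : sub_incl U u = vsval u.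
Proof. by rewrite lfunE. Qed.

Lemma sub_incl_hom M (U : submod M) : mod_hom (sub_incl U).
Proof. by move=> a u; rewrite !sub_inclE sub_actE. Qed.

Definition qpi M (C : submod M) : 'Hom(M, quo C) := quo_pi C.

Lemma qpi_hom M (C : submod M) : mod_hom (qpi C).
Proof. by move=> a x; rewrite /qpi -quo_act_pi. Qed.

Lemma qpi_eq0 M (C : submod M) x : (qpi C x == 0) = (x \in (C : {vspace M})).
Proof. exact: quo_pi_ker. Qed.

Lemma qpi_ker M (C : submod M) : lker (qpi C) = C :> {vspace M}.
Proof. by apply/vspaceP => x; rewrite memv_ker qpi_eq0. Qed.

Lemma qpi_surj M (C : submod M) (y : quo C) : exists x, y = qpi C x.
Proof. by exists (vsval y); rewrite /qpi quo_piK. Qed.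

Lemma qpi_img M (C : submod M) : limg (qpi C) = fullv.
Proof.
apply/vspaceP => y; rewrite memvf; have [x ->] := qpi_surj y.
by rewrite memv_img ?memvf.
Qed.

Lemma dim_quo M (C : submod M) :
  (\dim (C : {vspace M}) + \dim {:quo C} = \dim {:M})%N.
Proof. by rewrite -(limg_ker_dim (qpi C) fullv) capfv qpi_ker qpi_img. Qed.

(** The homomorphism theorem. *)
Lemma quo_iso M N (C : submod M) (f : 'Hom(M, N)) :
  mod_hom f -> limg f = fullv -> lker f = C :> {vspace M} ->
  mod_iso (quo C) N.
Proof.
move=> hf imf kf; pose g : 'Hom(quo C, N) := (f \o linfun (vsval : quo C -> M))%VF.
have gE x : g (qpi C x) = f x.
  rewrite comp_lfunE lfunE /=; apply/eqP; rewrite -subr_eq0 -linearB -memv_ker.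
  by rewrite kf -qpi_eq0 linearB /= /qpi quo_piK subrr.
exists g; split.
  by move=> a y; have [x ->] := qpi_surj y; rewrite -qpi_hom !gE hf.
apply: lker0_bij.
  apply/vspaceP => y; rewrite memv_ker memv0; have [x ->] := qpi_surj y.
  by rewrite gE -memv_ker kf qpi_eq0.
apply/vspaceP => y; rewrite memvf.
have /memv_imgP[x _ ->]: y \in limg f by rewrite imf memvf.
by rewrite -gE memv_img ?memvf.
Qed.

Lemma quo_eq_iso M (C D : submod M) :
  C = D :> {vspace M} -> mod_iso (quo C) (quo D).
Proof.
by move=> CD; apply: (quo_iso (@qpi_hom M D) (qpi_img D)); rewrite qpi_ker.
Qed.

(** An automorphism carrying one submodule to another one induces an
    isomorphism of the quotients. *)
Lemma aut_quo_iso M N (C : submod M) (D : submod N) (g : 'Hom(M, N)) :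
  mod_hom g -> bijective g -> (D : {vspace N}) = (g @: C)%VS ->
  mod_iso (quo C) (quo D).
Proof.
move=> hg bg DE; apply: (@quo_iso _ _ _ (qpi D \o g)%VF).
- by apply: hom_comp => //; apply: qpi_hom.
- by rewrite limg_comp; have [_ ->] := bij_lker0 bg; rewrite qpi_img.
apply/vspaceP => x; rewrite memv_ker comp_lfunE qpi_eq0 DE.
have [fK gK] := bij_lfunK bg.
apply/memv_imgP/idP => [[y Cy /(can_inj fK)->]|Cx] //.
by exists x.
Qed.

Lemma mod_iso_quo_surj M N (C : submod M) : mod_iso N (quo C) ->
  exists f : 'Hom(M, N),
    [/\ mod_hom f, limg f = fullv & lker f = C :> {vspace M}].
Proof.
move=> /mod_iso_sym[h [hh bh]]; exists (h \o qpi C)%VF; split.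
- by apply: hom_comp => //; apply: qpi_hom.
- by rewrite limg_comp qpi_img; have [] := bij_lker0 bh.
apply/vspaceP => x; rewrite memv_ker comp_lfunE -qpi_eq0.
have [/eqP/lker0P hI _] := bij_lker0 bh.
by rewrite -(inj_eq hI) linear0.
Qed.

(** Every proper submodule lies in a maximal one. *)
Lemma max_submod M (U : submod M) : (U : {vspace M}) != fullv ->
  exists V : submod M, [/\ (U <= V)%VS, (V : {vspace M}) != fullv &
    forall V' : submod M, (V <= V')%VS ->
      V' = V :> {vspace M} \/ V' = fullv :> {vspace M}].
Proof.
have [k] := ubnP (\dim {:M} - \dim (U : {vspace M})).
elim: k U => // k IH U leUk nU.
have [[V [UV nV nVU]]|nex] := classic (exists V : submod M,
   [/\ (U <= V)%VS, (V : {vspace M}) != fullv & (V : {vspace M}) != U]).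
  have ltUV : (\dim U < \dim V)%N.
    have [le eqd] := dimv_leqif_eq UV.
    by rewrite ltn_neqAle le andbT eqd eq_sym.
  have ltVM : (\dim V < \dim {:M})%N.
    have [le eqd] := dimv_leqif_eq (subvf V).
    by rewrite ltn_neqAle le andbT eqd.
  have [|V' [VV' nV' mV']] := IH V _ nV.
    rewrite -ltnS; apply: leq_ltn_trans leUk; apply: ltn_sub2l => //.
    exact: ltn_trans ltVM.
  by exists V'; split => //; apply: subv_trans VV'.
exists U; split => // V UV; case: (eqVneq (V : {vspace M}) fullv); first by right.
move=> nV; left; apply/eqP; apply/negPn/negP => nVU; apply: nex.
by exists V.
Qed.

End Modules.

Section Nakayama.
Variables (K : fieldType) (A : falgType K) (J : left_ideal A).
Hypothesis hJ : is_jacobson J.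
Implicit Types M N L : fdmod A.

Lemma rad_sub M (U : {vspace M}) :
  (forall j (x : M), j \in (J : {vspace A}) -> mact j x \in U) ->
  (rad J M <= U)%VS.
Proof.
move=> JU; apply/subv_sumP => k _; apply/subvP => y /memv_imgP[x _ ->].
by rewrite mactlE; apply: JU; apply: vbasis_mem; rewrite mem_nth ?size_tuple.
Qed.

Lemma rad_img M N (f : 'Hom(M, N)) : mod_hom f ->
  (f @: rad J M <= rad J N)%VS.
Proof.
move=> hf; rewrite sub_limgP; apply: rad_sub => j x Jj.
by rewrite -memv_preim hf mem_rad.
Qed.

Lemma rad_img_surj M N (f : 'Hom(M, N)) : mod_hom f -> limg f = fullv ->
  (f @: rad J M)%VS = rad J N.
Proof.
move=> hf imf; apply/eqP; rewrite eqEsubv rad_img //=; apply: rad_sub => j y Jj.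
have /memv_imgP[x _ ->]: y \in limg f by rewrite imf memvf.
by rewrite -hf memv_img // mem_rad.
Qed.

(** The Jacobson radical maps a module into each of its maximal submodules. *)
Lemma jacobson_max M (V : submod M) : (V : {vspace M}) != fullv ->
  (forall V' : submod M, (V <= V')%VS ->
      V' = V :> {vspace M} \/ V' = fullv :> {vspace M}) ->
  (rad J M <= V)%VS.
Proof.
move=> nV mV; apply: rad_sub => j x Jj.
have [Vx|nVx] := boolP (x \in (V : {vspace M})); first exact: sub_stable.
pose f : 'Hom(regular A, M) := linfun (mactr x).
have fE a : f a = mact a x by rewrite lfunE.
have hf : mod_hom f by move=> a b; rewrite !fE mactM.
have : j \in (preim_sub hf V : {vspace A}).
  apply: (iffLR (hJ j)) => //; split.
    move=> /vspaceP/(_ 1); rewrite memvf -memv_preim fE mact1.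
    by rewrite (negbTE nVx).
  move=> L VL; have [] := mV (add_sub (img_sub hf L) V) (addvSr _ _).
    move=> LV; left; apply/eqP; rewrite eqEsubv VL andbT.
    rewrite -sub_limgP -[X in (_ <= X)%VS]LV; exact: addvSl.
  move=> full; right; apply/vspaceP => a; rewrite memvf.
  have : x \in (add_sub (img_sub hf L) V : {vspace M}) by rewrite full memvf.
  move=> /memv_addP[_ /memv_imgP[l Ll ->] [v Vv xE]].
  have L1 : 1 - l \in (L : {vspace A}).
    apply: (subvP VL); rewrite -memv_preim linearB /= fE mact1 {1}xE.
    by rewrite addrC addKr.
  have : 1 \in (L : {vspace A}) by rewrite -[1](subrK l) rpredD.
  by move=> /(idealM a); rewrite mulr1 => ->.
by rewrite -memv_preim fE.
Qed.

Lemma nakayama M (U : submod M) : (U + rad J M)%VS = fullv ->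
  U = fullv :> {vspace M}.
Proof.
move=> full; apply/eqP/negPn/negP => /max_submod[V [UV nV mV]].
apply: (negP nV); rewrite eqEsubv subvf -full subv_add UV /=.
exact: jacobson_max.
Qed.

End Nakayama.

(** * Projective modules with a distinguished basis of top elements *)

Section FreeBasis.
Variables (K : fieldType) (A : falgType K) (n : nat) (e : 'I_n -> A).
Implicit Types (M N P : fdmod A) (I : finType).

(** [free_basis idx z] says that P is the direct sum of the A z_r, and that
    a e_(idx r) |-> a z_r is an isomorphism from A e_(idx r) onto A z_r; this is
    the form in which distinguished sequences are used. *)
Definition free_basis I (idx : I -> 'I_n) P (z : I -> P) : Prop :=
  [/\ forall r, mact (e (idx r)) (z r) = z r,
      forall x, exists a : {ffun I -> A}, x = \sum_r mact (a r) (z r)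
    & forall a : {ffun I -> A}, \sum_r mact (a r) (z r) = 0 ->
        forall r, a r * e (idx r) = 0].

(** The map (a_r) |-> sum of the a_r z_r, and the evaluations of a family at r. *)
Definition fcomb I P (z : I -> P) (a : {ffun I -> A}) : P :=
  \sum_r mact (a r) (z r).
Fact fcomb_linear I P (z : I -> P) : linear (fcomb z).
Proof.
move=> k a b; rewrite /fcomb scaler_sumr -big_split; apply: eq_bigr => r _ /=.
by rewrite !ffunE mactDl mactZl.
Qed.
HB.instance Definition _ I P (z : I -> P) :=
  GRing.isSemilinear.Build K {ffun I -> A} P _ (fcomb z)
    (GRing.semilinear_linear (fcomb_linear z)).

Definition ffun_at I (r : I) (a : {ffun I -> A}) : A := a r.
Fact ffun_at_linear I (r : I) : linear (ffun_at r).
Proof. by move=> k a b; rewrite /ffun_at !ffunE. Qed.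
HB.instance Definition _ I (r : I) :=
  GRing.isSemilinear.Build K {ffun I -> A} A _ (@ffun_at I r)
    (GRing.semilinear_linear (ffun_at_linear r)).

(** The coefficient of z_r, normalized to lie in A e_(idx r). *)
Definition fcoord I (idx : I -> 'I_n) P (z : I -> P) (r : I) : 'Hom(P, A) :=
  (amulr (e (idx r)) \o (linfun (ffun_at r) \o (linfun (fcomb z))^-1))%VF.

(** The homomorphism sending each z_r to y_r. *)
Definition fext I (idx : I -> 'I_n) P (z : I -> P) N (y : I -> N) : 'Hom(P, N) :=
  \sum_r (linfun (mactr (y r)) \o fcoord idx z r)%VF.

Lemma mactr_hom N (y : N) : mod_hom (linfun (mactr y) : 'Hom(regular A, N)).
Proof. by move=> a b; rewrite !lfunE /= /mactr mactM. Qed.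

(** The submodule generated by the C_r z_r. *)
Definition Dsub I P (z : I -> P) (C : I -> left_ideal A) : submod P :=
  sum_sub predT (fun r => img_sub (mactr_hom (z r)) (C r)).

Lemma mem_Dsub_gen I P (z : I -> P) (C : I -> left_ideal A) r c :
  c \in (C r : {vspace A}) -> mact c (z r) \in (Dsub z C : {vspace P}).
Proof.
move=> Cc; apply: (subvP (sumv_sup r isT (subvv _))).
by rewrite -[mact _ _](lfunE (mactr (z r))) memv_img.
Qed.

Lemma Dsub_sub I P (z : I -> P) (C : I -> left_ideal A) (U : {vspace P}) :
  (forall r c, c \in (C r : {vspace A}) -> mact c (z r) \in U) ->
  (Dsub z C <= U)%VS.
Proof.
move=> CU; apply/subv_sumP => r _; apply/subvP => _ /memv_imgP[c Cc ->].
by rewrite lfunE; apply: CU.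
Qed.

Hypothesis e_idem : forall i, e i * e i = e i.

Section Theory.
Variables (I : finType) (idx : I -> 'I_n) (P : fdmod A) (z : I -> P).
Hypothesis hz : free_basis idx z.
Local Notation c_ := (fcoord idx z).

Let fcomb_onto : limg (linfun (fcomb z)) = fullv.
Proof.
apply/vspaceP => x; rewrite memvf; have [_ + _] := hz => /(_ x)[a ->].
by rewrite -[\sum_r _]/(fcomb z a) -[fcomb z a]lfunE memv_img ?memvf.
Qed.

Lemma fcoord_e r x : c_ r x * e (idx r) = c_ r x.
Proof. by rewrite /fcoord !comp_lfunE !lfunE /= -mulrA e_idem. Qed.

Lemma free_gen r : mact (e (idx r)) (z r) = z r.
Proof. by have [-> _ _] := hz. Qed.

Lemma mact_gen a r : mact (a * e (idx r)) (z r) = mact a (z r).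
Proof. by rewrite mactM free_gen. Qed.

Lemma fcoord_sum x : \sum_r mact (c_ r x) (z r) = x.
Proof.
pose a := ((linfun (fcomb z))^-1)%VF x.
have xE : linfun (fcomb z) a = x by rewrite limg_lfunVK ?fcomb_onto ?memvf.
rewrite -[RHS]xE lfunE /= /fcomb; apply: eq_bigr => r _.
by rewrite /fcoord !comp_lfunE !lfunE /= /ffun_at mact_gen.
Qed.

Lemma fcoord_uniq (a : I -> A) x : x = \sum_r mact (a r) (z r) ->
  forall r, c_ r x = a r * e (idx r).
Proof.
move=> xE r; apply/eqP; rewrite -[c_ r x]fcoord_e -subr_eq0 -mulrBl.
have [_ _ + ] := hz => /(_ [ffun r => c_ r x - a r])/(_ _ r).
rewrite ffunE => -> //; under eq_bigr => q _ do rewrite ffunE mactBl.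
by rewrite sumrB fcoord_sum -xE subrr.
Qed.

Lemma fcoord_mact a r q :
  c_ q (mact a (z r)) = if q == r then a * e (idx r) else 0.
Proof.
rewrite (@fcoord_uniq (fun q => if q == r then a else 0)).
  by case: eqP => [->|_] //; rewrite mul0r.
rewrite (bigD1 r) //= eqxx big1 ?addr0 // => p /negbTE->.
by rewrite mact0l.
Qed.

Lemma fcoord_gen r q : c_ q (z r) = if q == r then e (idx r) else 0.
Proof. by rewrite -{1}(free_gen r) fcoord_mact e_idem. Qed.

Lemma fcoordM a x r : c_ r (mact a x) = a * c_ r x.
Proof.
rewrite (@fcoord_uniq (fun q => a * c_ q x)) -?mulrA ?fcoord_e //.
rewrite -{1}[x]fcoord_sum linear_sum; apply: eq_bigr => q _.
by rewrite mactM.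
Qed.

Lemma fcoord_hom r : mod_hom (c_ r : 'Hom(P, regular A)).
Proof. by move=> a x; rewrite fcoordM. Qed.

Lemma fcoord_eq x y : (forall r, c_ r x = c_ r y) -> x = y.
Proof.
by move=> xy; rewrite -[x]fcoord_sum -[y]fcoord_sum; apply: eq_bigr => r _; rewrite xy.
Qed.

Lemma fextE N (y : I -> N) x : fext idx z y x = \sum_r mact (c_ r x) (y r).
Proof.
rewrite /fext sum_lfunE; apply: eq_bigr => r _.
by rewrite comp_lfunE lfunE.
Qed.

Lemma fext_hom N (y : I -> N) : mod_hom (fext idx z y).
Proof.
move=> a x; rewrite !fextE linear_sum; apply: eq_bigr => r _.
by rewrite fcoordM mactM.
Qed.

Lemma fext_mact N (y : I -> N) a r : mact (e (idx r)) (y r) = y r ->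
  fext idx z y (mact a (z r)) = mact a (y r).
Proof.
move=> ey; rewrite fextE (bigD1 r) //= big1 => [|q /negbTE qr].
  by rewrite fcoord_mact eqxx addr0 mactM ey.
by rewrite fcoord_mact qr mact0l.
Qed.

Lemma fext_gen N (y : I -> N) r : mact (e (idx r)) (y r) = y r ->
  fext idx z y (z r) = y r.
Proof. by move=> ey; rewrite -[z r]mact1 fext_mact ?mact1. Qed.

Lemma hom_coord N (f : 'Hom(P, N)) x : mod_hom f ->
  f x = \sum_r mact (c_ r x) (f (z r)).
Proof.
move=> hf; rewrite -{1}[x]fcoord_sum linear_sum; apply: eq_bigr => r _.
exact: hf.
Qed.

Lemma hom_eq N (f g : 'Hom(P, N)) : mod_hom f -> mod_hom g ->
  (forall r, f (z r) = g (z r)) -> f = g.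
Proof.
move=> hf hg fg; apply/lfunP => x; rewrite (hom_coord _ hf) (hom_coord _ hg).
by apply: eq_bigr => r _; rewrite fg.
Qed.

Lemma free_lift M N (g : 'Hom(M, N)) (f : 'Hom(P, N)) :
  mod_hom g -> limg g = fullv -> mod_hom f ->
  exists h : 'Hom(P, M), mod_hom h /\ forall x, g (h x) = f x.
Proof.
move=> hg img hf; pose y r := mact (e (idx r)) ((g^-1)%VF (f (z r))).
exists (fext idx z y); split=> [|x]; first exact: fext_hom.
rewrite -comp_lfunE; congr (fun_of_lfun _ x); apply: hom_eq => // [|r].
  by apply: hom_comp => //; apply: fext_hom.
rewrite comp_lfunE fext_gen; last by rewrite /y -mactM e_idem.
by rewrite hg limg_lfunVK ?img ?memvf // -hf free_gen.
Qed.

Lemma mem_Dsub (C : I -> left_ideal A) :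
  (forall r c, c \in (C r : {vspace A}) -> c * e (idx r) = c) ->
  forall x, x \in (Dsub z C : {vspace P}) <->
            forall r, c_ r x \in (C r : {vspace A}).
Proof.
move=> Ce x; split=> [/memv_sumP[u Uu ->] r|Cx].
  rewrite linear_sum; apply: rpred_sum => q _.
  have /memv_imgP[c Cc ->] := Uu q isT; rewrite lfunE /= /mactr fcoord_mact.
  by case: eqP => [->|_]; rewrite ?mem0v // Ce.
rewrite -[x]fcoord_sum; apply: rpred_sum => r _; exact: mem_Dsub_gen.
Qed.

Lemma dim_Dsub (C : I -> left_ideal A) :
  (forall r c, c \in (C r : {vspace A}) -> c * e (idx r) = c) ->
  \dim (Dsub z C : {vspace P}) = (\sum_r \dim (C r : {vspace A}))%N.
Proof.
move=> Ce; rewrite /= (directvP _) /=.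
  apply: eq_bigr => r _; apply: limg_dim_eq; apply/vspaceP => c.
  rewrite memv_cap memv_ker memv0 lfunE /=; apply/andP/eqP => [[Cc /eqP c0]|->].
    have := fcoord_mact c r r; rewrite -[mact c _]/(mactr (z r) c) c0 linear0.
    by rewrite eqxx Ce.
  by rewrite mem0v linear0.
apply/directv_sum_independent => u Uu u0 r _.
have uE q : exists2 c, c \in (C q : {vspace A}) & u q = mact c (z q).
  have /memv_imgP[c Cc ->] := Uu q isT; exists c => //.
  by rewrite lfunE.
have : c_ r (\sum_q u q) = 0 by rewrite u0 linear0.
rewrite linear_sum (bigD1 r) //= big1 => [|q qr].
  have [c Cc ->] := uE r; rewrite fcoord_mact eqxx addr0 Ce // => ->.
  by rewrite mact0l.
by have [c _ ->] := uE q; rewrite fcoord_mact eq_sym (negbTE qr).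
Qed.

End Theory.

End FreeBasis.

(** * The Jacobson radical and primitive idempotents *)

Section Jacobson.
Variables (K : fieldType) (A : falgType K) (J : left_ideal A).
Hypothesis hJ : is_jacobson J.
Implicit Types (M N : fdmod A).
Local Notation inJ x := (x \in (J : {vspace A})).

Lemma jacobson_mulr j a : inJ j -> inJ (j * a).
Proof.
move=> Jj; apply: (iffRL (hJ _)) => L [nL mL].
have nL' : (L : {vspace regular A}) != fullv by apply/eqP.
by apply: (subvP (jacobson_max hJ nL' mL)); apply: (mem_rad (M := regular A)).
Qed.

Lemma rad_regular : (rad J (regular A) <= J)%VS.
Proof. by apply: rad_sub => j x Jj; apply: jacobson_mulr. Qed.

Lemma jacobson_powS k : (J ^+ k.+2 <= J ^+ k.+1)%VS.
Proof.
rewrite expvSr; apply/prodvP; elim: k => [|k IH] x j.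
  by rewrite expv1 => Jx Jj; apply: jacobson_mulr.
rewrite expvSl => Jx Jj.
have : x * j \in (J * J ^+ k.+1 * J)%VS by apply: memv_mul.
rewrite -prodvA; apply: subvP; apply: prodvSr; apply/prodvP; exact: IH.
Qed.

Fact jacobson_pow_stable k a (x : regular A) :
  x \in (J ^+ k.+1)%VS -> mact a x \in (J ^+ k.+1)%VS.
Proof.
rewrite expvSl => Jx.
have : a * x \in (fullv * (J * J ^+ k))%VS by rewrite memv_mul ?memvf.
rewrite prodvA; apply: subvP; apply: prodvSl; apply/prodvP => b j _ Jj.
exact: idealM.
Qed.
Definition jacobson_pow k : left_ideal A := SubMod (@jacobson_pow_stable k).

(** J is nilpotent: the powers of J descend strictly until they are zero, by
    Nakayama's lemma applied to J^(k+1) as a left module. *)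
Lemma jacobson_nil : exists k, (J ^+ k = 0)%VS.
Proof.
suff H k : (J ^+ k.+1 = 0)%VS \/ (\dim (J ^+ k.+1)%VS + k <= \dim {:A})%N.
  exists (\dim {:A}).+1; have [//|le] := H (\dim {:A}).
  apply/eqP; rewrite -dimv_eq0.
  by rewrite -leqn0 -(leq_add2r (\dim {:A})) add0n.
elim: k => [|k [J0|le]].
- by right; rewrite addn0 dimvS ?subvf.
- by left; rewrite expvSr J0 prod0v.
have [eqJ|neqJ] := eqVneq (J ^+ k.+2)%VS (J ^+ k.+1)%VS.
  left; rewrite eqJ; pose L := jacobson_pow k.
  have radL : (0 + rad J (sub_mod L))%VS = fullv.
    rewrite add0v; apply/eqP; rewrite eqEsubv subvf /=.
    apply/subvP => u _; have Ju : vsval u \in (J * J ^+ k.+1)%VS.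
      have JE : (J * J ^+ k.+1 = J ^+ k.+1)%VS by rewrite -expvSl.
      rewrite [X in _ \in pred_of_vspace X]JE; exact: subvsP.
    have : (J * J ^+ k.+1 <= sub_incl L @: rad J (sub_mod L))%VS.
      apply/prodvP => j x Jj Jx; have xE : vsval (vsproj L x) = x.
        by rewrite vsprojK.
      rewrite -xE -[j * _]/(mact (f := regular A) j _) -sub_actE -sub_inclE.
      by rewrite memv_img // (mem_rad (M := sub_mod L)).
    move=> /subvP/(_ _ Ju)/memv_imgP[v rv]; rewrite sub_inclE => /val_inj->.
    by [].
  have zs a (x : sub_mod L) : x \in 0%VS -> mact a x \in 0%VS.
    by rewrite !memv0 => /eqP->; rewrite linear0.
  have /= := @nakayama _ _ _ hJ _ (SubMod zs) radL.
  move=> z0; apply/vspaceP => x; rewrite memv0; apply/idP/eqP => [Jx|->]; last exact: mem0v.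
  have : vsproj L x \in (0%VS : {vspace sub_mod L}) by rewrite z0 memvf.
  rewrite memv0 => /eqP x0; have : vsval (vsproj L x) = x by rewrite vsprojK.
  by rewrite x0.
right; rewrite addnS; apply: leq_trans le; rewrite ltn_add2r.
have [le eqd] := dimv_leqif_eq (jacobson_powS k).
by rewrite ltn_neqAle le andbT eqd.
Qed.

Lemma jacobson_nilp x : inJ x -> exists k, x ^+ k = 0.
Proof.
move=> Jx; have [k Jk] := jacobson_nil; exists k; apply/eqP; rewrite -memv0 -Jk.
elim: k {Jk} => [|k IH]; first by rewrite expv0 expr0 memv_line.
by rewrite expvSl exprS memv_mul.
Qed.

End Jacobson.

Section Primitive.
Variables (K : fieldType) (A : falgType K).

(** The powers of y span a finite-dimensional space, so that some y^k is a
    multiple of y^(k+1). *)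
Lemma pow_stab (y : A) : exists k w, y ^+ k = y ^+ k.+1 * w /\ w * y = y * w.
Proof.
pose X := [tuple y ^+ i | i < (\dim {:A}).+1].
have XE (i : 'I_(\dim {:A}).+1) : X`_i = y ^+ i.
  by rewrite -tnth_nth tnth_mktuple.
have : ~~ free X.
  apply/negP => fX; have := dimvS (subvf <<X>>%VS).
  by rewrite (eqP fX) size_tuple ltnn.
rewrite freeNE => /existsP[i]; rewrite XE => yi.
have : (<<drop i.+1 X>> <= amull (y ^+ i.+1) @: 'C[y])%VS.
  apply/span_subvP => x; move=> /(nthP 0)[k]; rewrite size_drop size_tuple nth_drop.
  rewrite ltn_subRL => lt <-; have := XE (Ordinal lt) => /= ->.
  apply/memv_imgP; exists (y ^+ k); first exact: cent1vX.
  by rewrite lfunE /= -exprD.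
move=> /subvP/(_ _ yi)/memv_imgP[w /cent1vP Cw]; rewrite lfunE /= => yE.
by exists i, w.
Qed.

(** Fitting's lemma: for a primitive idempotent f, an element of f A f is nilpotent
    or invertible. *)
Lemma prim_fitting (f y : A) : primitive_idempotent f -> f * y = y -> y * f = y ->
  (exists k, y ^+ k = 0) \/
  exists u, [/\ f * u = u, u * f = u, y * u = f & u * y = f].
Proof.
move=> [ff nf prim] fy yf; have [k [w [yk cw]]] := pow_stab y.
have cyw i j : GRing.comm (y ^+ i) (w ^+ j) by apply/commrX/commr_sym/commrX.
have step j : y ^+ k = y ^+ (k + j) * w ^+ j.
  elim: j => [|j IH]; first by rewrite addn0 mulr1.
  have -> : y ^+ (k + j.+1) = y ^+ j * y ^+ k.+1.
    by rewrite -exprD addnC addSn addnS.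
  by rewrite (exprS w) mulrA -(mulrA (y ^+ j)) -yk -exprD addnC.
(* the idempotent of the Fitting decomposition *)
pose g := y ^+ k.+1 * w ^+ k.+1.
have fg : f * g = g by rewrite /g mulrA (exprS y) (mulrA f) fy.
have gf : g * f = g by rewrite /g cyw (exprSr y) mulrA -mulrA yf.
have yg : y ^+ k.+1 * g = y ^+ k.+1.
  by rewrite /g mulrA -exprD addSn exprS -mulrA -step -exprS.
have gg : g * g = g by rewrite {1}/g cyw -mulrA yg -cyw.
have hh : (f - g) * (f - g) = f - g.
  by rewrite mulrBl !mulrBr ff fg gf gg subrr subr0.
have [g0|fg0] : g = 0 \/ f - g = 0.
- apply: prim => //; first by rewrite mulrBr gf gg subrr.
    by rewrite mulrBl fg gg subrr.
  by rewrite addrC subrK.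
- by left; exists k.+1; rewrite -yg g0 mulr0.
have gE : g = f by apply/esym/eqP; rewrite -subr_eq0 fg0.
right; exists (f * (y ^+ k * w ^+ k.+1) * f); split.
- by rewrite !mulrA ff.
- by rewrite -!mulrA ff.
- by rewrite !mulrA yf -exprS -/g gf.
have cy : w ^+ k.+1 * y = y * w ^+ k.+1 by rewrite -{1}[y]expr1 -cyw expr1.
by rewrite -!mulrA fy cy (mulrA (y ^+ k)) -exprSr -/g fg.
Qed.

End Primitive.

Lemma cyc_regP (K : fieldType) (A : falgType K) (x a : A) :
  a \in (cyc (x : regular A) : {vspace A}) <-> exists b, a = b * x.
Proof. exact: (iff_sym (rwP (@cyc_vsP K A (regular A) x a))). Qed.

Import passmx.

Lemma eigen_exists (K : closedFieldType) (V : vectType K) (f : 'End(V)) :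
  (0 < \dim {:V})%N -> exists k v, v != 0 /\ f v = k *: v.
Proof.
move=> V0; pose b := vbasis {:V}.
have bb : basis_of {:V} b by apply: vbasisP.
have [|k] := @closed_rootP _ (char_poly (mxof b b f)) _.
  by rewrite size_char_poly eqSS -lt0n.
rewrite -eigenvalue_root_char => /eigenvalueP[u uE nu].
exists k, (vecof b u); split; first by rewrite (vecof_eq0 bb).
by move: uE; rewrite mul_mxof => /(congr1 (vecof b)); rewrite (rVofK bb) linearZ.
Qed.

Section PrimDich.
Variables (K : fieldType) (A : falgType K) (J : left_ideal A).
Hypothesis hJ : is_jacobson J.

Lemma nilp_mem (L : left_ideal A) (y x : A) k :
  y ^+ k = 0 -> x - y * x \in (L : {vspace A}) -> x \in (L : {vspace A}).
Proof.
move=> yk Lx; suff H j : x - y ^+ j * x \in (L : {vspace A}).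
  by have := H k; rewrite yk mul0r subr0.
elim: j => [|j IH]; first by rewrite expr0 mul1r subrr mem0v.
have -> : x - y ^+ j.+1 * x = (x - y ^+ j * x) + y ^+ j * (x - y * x).
  by rewrite mulrBr mulrA -exprSr addrA subrK.
by rewrite rpredD // idealM.
Qed.

(** An element of f A g, with f and g primitive idempotents, is either in the
    Jacobson radical or invertible. *)
Lemma prim_dich (f g x : A) : primitive_idempotent f -> primitive_idempotent g ->
  f * x = x -> x * g = x ->
  x \in (J : {vspace A}) \/
  exists y, [/\ g * y = y, y * f = y, x * y = f & y * x = g].
Proof.
move=> pf pg fx xg; have [ff nf _] := pf; have [gg ng primg] := pg.
have [|nJx] := boolP (x \in (J : {vspace A})); [by left | right].
(* x is outside some maximal left ideal L, so that 1 - a x is in L for some a; then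
   x a f is not nilpotent, hence invertible in f A f, and x has a right inverse. *)
have [L [mL nLx]] : exists L : left_ideal A,
    maximal_left_ideal L /\ x \notin (L : {vspace A}).
  apply: NNPP => nex; case/negP: nJx; apply: (iffRL (hJ _)) => L mL.
  by apply: contraT => nLx; case: nex; exists L.
have [nL maxL] := mL.
have [l [a [Ll E1]]] : exists l a, l \in (L : {vspace A}) /\ 1 = l + a * x.
  pose Ax : left_ideal A := cyc (x : regular A).
  have [LE|full] := maxL (add_sub L Ax) (addvSl _ _).
    case/negP: nLx; rewrite -LE; apply: (subvP (addvSr _ _)).
    by apply/cyc_regP; exists 1; rewrite mul1r.
  have : 1 \in (add_sub L Ax : {vspace A}) by rewrite full memvf.
  by move=> /memv_addP[l Ll [_ /cyc_regP[a ->] ->]]; exists l, a.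
pose m := x * (a * f).
have fm : f * m = m by rewrite /m mulrA fx.
have mf : m * f = m by rewrite /m -!mulrA ff.
have mx : m * x = x * (a * x) by rewrite /m -!mulrA fx.
have Lx : x - m * x \in (L : {vspace A}).
  by rewrite mx -{1}[x]mulr1 -mulrBr E1 addrK idealM.
have [[k mk]|[u [fu uf mu um]]] := prim_fitting pf fm mf.
  by case/negP: nLx; exact: nilp_mem mk Lx.
exists (g * (a * f) * u); have xy : x * (g * (a * f) * u) = f.
  by rewrite !mulrA xg -(mulrA x) -/m mu.
have idp : g * (a * f) * u * x * (g * (a * f) * u * x) = g * (a * f) * u * x.
  by rewrite -[LHS]mulrA (mulrA x) xy fx.
split=> //; first by rewrite !mulrA gg.
  by rewrite -!mulrA uf.
(* y x is a nonzero idempotent of g A g, hence equal to g *)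
set y := g * (a * f) * u in xy idp *.
have gy : g * (y * x) = y * x by rewrite /y !mulrA gg.
have yg : (y * x) * g = y * x by rewrite -mulrA xg.
have [|||||yx0|/eqP] := primg (y * x) (g - y * x).
- exact: idp.
- by rewrite mulrBl !mulrBr gg gy yg idp subrr subr0.
- by rewrite mulrBr yg idp subrr.
- by rewrite mulrBl gy idp subrr.
- by rewrite addrC subrK.
- by case: nf; rewrite -ff -{1}xy -xy mulrA -(mulrA x) yx0 mulr0 mul0r.
by rewrite subr_eq0 => /eqP.
Qed.

End PrimDich.

Section Basic.
Variables (K : closedFieldType) (A : falgType K) (n : nat).
Variables (J : left_ideal A) (e : 'I_n -> A).
Hypothesis hJ : is_jacobson J.
Hypothesis he : basic_with e.
Local Notation inJ x := (x \in (J : {vspace A})).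

Lemma e_prim i : primitive_idempotent (e i).
Proof. by have [[_ + _] _] := he => /(_ i). Qed.
Lemma e_idem i : e i * e i = e i.
Proof. by have [] := e_prim i. Qed.
Lemma e_orth i j : i != j -> e i * e j = 0.
Proof. by move=> /negbTE ij; have [[+ _ _] _] := he => /(_ i j); rewrite ij. Qed.
Lemma e_sum : \sum_i e i = 1.
Proof. by have [[_ _ +] _] := he. Qed.
Lemma e_neq0 i : e i != 0.
Proof. by have [_ /eqP] := e_prim i. Qed.

Lemma e_notJ i : ~~ inJ (e i).
Proof.
apply/negP => /(jacobson_nilp hJ)[k]; have := e_idem i; move: (e_neq0 i).
move: (e i) => f nf ff; case: k => [|k].
  by rewrite expr0 => /eqP; rewrite oner_eq0.
have -> : f ^+ k.+1 = f by elim: k => [|k IH] //; rewrite exprS IH ff.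
by move/eqP; rewrite (negbTE nf).
Qed.

Fact lam_memP i a : a \in (Lam_ideal (e i) : {vspace A}) <-> a * e i = a.
Proof.
split=> [/cyc_regP[b ->]|aE]; first by rewrite -mulrA e_idem.
by apply/cyc_regP; exists a.
Qed.

(** The generator of A e_i, which is a basis of it. *)
Definition lam_gen i : Lam (e i) := vsproj (Lam_ideal (e i)) (e i).
Lemma lam_genE i : vsval (lam_gen i) = e i.
Proof. by rewrite vsprojK //; apply/lam_memP; rewrite e_idem. Qed.

Lemma lam_actE i a : vsval (mact a (lam_gen i)) = a * e i.
Proof. by rewrite sub_actE lam_genE. Qed.

Lemma lam_free i : free_basis e (fun _ : 'I_1 => i) (fun _ => lam_gen i).
Proof.
split=> [_|x|a]; first by apply: subvs_inj; rewrite lam_actE lam_genE e_idem.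
  exists [ffun _ => vsval x]; rewrite big_ord1 ffunE; apply: val_inj.
  by rewrite /= lam_actE; apply/esym/lam_memP; apply: subvsP.
by rewrite big_ord1 => a0 r; rewrite ord1 -lam_actE a0.
Qed.

(** Right multiplication by x in e_i A e_k, as a map from A e_i to A e_k. *)
Lemma lam_hom i k x : e i * x = x -> x * e k = x ->
  exists f : 'Hom(Lam (e i), Lam (e k)), mod_hom f /\
    forall u, vsval (f u) = vsval u * x.
Proof.
move=> ex xe; have lx : x \in (Lam_ideal (e k) : {vspace A}) by apply/lam_memP.
pose y : 'I_1 -> Lam (e k) := fun _ => vsproj (Lam_ideal (e k)) x.
have yE r : vsval (y r) = x by rewrite vsprojK.
exists (fext e (fun _ : 'I_1 => i) (fun _ => lam_gen i) y); split.
  exact/fext_hom/lam_free/e_idem.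
move=> u; have [_ /(_ u)[a ->] _] := lam_free i; rewrite big_ord1.
rewrite (@fext_mact _ _ _ _ e_idem _ _ _ _ (lam_free i) _ y _ ord0); last first.
  by apply: subvs_inj; rewrite sub_actE yE.
by rewrite sub_actE yE lam_actE -mulrA ex.
Qed.

Lemma e_dich i k x : e i * x = x -> x * e k = x -> inJ x \/
  i = k /\ exists y, [/\ e k * y = y, y * e i = y, x * y = e i & y * x = e k].
Proof.
move=> ex xe; have [|[y [ey ye xy yx]]] := prim_dich hJ (e_prim i) (e_prim k) ex xe.
  by left.
right; split; last by exists y.
have [_ inj] := he; apply: inj; have [f [hf fE]] := lam_hom ex xe.
have [g [hg gE]] := lam_hom ey ye.
exists f; split=> //; exists g => u; apply: subvs_inj.
  by rewrite gE fE -mulrA xy; apply/lam_memP/subvsP.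
by rewrite fE gE -mulrA yx; apply/lam_memP/subvsP.
Qed.

(** As the algebra is basic, e_i A e_k contains no invertible element for i <> k. *)
Lemma e_offdiag i k x : i != k -> inJ (e i * x * e k).
Proof.
move=> /eqP ik; have [||//|[/ik]] := @e_dich i k (e i * x * e k) => //.
  by rewrite !mulrA e_idem.
by rewrite -!mulrA e_idem.
Qed.

Lemma e_local i x : e i * x = x -> x * e i = x -> ~~ inJ x ->
  exists y, [/\ e i * y = y, y * e i = y, x * y = e i & y * x = e i].
Proof. by move=> ex xe nJ; have [Jx|[_ //]] := e_dich ex xe; rewrite Jx in nJ. Qed.

(** The residue field of the local ring e_i A e_i is K: an eigenvalue k of right
    multiplication by y on A e_i makes y - k e_i a zero divisor, hence not a unit. *)
Lemma e_residue i x : exists k : K, inJ (e i * x * e i - k *: e i).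
Proof.
set y := e i * x * e i.
have ey : e i * y = y by rewrite /y !mulrA e_idem.
have ye : y * e i = y by rewrite /y -!mulrA e_idem.
have [f [_ fE]] := lam_hom ey ye.
have [|k [v [nv fv]]] := @eigen_exists _ _ f.
  rewrite lt0n dimv_eq0; apply/eqP => /vspaceP/(_ (lam_gen i)).
  rewrite memvf memv0 => /esym/eqP g0; have := lam_genE i; rewrite g0.
  by move/esym/eqP; rewrite (negbTE (e_neq0 i)).
exists k; apply: contraT => nJ.
have [||u [_ _ uE _]]  := @e_local i (y - k *: e i) _ _ nJ.
- by rewrite mulrBr ey -scalerAr e_idem.
- by rewrite mulrBl ye -scalerAl e_idem.
case/eqP: nv; apply: subvs_inj; rewrite linear0.
have /lam_memP vE : vsval v \in (Lam_ideal (e i) : {vspace A}) by apply: subvsP.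
have fv' : vsval v * y = k *: vsval v by rewrite -fE fv linearZ.
move: (vsval v) vE fv' => /= w wE wy.
by rewrite -wE -uE mulrA mulrBr wy -scalerAr wE subrr mul0r.
Qed.

End Basic.

(** * Lifting isomorphisms and the uniqueness of decompositions *)

(** If a permutation matches the values of f with those of f', then a value of
    f' at a place where f and f' may differ is matched by a value of f at such
    a place: follow the cycle of the permutation backwards. *)
Lemma perm_cancel (I : finType) (T : Type) (R : T -> T -> Prop)
    (s : {perm I}) (f f' : I -> T) (S : pred I) :
  (forall x y w, R x y -> R y w -> R x w) ->
  (forall p, R (f p) (f' (s p))) -> (forall q, ~~ S q -> f' q = f q) ->
  forall q0, S q0 -> exists2 q, S q & R (f q) (f' q0).
Proof.
move=> trR fR fE q0 Sq0.
have H k : (exists2 q, S q & R (f q) (f' q0)) \/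
           R (f (((s^-1) ^+ k.+1)%g q0)) (f' q0).
  elim: k => [|k [|IH]]; first by right; rewrite expg1 -{2}(permKV s q0).
    by left.
  set p := ((s^-1) ^+ k.+1)%g q0 in IH.
  have [Sp|nSp] := boolP (S p); first by left; exists p.
  right; rewrite expgSr permM -/p; apply: trR IH.
  by rewrite -(fE p nSp) -{2}(permKV s p).
have [//|] := H (#[s^-1]%g).-1; rewrite prednK ?order_gt0 // expg_order perm1.
by move=> Rq; exists q0.
Qed.

(** By the Leibniz formula, an invertible matrix has a permutation along which
    its entries do not vanish. *)
Lemma inv_perm (K : fieldType) (I : finType) (g h : I -> I -> K) :
  (forall p q, \sum_r g p r * h r q = (p == q)%:R) ->
  exists s : {perm I}, forall p, g p (s p) != 0.
Proof.
move=> gh; pose M := \matrix_(i < #|I|, j < #|I|) g (enum_val i) (enum_val j).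
pose M' := \matrix_(i < #|I|, j < #|I|) h (enum_val i) (enum_val j).
have MM' : M *m M' = 1%:M.
  apply/matrixP => i j; rewrite !mxE.
  transitivity (\sum_r g (enum_val i) r * h r (enum_val j)).
    rewrite [RHS](reindex (@enum_val I I)) /=; first by apply: eq_bigr => k _; rewrite !mxE.
    by exists enum_rank => x _; rewrite ?enum_valK ?enum_rankK.
  by rewrite gh (inj_eq enum_val_inj).
have : \det M != 0.
  apply/eqP => M0; have := congr1 determinant MM'.
  by rewrite det_mulmx M0 mul0r det1 => /esym/eqP; rewrite oner_eq0.
have [/existsP[s /forallP sP] _|/existsPn nex /eqP[]] :=
  boolP [exists s : 'S_#|I|, forall i, M i (s i) != 0]; last first.
  rewrite /determinant big1 // => s _; have /forallPn[i] := nex s.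
  by rewrite negbK => /eqP Mi; rewrite (bigD1 i) //= Mi mul0r mulr0.
have fI : injective (fun p : I => enum_val (s (enum_rank p))).
  by move=> p q /enum_val_inj/perm_inj/enum_rank_inj.
exists (perm fI) => p; rewrite permE.
by have := sP (enum_rank p); rewrite mxE enum_rankK.
Qed.

Section Basic.
Variables (K : closedFieldType) (A : falgType K) (n : nat).
Variables (J : left_ideal A) (e : 'I_n -> A).
Hypothesis hJ : is_jacobson J.
Hypothesis he : basic_with e.
Local Notation inJ x := (x \in (J : {vspace A})).
Local Notation eid := (e_idem he).

Lemma resid_uniq i x (k l : K) : inJ (x - k *: e i) -> inJ (x - l *: e i) -> k = l.
Proof.
move=> Jk Jl; apply/eqP; rewrite -subr_eq0; apply: contraT => kl.
have : inJ ((k - l) *: e i).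
  have -> : (k - l) *: e i = (x - l *: e i) - (x - k *: e i).
    by rewrite scalerBl opprB [RHS]addrC addrA subrK.
  exact: rpredB.
by rewrite rpredZeq (negbTE kl) (negbTE (e_notJ hJ he i)).
Qed.

Lemma resid_ex i k x : e i * x = x -> x * e k = x ->
  exists c : K, inJ (x - c *: e i) /\ (i != k -> c = 0).
Proof.
move=> ex xe; have [ik|nik] := eqVneq i k.
  have [c Jc] := e_residue hJ he i x; exists c; split=> [|//].
  by move: Jc; rewrite ex ik xe.
exists 0; split=> //; rewrite scale0r subr0 -xe -ex.
exact: e_offdiag.
Qed.

Section Free.
Variables (I : finType) (idx : I -> 'I_n) (P : fdmod A) (z : I -> P).
Hypothesis hz : free_basis e idx z.
Local Notation c_ := (fcoord e idx z).

Lemma mem_radP x : x \in (rad J P : {vspace P}) <-> forall r, inJ (c_ r x).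
Proof.
split=> [Jx r|Jx].
  apply: (subvP (rad_regular hJ)).
  apply: (subvP (rad_img J (fcoord_hom eid hz r))).
  exact: memv_img.
rewrite -[x](fcoord_sum hz); apply: rpred_sum => r _.
exact: mem_rad.
Qed.

(** Isomorphisms between quotients of P by submodules of its radical lift to
    automorphisms of P. *)
Lemma lift_iso (C D : submod P) : (C <= rad J P)%VS -> (D <= rad J P)%VS ->
  mod_iso (quo C) (quo D) ->
  exists g : 'End(P), mod_aut g /\ (D : {vspace P}) = (g @: C)%VS.
Proof.
move=> Crad Drad CD; have [f [hf imf kf]] := mod_iso_quo_surj CD.
have [g [hg gE]] := free_lift eid hz hf imf (@qpi_hom K A P C).
have gsurj : limg g = fullv.
  apply: (nakayama hJ (U := img_sub hg (full_sub P))); apply/eqP.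
  rewrite eqEsubv subvf /=; apply/subvP => y _.
  have [x xE] := qpi_surj (f y).
  have Dyx : y - g x \in (D : {vspace P}).
    by rewrite -kf memv_ker linearB /= gE xE subrr.
  rewrite -(subrK (g x) y) addrC memv_add ?memv_img ?memvf //.
  exact: (subvP Drad).
have bg := surj_bij gsurj; exists g; split; first by [].
apply/esym/eqP; rewrite eqEdim; apply/andP; split.
  apply/subvP => _ /memv_imgP[x Cx ->].
  by rewrite -kf memv_ker gE qpi_eq0.
rewrite bij_dim // -(leq_add2r (\dim {:quo D})) dim_quo.
by rewrite -(mod_iso_dim CD) dim_quo.
Qed.

(** Modulo the radical, the endomorphism g of P is given by the scalar matrix c,
    which is block diagonal for the partition of the basis by idempotents. *)
Definition is_gamma (g : 'End(P)) (c : I -> I -> K) : Prop :=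
  forall p q, inJ (c_ q (g (z p)) - c p q *: e (idx p)) /\
              (idx p != idx q -> c p q = 0).

Lemma hom_gen_e (N : fdmod A) (g : 'Hom(P, N)) : mod_hom g ->
  forall p, mact (e (idx p)) (g (z p)) = g (z p).
Proof. by move=> hg p; rewrite -hg (free_gen hz). Qed.

Lemma coord_gen_e (g : 'End(P)) : mod_hom g ->
  forall p q, e (idx p) * c_ q (g (z p)) = c_ q (g (z p)).
Proof. by move=> hg p q; rewrite -(fcoordM eid hz) hom_gen_e. Qed.

Lemma gamma_ex (g : 'End(P)) : mod_hom g -> exists c, is_gamma g c.
Proof.
move=> hg; have H p q : exists c : K, inJ (c_ q (g (z p)) - c *: e (idx p)) /\
              (idx p != idx q -> c = 0).
  by apply: resid_ex; [apply: coord_gen_e | exact: (fcoord_e eid)].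
have [c cP] := fin_all_exists (fun p => fin_all_exists (H p)).
by exists c => p q; apply: cP.
Qed.

Lemma gamma_uniq g c c' : is_gamma g c -> is_gamma g c' -> forall p q, c p q = c' p q.
Proof.
by move=> hc hc' p q; apply: resid_uniq; [apply: (hc p q).1 | apply: (hc' p q).1].
Qed.

Lemma gamma_id : is_gamma \1%VF (fun p q => (p == q)%:R).
Proof.
move=> p q; rewrite id_lfunE (fcoord_gen eid hz) eq_sym.
case: eqVneq => [->|npq]; last by rewrite scale0r subrr mem0v.
by rewrite scale1r subrr mem0v eqxx.
Qed.

Lemma coord_comp (g h : 'End(P)) p q : mod_hom h ->
  c_ q (h (g (z p))) = \sum_r c_ r (g (z p)) * c_ q (h (z r)).
Proof.
move=> hh; rewrite (hom_coord hz _ hh) linear_sum; apply: eq_bigr => r _.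
by rewrite /= (fcoordM eid hz).
Qed.

Lemma gamma_comp g h c d : mod_hom g -> mod_hom h -> is_gamma g c -> is_gamma h d ->
  is_gamma (h \o g)%VF (fun p q => \sum_r c p r * d r q).
Proof.
move=> hg hh gc hd p q; split; last first.
  move=> pq; apply: big1 => r _; have [pr|pr] := eqVneq (idx p) (idx r).
    by rewrite (hd r q).2 ?mulr0 // -pr.
  by rewrite (gc p r).2 ?mul0r.
rewrite comp_lfunE coord_comp // scaler_suml -sumrB; apply: rpred_sum => r _.
have [Jc c0] := gc p r; have [Jd _] := hd r q.
set x := c_ r _ in Jc *; set y := c_ q _ in Jd *.
have -> : x * y - (c p r * d r q) *: e (idx p) =
    (x - c p r *: e (idx p)) * y + c p r *: (e (idx p) * (y - d r q *: e (idx r))).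
  have yE : e (idx r) * y = y by rewrite /y coord_gen_e.
  have [pr|/c0->] := eqVneq (idx p) (idx r); last first.
    by rewrite mul0r !scale0r !subr0 addr0.
  rewrite mulrBl mulrBr -scalerAl pr yE -scalerAr eid scalerBr scalerA.
  by rewrite addrA subrK.
apply: rpredD; last by rewrite rpredZ ?idealM.
exact: (jacobson_mulr hJ).
Qed.

Lemma gamma_aut (g : 'End(P)) : mod_aut g -> exists c d,
  [/\ is_gamma g c, is_gamma (g^-1)%VF d,
      forall p q, \sum_r c p r * d r q = (p == q)%:R &
      forall p q, \sum_r d p r * c r q = (p == q)%:R].
Proof.
move=> [hg bg]; have hV := hom_inv hg bg; have [gK gVK] := bij_lfunK bg.
have [c gc] := gamma_ex hg; have [d gd] := gamma_ex hV.
have E1 : (g^-1 \o g)%VF = \1%VF.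
  by apply/lfunP => x; rewrite comp_lfunE id_lfunE gK.
have E2 : (g \o g^-1)%VF = \1%VF.
  by apply/lfunP => x; rewrite comp_lfunE id_lfunE gVK.
exists c, d; split=> // p q.
  have := gamma_comp hg hV gc gd; rewrite E1 => h.
  exact: (gamma_uniq h gamma_id p q).
have := gamma_comp hV hg gd gc; rewrite E2 => h.
exact: (gamma_uniq h gamma_id p q).
Qed.

(** Pairs (i, X), with X a left ideal contained in A e_i, are equivalent when
    right multiplication by a unit of e_i A e_i carries one ideal to the other;
    equivalently, when the modules A e_i / X are isomorphic. *)
Definition lequiv (a b : 'I_n * left_ideal A) : Prop :=
  a.1 = b.1 /\ exists u v, [/\ e a.1 * u = u, u * e a.1 = u,
    e a.1 * v = v /\ v * e a.1 = v, u * v = e a.1 /\ v * u = e a.1 &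
    (amulr u @: a.2)%VS = b.2].

Lemma lequiv_trans a b c : lequiv a b -> lequiv b c -> lequiv a c.
Proof.
move=> [ab [u [v [eu ue [ev ve] [uv vu] aE]]]] [bc].
rewrite /lequiv -bc -ab -aE => -[u' [v' [eu' ue' [ev' ve'] [uv' vu'] cE]]].
split=> //; exists (u * u'), (v' * v).
split; rewrite ?mulrA ?eu ?ev' //; first by rewrite -mulrA ue'.
- by rewrite -mulrA ve.
- by rewrite -(mulrA u) uv' ue uv -(mulrA v') vu ve' vu'.
rewrite -cE -limg_comp; congr (_ @: _)%VS; apply/lfunP => x.
by rewrite comp_lfunE !lfunE /= mulrA.
Qed.

Lemma lequiv_dim a b : lequiv a b ->
  (forall x, x \in (a.2 : {vspace A}) -> x * e a.1 = x) ->
  \dim (a.2 : {vspace A}) = \dim (b.2 : {vspace A}).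
Proof.
move=> [_ [u [v [_ _ _ [uv _] <-]]]] ae; apply/esym/limg_dim_eq/vspaceP => x.
rewrite memv_cap memv_ker memv0 lfunE /=; apply/andP/eqP => [[ax /eqP x0]|->].
  by rewrite -(ae x ax) -uv mulrA x0 mul0r.
by rewrite mem0v mul0r.
Qed.

(** A Krull-Schmidt theorem: if an automorphism of P carries the direct sum of the
    C_p z_p to that of the C'_p z_p, then the summands agree up to a permutation
    and to units. The permutation is one along which the matrix of g modulo the
    radical does not vanish. *)
Lemma krull_schmidt (g : 'End(P)) (C C' : I -> left_ideal A) :
  (forall r c, c \in (C r : {vspace A}) -> c * e (idx r) = c) ->
  (forall r c, c \in (C' r : {vspace A}) -> c * e (idx r) = c) ->
  mod_aut g -> (g @: Dsub z C)%VS = Dsub z C' ->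
  exists s : {perm I}, forall p, lequiv (idx p, C p) (idx (s p), C' (s p)).
Proof.
move=> Ce Ce' ag gD; have [hg bg] := ag.
have [c [d [gc gd cd dc]]] := gamma_aut ag; have [s sP] := inv_perm cd.
have sidx p : idx p = idx (s p).
  apply/eqP; apply: contraT => npq; have := sP p.
  by rewrite (gc p (s p)).2 ?eqxx.
pose u p := c_ (s p) (g (z p)).
have eu p : e (idx p) * u p = u p by apply: coord_gen_e.
have ue p : u p * e (idx p) = u p by rewrite sidx; exact: (fcoord_e eid).
have uJ p : ~~ inJ (u p).
  apply/negP => Ju; have [Jc _] := gc p (s p); have := sP p.
  have : inJ (c p (s p) *: e (idx p)).
    by rewrite -(subKr (u p) (_ *: _)); apply: rpredB.
  by rewrite rpredZeq (negbTE (e_notJ hJ he _)) orbF => ->.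
have sub p : (amulr (u p) @: C p <= C' (s p))%VS.
  apply/subvP => _ /memv_imgP[x Cx ->]; rewrite lfunE /=.
  have : g (mact x (z p)) \in (Dsub z C' : {vspace P}).
    by rewrite -gD memv_img // mem_Dsub_gen.
  move/(mem_Dsub eid hz Ce')/(_ (s p)).
  by rewrite hg (fcoordM eid hz).
have uV p : exists v, [/\ e (idx p) * v = v, v * e (idx p) = v,
    u p * v = e (idx p) & v * u p = e (idx p)] by apply: (e_local hJ he).
have dimu p : \dim (amulr (u p) @: C p)%VS = \dim (C p : {vspace A}).
  have [v [_ _ uv _]] := uV p; apply/limg_dim_eq/vspaceP => x.
  rewrite memv_cap memv_ker memv0 lfunE /=; apply/andP/eqP => [[ax /eqP x0]|->].
    by rewrite -(Ce p x ax) -uv mulrA x0 mul0r.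
  by rewrite mem0v mul0r.
have [_ eqs] := leqif_sum (fun p (_ : xpredT p) => dimv_leqif_eq (sub p)).
have : (\sum_p \dim (amulr (u p) @: C p)%VS == \sum_p \dim (C' (s p) : {vspace A}))%N.
  under eq_bigr => p _ do rewrite dimu.
  rewrite -(dim_Dsub eid hz Ce) -(bij_dim _ bg) gD (dim_Dsub eid hz Ce').
  by rewrite (reindex_inj (@perm_inj _ s)).
rewrite eqs => /forallP eqC; exists s => p; split; first exact: sidx.
have [v [ev ve uv vu]] := uV p; exists (u p), v.
by split=> //; have /= /eqP := eqC p.
Qed.

End Free.
End Basic.

(** * One-parameter limits force a nested direct sum *)

Section Limit.
Variables (K : fieldType) (A : falgType K) (P : fdmod A).

(** For a projection f commuting with A, the limit for s -> 0 of the images of C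
    under f + s (1 - f). *)
Definition lim_sub (f : 'End(P)) (hf : mod_hom f) (C : submod P) : submod P :=
  add_sub (img_sub hf C) (cap_sub C (ker_sub hf)).

Lemma rmul_hom (x : A) : mod_hom (amulr x : 'Hom(regular A, regular A)).
Proof. by move=> a c; rewrite !lfunE /= mulrA. Qed.

End Limit.

Section Basic.
Variables (K : closedFieldType) (A : falgType K) (n : nat).
Variables (J : left_ideal A) (e : 'I_n -> A).
Hypothesis hJ : is_jacobson J.
Hypothesis he : basic_with e.
Local Notation inJ x := (x \in (J : {vspace A})).
Local Notation eid := (e_idem he).

Section Free.
Variables (I : finType) (idx : I -> 'I_n) (P : fdmod A) (z : I -> P).
Hypothesis hz : free_basis e idx z.
Local Notation c_ := (fcoord e idx z).

(** The projection onto A z_r, and the complementary one. *)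
Definition gen_proj (r : I) : 'End(P) := (linfun (mactr (z r)) \o c_ r)%VF.
Definition cogen_proj (r : I) : 'End(P) := \1%VF - gen_proj r.

Lemma gen_projE r x : gen_proj r x = mact (c_ r x) (z r).
Proof. by rewrite comp_lfunE lfunE. Qed.

Lemma cogen_projE r x : cogen_proj r x = x - mact (c_ r x) (z r).
Proof. by rewrite add_lfunE opp_lfunE id_lfunE gen_projE. Qed.

Lemma gen_proj_hom r : mod_hom (gen_proj r).
Proof. by move=> a x; rewrite !gen_projE (fcoordM eid hz) mactM. Qed.

Lemma cogen_proj_hom r : mod_hom (cogen_proj r).
Proof. by move=> a x; rewrite !cogen_projE (fcoordM eid hz) mactM linearB. Qed.

Lemma fcoord_gen_proj r q x : c_ q (gen_proj r x) = if q == r then c_ q x else 0.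
Proof.
rewrite gen_projE (fcoord_mact eid hz); case: eqP => [->|//].
exact: (fcoord_e eid).
Qed.

Lemma fcoord_cogen_proj r q x :
  c_ q (cogen_proj r x) = if q == r then 0 else c_ q x.
Proof.
have -> : cogen_proj r x = x - gen_proj r x by rewrite cogen_projE gen_projE.
rewrite linearB /= fcoord_gen_proj; case: eqP => _; last exact: subr0.
by rewrite subrr.
Qed.

(** The limit for s -> 0 of the images of C under the automorphisms which multiply
    z_r by s and fix the other basis elements. *)
Definition lim_gen r (C : submod P) := lim_sub (cogen_proj_hom r) C.

Lemma lim_gen_rad r (C : submod P) : (C <= rad J P)%VS -> (lim_gen r C <= rad J P)%VS.
Proof.
move=> Crad; rewrite subv_add; apply/andP; split.
  exact: subv_trans (limgS _ Crad) (rad_img J (cogen_proj_hom r)).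
exact: subv_trans (capvSl _ _) Crad.
Qed.

Variable M : fdmod A.

(** All these limits, for all presentations of M as a quotient of P, are again
    presentations of M. *)
Definition lim_stable : Prop := forall C : submod P, (C <= rad J P)%VS ->
  mod_iso M (quo C) -> forall r, mod_iso M (quo (lim_gen r C)).

Hypothesis hM : lim_stable.

(** Taking the limits for all r successively, the submodule becomes a direct sum of
    submodules of the A z_r. *)
Lemma lim_gen_diag (C : submod P) : (C <= rad J P)%VS -> mod_iso M (quo C) ->
  exists C' : I -> left_ideal A,
    [/\ forall r c, c \in (C' r : {vspace A}) -> c * e (idx r) = c,
        (Dsub z C' <= rad J P)%VS & mod_iso M (quo (Dsub z C'))].
Proof.
move=> Crad MC.
have H (s : seq I) : exists D : submod P, [/\ (D <= rad J P)%VS, mod_iso M (quo D) &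
    forall r, r \in s -> (gen_proj r @: D <= D)%VS].
  elim: s => [|r s [D [Drad MD sD]]]; first by exists C.
  have cw w : cogen_proj r w = 0 -> forall p, p != r -> c_ p w = 0.
    move=> w0 p /negbTE pr; have := fcoord_cogen_proj r p w.
    by rewrite pr w0 linear0.
  exists (lim_gen r D); split; [exact: lim_gen_rad | exact: hM |].
  move=> q; rewrite inE => /orP[/eqP-> {q}|qs]; apply/subvP => _ /memv_imgP[x + ->].
    move=> /memv_addP[_ /memv_imgP[y Dy ->] [w]]; rewrite memv_cap memv_ker.
    move=> /andP[Dw /eqP w0] ->; have -> : gen_proj r (cogen_proj r y + w) = w.
      apply: (fcoord_eq hz) => p; rewrite fcoord_gen_proj linearD /=.
      rewrite fcoord_cogen_proj.
      by have [E|/(cw _ w0)->] := eqVneq p r; rewrite ?add0r.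
    apply: (subvP (addvSr _ _)); rewrite memv_cap Dw memv_ker.
    by rewrite w0 eqxx.
  move=> /memv_addP[_ /memv_imgP[y Dy ->] [w]]; rewrite memv_cap memv_ker.
  move=> /andP[Dw /eqP w0] ->; rewrite linearD /=; apply: memv_add.
    have -> : gen_proj q (cogen_proj r y) = cogen_proj r (gen_proj q y).
      apply: (fcoord_eq hz) => p; rewrite !(fcoord_gen_proj, fcoord_cogen_proj).
      by case: (p == q); case: (p == r).
    by rewrite memv_img // (subvP (sD q qs)) // memv_img.
  rewrite memv_cap (subvP (sD q qs)) ?memv_img //= memv_ker; apply/eqP.
  apply: (fcoord_eq hz) => p; rewrite linear0 fcoord_cogen_proj fcoord_gen_proj.
  by have [//|/(cw _ w0)->] := eqVneq p r; case: (p == q).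
have [D [Drad MD sD]] := H (enum I).
pose C' r : left_ideal A := img_sub (fcoord_hom eid hz r) D.
have C'e r c : c \in (C' r : {vspace A}) -> c * e (idx r) = c.
  by move=> /memv_imgP[x _ ->]; apply: (fcoord_e eid).
have DE : D = Dsub z C' :> {vspace P}.
  apply/eqP; rewrite eqEsubv; apply/andP; split.
    by apply/subvP => x Dx; apply/(mem_Dsub eid hz C'e) => r; apply: memv_img.
  apply: Dsub_sub => r _ /memv_imgP[x Dx ->]; rewrite -gen_projE.
  by apply: (subvP (sD r _)); rewrite ?mem_enum ?memv_img.
exists C'; split; rewrite -?DE //; apply: mod_iso_trans MD _.
exact: quo_eq_iso.
Qed.

Section Twist.
Variables (C : I -> left_ideal A).
Hypothesis Ce : forall r c, c \in (C r : {vspace A}) -> c * e (idx r) = c.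
Hypothesis Crad : (Dsub z C <= rad J P)%VS.
Hypothesis MC : mod_iso M (quo (Dsub z C)).
Variables (p q : I) (x : A).
Hypothesis npq : p != q.
Hypothesis xe : x * e (idx q) = x.

(** The left ideals C_p x^(-1) within C_p, and C_p x + C_q. *)
Definition tw_cap : left_ideal A := cap_sub (C p) (preim_sub (rmul_hom x) (C q)).
Definition tw_add : left_ideal A := add_sub (img_sub (rmul_hom x) (C p)) (C q).

Lemma mem_tw_cap c : (c \in (tw_cap : {vspace A})) =
  (c \in (C p : {vspace A})) && (c * x \in (C q : {vspace A})).
Proof. by rewrite memv_cap -memv_preim lfunE. Qed.

Lemma mem_tw_add c : c \in (tw_add : {vspace A}) <-> exists c1 c2,
  [/\ c1 \in (C p : {vspace A}), c2 \in (C q : {vspace A}) & c = c1 * x + c2].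
Proof.
split=> [/memv_addP[_ /memv_imgP[c1 Cc1 ->] [c2 Cc2 ->]]|[c1 [c2 [Cc1 Cc2 ->]]]].
  by exists c1, c2; rewrite lfunE.
apply: memv_add => //; apply/memv_imgP; exists c1 => //.
by rewrite lfunE.
Qed.

(** The family C with C_p and C_q replaced by these two ideals. *)
Definition twist : I -> left_ideal A :=
  fun r => if r == p then tw_cap else if r == q then tw_add else C r.

Lemma twist_e r c : c \in (twist r : {vspace A}) -> c * e (idx r) = c.
Proof.
rewrite /twist; case: eqP => [->|_].
  by rewrite mem_tw_cap => /andP[/Ce].
case: eqP => [->|_]; last exact: Ce.
by move=> /mem_tw_add[c1 [c2 [_ /Ce c2e ->]]]; rewrite mulrDl c2e -mulrA xe.
Qed.

(* g maps z_p to z_p + x z_q and fixes the other basis elements; nu = g - 1. *)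
Let nu : 'End(P) := (linfun (mactr (mact x (z q))) \o c_ p)%VF.
Let nuE y : nu y = mact (c_ p y * x) (z q).
Proof. by rewrite comp_lfunE lfunE /= /mactr mactM. Qed.
Let nu_hom : mod_hom nu.
Proof. by move=> a y; rewrite !nuE (fcoordM eid hz) -mulrA mactM. Qed.
Let nu2 y : nu (nu y) = 0.
Proof. by rewrite {1}nuE nuE (fcoord_mact eid hz) (negbTE npq) mul0r mact0l. Qed.
Let g : 'End(P) := \1%VF + nu.
Let gE y : g y = y + nu y.
Proof. by rewrite add_lfunE id_lfunE. Qed.
Let g_hom : mod_hom g.
Proof. exact: hom_add (hom_id (M := P)) nu_hom. Qed.
Let g_bij : bijective g.
Proof.
exists (\1%VF - nu) => y; rewrite add_lfunE opp_lfunE id_lfunE gE.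
  by rewrite linearD /= nu2 addr0 addrK.
by rewrite linearB /= nu2 subr0 subrK.
Qed.
Let c_nu r y : c_ r (nu y) = if r == q then c_ p y * x else 0.
Proof.
rewrite nuE (fcoord_mact eid hz); case: eqP => // _.
by rewrite -mulrA xe.
Qed.

(** The limit along z_p of the image under g of the sum of the C_r z_r. *)
Lemma lim_twist :
  lim_gen p (img_sub g_hom (Dsub z C)) = Dsub z twist :> {vspace P}.
Proof.
apply/eqP; rewrite eqEsubv; apply/andP; split.
  rewrite subv_add; apply/andP; split; apply/subvP.
    move=> _ /memv_imgP[_ /memv_imgP[d Dd ->] ->].
    have {}Dd := iffLR (mem_Dsub eid hz Ce d) Dd.
    apply/(mem_Dsub eid hz twist_e) => r; rewrite fcoord_cogen_proj gE linearD /=.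
    rewrite c_nu /twist; case: (r == p); first exact: mem0v.
    case: eqP => [->|_]; last by rewrite addr0.
    by apply/mem_tw_add; exists (c_ p d), (c_ q d); rewrite addrC !Dd.
  move=> y; rewrite memv_cap memv_ker => /andP[/memv_imgP[d Dd yE] /eqP y0].
  have {}Dd := iffLR (mem_Dsub eid hz Ce d) Dd.
  have cy r : r != p -> c_ r y = 0.
    by move=> /negbTE rp; have := fcoord_cogen_proj p r y; rewrite rp y0 linear0.
  apply/(mem_Dsub eid hz twist_e) => r; rewrite /twist; case: eqP => [->|/eqP rp].
    have := cy q; rewrite eq_sym => /(_ npq).
    rewrite yE gE !linearD /= !c_nu eqxx (negbTE npq) addr0 mem_tw_cap Dd /=.
    move=> /eqP; rewrite addrC addr_eq0 => /eqP->.
    by rewrite rpredN.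
  by rewrite cy // mem0v.
apply: Dsub_sub => r c; rewrite /twist; case: eqP => [->|/eqP rp].
  rewrite mem_tw_cap => /andP[Cc Ccx]; apply: (subvP (addvSr _ _)).
  rewrite memv_cap memv_ker; apply/andP; split.
    apply/memv_imgP; exists (mact c (z p) - mact (c * x) (z q)).
      by apply: rpredB; apply: mem_Dsub_gen.
    rewrite gE linearB /= !nuE !(fcoord_mact eid hz) eqxx (negbTE npq) mul0r.
    by rewrite mact0l subr0 Ce // subrK.
  apply/eqP/(fcoord_eq hz) => s; rewrite linear0 fcoord_cogen_proj.
  by rewrite (fcoord_mact eid hz); case: (s == p).
have projg y s : s != p -> cogen_proj p (mact y (z s)) = mact y (z s).
  move=> sp; rewrite cogen_projE (fcoord_mact eid hz) eq_sym (negbTE sp).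
  by rewrite mact0l subr0.
case: eqP => [->|/eqP rq Cc]; last first.
  apply: (subvP (addvSl _ _)); apply/memv_imgP; exists (mact c (z r)).
    apply/memv_imgP; exists (mact c (z r)); first exact: mem_Dsub_gen.
    by rewrite gE nuE (fcoord_mact eid hz) eq_sym (negbTE rp) mul0r mact0l addr0.
  by rewrite projg.
move=> /mem_tw_add[c1 [c2 [Cc1 Cc2 ->]]]; apply: (subvP (addvSl _ _)).
apply/memv_imgP; exists (g (mact c1 (z p) + mact c2 (z q))).
  by rewrite memv_img // rpredD // mem_Dsub_gen.
rewrite gE [nu _]linearD /= !nuE !(fcoord_mact eid hz) eqxx (negbTE npq) mul0r mact0l.
rewrite addr0 Ce // !linearD /= !(projg _ q) 1?eq_sym // cogen_projE.
rewrite (fcoord_mact eid hz) eqxx Ce // subrr add0r addrC -mactDl.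
by [].
Qed.

(** By uniqueness of decompositions, the two new ideals replace C_p and C_q up to
    units; if C_p x is not contained in C_q, then they do so in the opposite
    order, since the first one is contained in C_p and the second contains C_q. *)
Lemma twist_equiv : ~~ (amulr x @: C p <= C q)%VS ->
  [/\ idx p = idx q, lequiv e (idx q, C q) (idx p, tw_cap) &
      lequiv e (idx p, C p) (idx q, tw_add)].
Proof.
move=> nsub; have gDrad : (img_sub g_hom (Dsub z C) <= rad J P)%VS.
  exact: subv_trans (limgS _ Crad) (rad_img J g_hom).
have MgD : mod_iso M (quo (img_sub g_hom (Dsub z C))).
  by apply: mod_iso_trans MC _; apply: (aut_quo_iso g_hom g_bij).
have Mlim := hM gDrad MgD p; have limrad := lim_gen_rad p gDrad.
have [||h [ah hE]] := lift_iso hJ he hz Crad (D := Dsub z twist).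
- by rewrite -lim_twist.
- apply: mod_iso_trans (mod_iso_sym MC) _; apply: mod_iso_trans Mlim _.
  by apply: quo_eq_iso; apply: lim_twist.
have [s sP] := krull_schmidt hJ he hz Ce twist_e ah (esym hE).
have canc r0 : (r0 == p) || (r0 == q) ->
    exists2 r, (r == p) || (r == q) & lequiv e (idx r, C r) (idx r0, twist r0).
  apply: (@perm_cancel _ _ (lequiv e) s (fun r => (idx r, C r))
    (fun r => (idx r, twist r)) (fun r => (r == p) || (r == q))) => //.
    by move=> ? ? ?; apply: lequiv_trans.
  by move=> r; rewrite negb_or /twist => /andP[/negbTE-> /negbTE->].
have capC : (tw_cap <= C p)%VS by apply: capvSl.
have addC : (C q <= tw_add)%VS by apply: addvSr.
have [r rpq capE] : exists2 r, (r == p) || (r == q) &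
    lequiv e (idx r, C r) (idx p, tw_cap).
  by have := canc p; rewrite eqxx /twist eqxx; apply.
have [r' rpq' addE] : exists2 r, (r == p) || (r == q) &
    lequiv e (idx r, C r) (idx q, tw_add).
  by have := canc q; rewrite eqxx orbT /twist eq_sym (negbTE npq) eqxx; apply.
have rq : r = q.
  case/orP: rpq => /eqP // rp; case/negP: nsub; rewrite rp in capE.
  have capCE : (tw_cap = C p :> {vspace A}).
    by apply/eqP; rewrite eqEdim capC (lequiv_dim capE) //=; apply: Ce.
  apply/subvP => _ /memv_imgP[c Cc ->]; rewrite lfunE /=; move: Cc.
  by rewrite -capCE mem_tw_cap => /andP[].
have rp' : r' = p.
  case/orP: rpq' => /eqP // rq'; case/negP: nsub; rewrite rq' in addE.
  have addCE : (C q = tw_add :> {vspace A}).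
    by apply/eqP; rewrite eqEdim addC -(lequiv_dim addE) //=; apply: Ce.
  by rewrite addCE; apply: addvSl.
rewrite rq in capE; rewrite rp' in addE.
by split=> //; have [] := addE.
Qed.

End Twist.
End Free.
End Basic.

(** * Consequences of the stability under limits *)

Section Basic.
Variables (K : closedFieldType) (A : falgType K) (n : nat).
Variables (J : left_ideal A) (e : 'I_n -> A).
Hypothesis hJ : is_jacobson J.
Hypothesis he : basic_with e.
Local Notation inJ x := (x \in (J : {vspace A})).
Local Notation eid := (e_idem he).

Section Core.
Variables (I : finType) (idx : I -> 'I_n) (P : fdmod A) (z : I -> P).
Hypothesis hz : free_basis e idx z.
Variable M : fdmod A.
Hypothesis hM : lim_stable J he hz M.
Variables (C : I -> left_ideal A).
Hypothesis Ce : forall r c, c \in (C r : {vspace A}) -> c * e (idx r) = c.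
Hypothesis Crad : (Dsub z C <= rad J P)%VS.
Hypothesis MC : mod_iso M (quo (Dsub z C)).

Let tw := twist_equiv hJ hM Ce Crad MC.

(** Twisting by a unit u of e_i A e_i with inverse v: if C_p u is not contained in
    C_q, then C_q v is properly contained in C_p. *)
Lemma comparable_unit p q u v : p != q -> idx p = idx q ->
  e (idx p) * u = u -> u * e (idx p) = u -> u * v = e (idx p) ->
  ~~ (amulr u @: C p <= C q)%VS ->
  (\dim (C q : {vspace A}) < \dim (C p : {vspace A}))%N /\
  (amulr v @: C q <= C p)%VS.
Proof.
move=> npq ipq eu ue uv nsub.
have [|_ cE _] := tw npq _ nsub; first by rewrite -ipq.
have dimE : \dim (C q : {vspace A}) = \dim (tw_cap C p q u : {vspace A}).
  by apply: (lequiv_dim cE) => c; apply: Ce.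
have capC : (tw_cap C p q u <= C p)%VS by apply: capvSl.
split.
  rewrite dimE; have [le eqd] := dimv_leqif_eq capC.
  rewrite ltn_neqAle le andbT eqd; apply: contra nsub => /eqP E.
  apply/subvP => _ /memv_imgP[c Cc ->]; rewrite lfunE /=; move: Cc.
  by rewrite -E mem_tw_cap => /andP[].
have imgE : (amulr u @: tw_cap C p q u)%VS = C q.
  apply/eqP; rewrite eqEdim; apply/andP; split.
    apply/subvP => _ /memv_imgP[c + ->]; rewrite mem_tw_cap lfunE /=.
    by move=> /andP[].
  rewrite dimE limg_dim_eq //; apply/vspaceP => c.
  rewrite memv_cap memv_ker memv0 lfunE /=; apply/andP/eqP => [[ac /eqP c0]|->].
    have := subvP capC _ ac; move/Ce => <-.
    by rewrite -uv mulrA c0 mul0r.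
  by rewrite mem0v mul0r.
rewrite -imgE -limg_comp; apply/subvP => _ /memv_imgP[c Cc ->].
have cE' := Ce (subvP capC _ Cc).
by rewrite comp_lfunE !lfunE /= -mulrA uv cE' (subvP capC).
Qed.

(** The case of the unit e_i. *)
Lemma comparable p q : idx p = idx q -> (C p <= C q)%VS \/ (C q <= C p)%VS.
Proof.
move=> ipq; have [->|npq] := eqVneq p q; first by left.
have idE r : (amulr (e (idx p)) @: C r)%VS = C r \/ idx r <> idx p.
  have [irp|/eqP] := eqVneq (idx r) (idx p); [left | by right].
  apply/vspaceP => c; apply/memv_imgP/idP => [[x Cx ->]|Cc].
    by rewrite lfunE /= -irp Ce.
  by exists c; rewrite // lfunE /= -irp Ce.
have [pE|//] := idE p; have [qE|//] := idE q; last by rewrite ipq.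
have [le|nle] := boolP (C p <= C q)%VS; [by left | right].
rewrite -qE; have [||||//] := @comparable_unit p q (e (idx p)) (e (idx p)) npq ipq.
all: by rewrite ?eid ?pE.
Qed.

(* Assuming that C_p x is not contained in C_q for some x in e_p J e_q, a
   contradiction is derived; the twist forces e_p = e_q. *)
Section Radical.
Variables (p q : I) (x : A).
Hypothesis npq : p != q.
Hypothesis Jx : inJ x.
Hypothesis ex : e (idx p) * x = x.
Hypothesis xe : x * e (idx q) = x.
Hypothesis nsub : ~~ (amulr x @: C p <= C q)%VS.

Let ipq : idx p = idx q.
Proof. by have [] := tw npq xe nsub. Qed.

Let Ccap : lequiv e (idx q, C q) (idx p, tw_cap C p q x).
Proof. by have [] := tw npq xe nsub. Qed.

Let Cadd : lequiv e (idx p, C p) (idx q, tw_add C p q x).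
Proof. by have [] := tw npq xe nsub. Qed.

Let ltqp : (\dim (C q : {vspace A}) < \dim (C p : {vspace A}))%N.
Proof.
have capC : (tw_cap C p q x <= C p)%VS by apply: capvSl.
rewrite (lequiv_dim Ccap) /=; last exact: Ce.
have [le eqd] := dimv_leqif_eq capC.
rewrite ltn_neqAle le andbT eqd; apply: contra nsub => /eqP E.
apply/subvP => _ /memv_imgP[c Cc ->]; rewrite lfunE /=; move: Cc.
by rewrite -E mem_tw_cap => /andP[].
Qed.

Let Cq_Cp_unit w c : e (idx p) * w = w -> w * e (idx p) = w -> ~~ inJ w ->
  c \in (C q : {vspace A}) -> c * w \in (C p : {vspace A}).
Proof.
move=> ew we nJw Cc; have [u [eu ue wu uw]] := e_local hJ he ew we nJw.
have nle : ~~ (amulr u @: C p <= C q)%VS.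
  apply: contraL ltqp => le; rewrite -leqNgt; apply: leq_trans (dimvS le).
  rewrite limg_dim_eq //; apply/vspaceP => b.
  rewrite memv_cap memv_ker memv0 lfunE /=; apply/andP/eqP => [[ac /eqP c0]|->].
    by rewrite -(Ce ac) -uw mulrA c0 mul0r.
  by rewrite mem0v mul0r.
have [_ /subvP sub] := comparable_unit npq ipq eu ue uw nle.
by apply: sub; apply/memv_imgP; exists c; rewrite // lfunE.
Qed.

(* An element of J is a difference of two units. *)
Let Cq_Cp w c : e (idx p) * w = w -> w * e (idx p) = w ->
  c \in (C q : {vspace A}) -> c * w \in (C p : {vspace A}).
Proof.
move=> ew we Cc; have [Jw|nJw] := boolP (inJ w); last exact: Cq_Cp_unit.
have -> : c * w = c * (w + e (idx p)) - c * e (idx p) by rewrite mulrDr addrK.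
apply: rpredB; apply: Cq_Cp_unit => //; rewrite ?mulrDr ?mulrDl ?ew ?we ?eid //.
  apply: contra (e_notJ hJ he (idx p)) => Jwe.
  by rewrite -[e _](addrK w) addrC (addrC _ w) addrC rpredB.
exact: e_notJ.
Qed.

(* C_p u = C_p x + C_q for a unit u; this is used to express elements of C_p. *)
Let Cp_dec : exists u v, [/\ e (idx p) * u = u, u * e (idx p) = u,
   e (idx p) * v = v /\ v * e (idx p) = v, u * v = e (idx p) /\ v * u = e (idx p) &
   forall c, c \in (C p : {vspace A}) -> exists c1 c2,
   [/\ c1 \in (C p : {vspace A}), c2 \in (C q : {vspace A}) & c * u = c1 * x + c2]].
Proof.
have [_ [u [v [eu ue ev uv imgE]]]] := Cadd; exists u, v; split=> // c Cc.
apply/mem_tw_add; rewrite -[X in _ \in pred_of_vspace X]imgE.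
by apply/memv_imgP; exists c; rewrite // lfunE.
Qed.

(* By descending induction on k, C_p is stable under e_i J^k e_i. *)
Let Cp_stable w c : e (idx p) * w = w -> w * e (idx p) = w ->
  c \in (C p : {vspace A}) -> c * w \in (C p : {vspace A}).
Proof.
have [u [v [eu ue [ev ve] [uv vu] dec]]] := Cp_dec.
have step (k : nat) : (forall w c, e (idx p) * w = w -> w * e (idx p) = w ->
      w \in (J ^+ k)%VS -> c \in (C p : {vspace A}) -> c * w \in (C p : {vspace A})) ->
    forall w c, e (idx p) * w = w -> w * e (idx p) = w -> x * (v * w) \in (J ^+ k)%VS ->
      c \in (C p : {vspace A}) -> c * w \in (C p : {vspace A}).
  move=> IH {}w {}c ew we Jw Cc; have [c1 [c2 [Cc1 Cc2 cE]]] := dec c Cc.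
  have -> : c * w = c1 * (x * (v * w)) + c2 * (v * w).
    by rewrite !mulrA -mulrDl -mulrDl -cE -(mulrA c u v) uv Ce.
  apply: rpredD; last by apply: Cq_Cp; rewrite ?mulrA ?ev // -mulrA we.
  by apply: IH => //; rewrite ?mulrA ?ex // -!mulrA we.
have [N JN] := jacobson_nil hJ.
have H m : forall w c, e (idx p) * w = w -> w * e (idx p) = w ->
    w \in (J ^+ (N - m).+1)%VS -> c \in (C p : {vspace A}) ->
    c * w \in (C p : {vspace A}).
  elim: m => [|m IH] {}w {}c ew we.
    rewrite subn0 expvSr JN prod0v memv0 => /eqP->.
    by rewrite mulr0 mem0v.
  have [ltmN|leNm] := ltnP m N; last first.
    have E0 : (N - m.+1 = N - m)%N by rewrite subnS; move: leNm; rewrite -subn_eq0 => /eqP->.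
    by rewrite E0; apply: IH.
  rewrite subnS prednK ?subn_gt0 // => Jw; apply: step IH _ _ ew we _.
  rewrite expvSl memv_mul //; move: Jw; case: (N - m)%N (subn_gt0 m N) => [|k _ Jw].
    by rewrite ltmN.
  exact: (jacobson_pow_stable v Jw).
move=> ew we; apply: step (H N) _ _ ew we _.
by rewrite subnn expv1 jacobson_mulr.
Qed.

(** With C_q u = C_p x^(-1) within C_p and C_p u' = C_p x + C_q, the element y = u x
    of J satisfies C_p = C_p y + C_q; as y is nilpotent and C_q y is contained in
    C_q, this gives C_p <= C_q, against the dimensions. *)
Lemma radical_contra : False.
Proof.
have [_ [u [v [eu ue [ev ve] [uv vu] imgE]]]] := Ccap.
have [u' [v' [eu' ue' [ev' ve'] [uv' vu'] dec]]] := Cp_dec.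
rewrite /= -ipq in eu ue ev ve uv vu imgE.
pose y := u * x.
have Jy : inJ y by apply: idealM.
have Cqy c : c \in (C q : {vspace A}) -> c * y \in (C q : {vspace A}).
  move=> Cc; have : c * u \in (tw_cap C p q x : {vspace A}).
    rewrite -[X in _ \in pred_of_vspace X]imgE.
    by apply/memv_imgP; exists c; rewrite // lfunE.
  by rewrite mem_tw_cap -mulrA => /andP[].
have decy c : c \in (C p : {vspace A}) -> exists c1 c2,
   [/\ c1 \in (C p : {vspace A}), c2 \in (C q : {vspace A}) & c = c1 * y + c2].
  move=> Cc; have [c1 [c2 [Cc1 Cc2 cE]]] := dec _ (Cp_stable ev' ve' Cc).
  exists (c1 * v), c2; split=> //; first exact: Cp_stable.
  rewrite /y !mulrA -(mulrA c1) vu Ce // -cE -mulrA vu' Ce //.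
have H k c : c \in (C p : {vspace A}) -> exists c1 c2,
   [/\ c1 \in (C p : {vspace A}), c2 \in (C q : {vspace A}) & c = c1 * y ^+ k + c2].
  move=> Cc; elim: k => [|k [c1 [c2 [Cc1 Cc2 cE]]]].
    by exists c, 0; rewrite expr0 mulr1 addr0 mem0v.
  have [d1 [d2 [Cd1 Cd2 dE]]] := decy c1 Cc1.
  exists d1, (d2 * y ^+ k + c2); split=> //.
    rewrite rpredD //; elim: (k) => [|l IH]; first by rewrite expr0 mulr1.
    by rewrite exprSr mulrA Cqy.
  by rewrite cE {1}dE mulrDl -mulrA -exprS addrA.
have [k yk] := jacobson_nilp hJ Jy.
have : (C p <= C q)%VS.
  apply/subvP => c Cc; have [c1 [c2 [_ Cc2 ->]]] := H k c Cc.
  by rewrite yk mulr0 add0r.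
by move/dimvS; rewrite leqNgt ltqp.
Qed.

End Radical.

Lemma radical_sub p q x c : p != q -> inJ x -> e (idx p) * x = x ->
  x * e (idx q) = x -> c \in (C p : {vspace A}) -> c * x \in (C q : {vspace A}).
Proof.
move=> npq Jx ex xe Cc; have [/subvP sub|nsub] := boolP (amulr x @: C p <= C q)%VS.
  by apply: sub; apply/memv_imgP; exists c; rewrite // lfunE.
by case: (radical_contra npq Jx ex xe nsub).
Qed.

End Core.
End Basic.

(** * Closed conditions: polynomial curves and ranks *)

(** A polynomial vanishing outside 0 vanishes at 0, as K is infinite. *)
Lemma horner_off0 (K : closedFieldType) (q : {poly K}) :
  (forall s, s != 0 -> q.[s] = 0) -> q.[0] = 0.
Proof.
move=> q0; suff : 'X * q = 0.
  by move/eqP; rewrite mulf_eq0 polyX_eq0 => /eqP->; rewrite horner0.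
apply/eqP/negPn/negP => /closed_nonrootP[s]; apply/negP; rewrite negbK.
rewrite /root hornerM hornerX; have [->|/q0->] := eqVneq s 0.
  by rewrite mul0r.
by rewrite mulr0.
Qed.

Section Evalp.
Variables (K : fieldType) (I : finType).
Implicit Types (p : coord_poly K I).

Lemma evalpE p (x : I -> K) :
  evalp p x = \sum_(m <- msupp p) p@_m * \prod_k x (enum_val k) ^+ m k.
Proof. exact: mevalE. Qed.

Lemma evalp_eq p (x y : I -> K) : x =1 y -> evalp p x = evalp p y.
Proof.
move=> xy; rewrite !evalpE; apply: eq_bigr => m _; congr (_ * _).
by apply: eq_bigr => k _; rewrite xy.
Qed.

Lemma evalp_curve p (h : I -> {poly K}) :
  exists q : {poly K}, forall s, evalp p (fun i => (h i).[s]) = q.[s].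
Proof.
exists (\sum_(m <- msupp p) (p@_m)%:P * \prod_k h (enum_val k) ^+ m k) => s.
rewrite evalpE horner_sum; apply: eq_bigr => m _.
rewrite hornerM hornerC horner_prod; congr (_ * _).
by apply: eq_bigr => k _; rewrite horner_exp.
Qed.

Lemma evalp_homog p k c (x : I -> K) : p \is k.-homog ->
  evalp p (fun i => c * x i) = c ^+ k * evalp p x.
Proof.
move=> /dhomogP hp; rewrite !evalpE big_distrr /= !big_seq.
apply: eq_bigr => m /hp mk; rewrite mulrCA; congr (_ * _).
rewrite -mk; under eq_bigr => i _ do rewrite exprMn.
by rewrite big_split /= prodrXr -mdegE.
Qed.

(** The coordinate function of index i. *)
Definition pvar (i : I) : coord_poly K I := 'X_(enum_rank i).

Lemma evalp_var i x : evalp (pvar i) x = x i.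
Proof. by rewrite /evalp mevalXU enum_rankK. Qed.

Lemma pvar_homog i : pvar i \is 1.-homog.
Proof. by rewrite dhomogX; apply/eqP; exact: mdeg1. Qed.

Lemma evalp_sum (T : Type) (r : seq T) (Q : pred T) (F : T -> coord_poly K I) x :
  evalp (\sum_(i <- r | Q i) F i) x = \sum_(i <- r | Q i) evalp (F i) x.
Proof. exact: raddf_sum. Qed.

Lemma evalpZ c p x : evalp (c *: p) x = c * evalp p x.
Proof. exact: mevalZ. Qed.

Lemma evalpD p q x : evalp (p + q) x = evalp p x + evalp q x.
Proof. exact: mevalD. Qed.

Lemma evalp_det k (N : 'M[coord_poly K I]_k) x :
  evalp (\det N) x = \det (\matrix_(i, j) evalp (N i j) x).
Proof.
rewrite /evalp -det_map_mx; congr (\det _); apply/matrixP => i j.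
by rewrite !mxE.
Qed.

Lemma det_homog k (N : 'M[coord_poly K I]_k) :
  (forall i j, N i j \is 1.-homog) -> \det N \is k.-homog.
Proof.
move=> hN; rewrite /determinant; apply: rpred_sum => s _.
rewrite -signr_odd; have H : \prod_i N i (s i) \is k.-homog.
  suff : \prod_i N i (s i) \is (\sum_(i < k) 1)%N.-homog.
    by rewrite sum_nat_const card_ord muln1.
  elim/big_rec2: _ => [|i q d _ hq]; first exact: dhomog1.
  exact: dhomogM.
by case: odd; rewrite ?expr0 ?mul1r // expr1 mulN1r rpredN.
Qed.

End Evalp.

(** A closed condition satisfied along a polynomial curve off 0 holds at 0. *)
Lemma aff_curve_closed (K : closedFieldType) (X : Type) (I : finType)
    (c : X -> I -> K) (Z : X -> Prop) (g : K -> X) (h : I -> {poly K}) :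
  aff_closed c Z -> (forall s i, c (g s) i = (h i).[s]) ->
  (forall s, s != 0 -> Z (g s)) -> Z (g 0).
Proof.
move=> [F ZF] gh gZ; apply/ZF => p Fp; have [q qE] := evalp_curve p h.
have E s : evalp p (c (g s)) = q.[s] by rewrite -qE; apply: evalp_eq => i; apply: gh.
rewrite E; apply: horner_off0 => s s0; rewrite -E.
by apply: (iffLR (ZF _) (gZ s s0)).
Qed.

Section Minors.
Variable K : fieldType.

Lemma free_minor k l (N : 'M[K]_(k, l)) : row_free N ->
  exists g : 'I_k -> 'I_l, \det (colsub g N) != 0.
Proof.
move=> fN; have fT : row_full N^T by rewrite /row_full mxrank_tr.
exists (fullrankfun fT); rewrite -det_tr -unitfE -[_ \is a _]/(_ \in unitmx).
have -> : (colsub (fullrankfun fT) N)^T = rowsub (fullrankfun fT) N^T.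
  by apply/matrixP => i j; rewrite !mxE.
exact: fullrowsub_unit.
Qed.

(** The rank is at most r if and only if all the larger minors vanish; here minors
    may have repeated rows and columns. *)
Lemma rank_minors k l (N : 'M[K]_(k, l)) r : (\rank N <= r)%N <->
  forall q (f : 'I_q -> 'I_k) (g : 'I_q -> 'I_l), (r < q)%N ->
    \det (mxsub f g N) = 0.
Proof.
split=> [leN q f g ltq|H].
  apply/eqP; apply: contraLR ltq; rewrite -unitfE -[_ \is a _]/(_ \in unitmx).
  rewrite -row_free_unit -leqNgt => /eqP <-; apply: leq_trans leN.
  have -> : mxsub f g N = rowsub f (colsub g N).
    by apply/matrixP => i j; rewrite !mxE.
  apply: leq_trans (mxrankS (rowsub_sub _ _)) _.
  have -> : colsub g N = (rowsub g N^T)^T by apply/matrixP => i j; rewrite !mxE.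
  rewrite mxrank_tr -[leqRHS]mxrank_tr; exact: mxrankS (rowsub_sub _ _).
rewrite leqNgt; apply/negP => ltN.
have [g] := free_minor (maxrowsub_free N).
have := H _ (maxrankfun N) g ltN.
have -> : colsub g (rowsub (maxrankfun N) N) = mxsub (maxrankfun N) g N.
  by apply/matrixP => i j; rewrite !mxE.
by move->; rewrite eqxx.
Qed.

(** There are s independent relations between the rows of N if and only if the
    rank of N is small. *)
Lemma relations_rank k l (N : 'M[K]_(k, l)) s : (s <= k)%N ->
  (exists L : 'M[K]_(s, k), row_free L /\ L *m N = 0) <-> (\rank N <= k - s)%N.
Proof.
move=> sk; split=> [[L [fL LN]]|leN].
  have /mxrankS : (L <= kermx N)%MS by apply/sub_kermxP.
  rewrite (eqP fL) mxrank_ker => le.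
  by rewrite -(subKn (rank_leq_row N)) leq_sub2l.
have le : (s <= \rank (kermx N))%N.
  by rewrite mxrank_ker -(subKn sk) leq_sub2l.
exists (pid_mx s *m row_base (kermx N)); split.
  by rewrite /row_free mxrankMfree ?row_base_free // rank_pid_mx.
apply/sub_kermxP; apply: submx_trans (submxMl _ _) _.
by rewrite eq_row_base.
Qed.

End Minors.

(** Having s independent solutions is a closed condition on the coefficients of
    a system of linear equations. *)
Lemma relations_closed (K : fieldType) (I B : finType) k s
    (p : 'I_k -> B -> coord_poly K I) : (s <= k)%N ->
  exists F : coord_poly K I -> Prop,
    ((forall i b, p i b \is 1.-homog) ->
       forall q, F q -> exists l, q \is l.-homog) /\
    forall x : I -> K,
      (exists L : 'M[K]_(s, k), row_free L /\
         forall a b, \sum_i L a i * evalp (p i b) x = 0) <->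
      forall q, F q -> evalp q x = 0.
Proof.
move=> sk; pose N : 'M[coord_poly K I]_(k, #|B|) := \matrix_(i, j) p i (enum_val j).
exists (fun q => exists r (f : 'I_r -> 'I_k) (g : 'I_r -> 'I_#|B|),
  (k - s < r)%N /\ q = \det (mxsub f g N)); split.
  move=> hp q [r [f [g [_ ->]]]]; exists r; apply: det_homog => i j.
  by rewrite !mxE.
move=> x; pose Nx : 'M[K]_(k, #|B|) := \matrix_(i, j) evalp (p i (enum_val j)) x.
have detE r (f : 'I_r -> 'I_k) (g : 'I_r -> 'I_#|B|) :
    evalp (\det (mxsub f g N)) x = \det (mxsub f g Nx).
  by rewrite evalp_det; congr (\det _); apply/matrixP => i j; rewrite !mxE.
have LE (L : 'M[K]_(s, k)) : (L *m Nx = 0) <->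
    forall a b, \sum_i L a i * evalp (p i b) x = 0.
  split=> [/matrixP LN a b|H].
    have := LN a (enum_rank b); rewrite !mxE => LN0; rewrite -[RHS]LN0.
    by apply: eq_bigr => i _; rewrite !mxE enum_rankK.
  apply/matrixP => a j; rewrite !mxE -[RHS](H a (enum_val j)).
  by apply: eq_bigr => i _; rewrite !mxE.
transitivity (\rank Nx <= k - s)%N.
  rewrite -relations_rank //.
  by split=> -[L [fL LN]]; exists L; split=> //; apply/LE.
rewrite rank_minors; split=> [H q [r [f [g [ltr ->]]]]|H r f g ltr].
  by rewrite detE H.
by rewrite -detE; apply: H; exists r, f, g.
Qed.

(** * Closed conditions on the Grassmannian *)

Lemma vbasis_free (K : fieldType) (V : vectType K) (C : {vspace V}) m
    (v : 'I_m -> K) : \dim C = m -> \sum_i v i *: (vbasis C)`_i = 0 -> v =1 fun=> 0.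
Proof.
move=> dC; case: m / dC v => v v0; exact: (freeP (basis_free (vbasisP C)) v v0).
Qed.

Section Pluecker.
Variables (K : fieldType) (V : vectType K) (m : nat).
Local Notation N := (\dim {:V}).
Local Notation cV := (coord (vbasis {:V})).

Lemma coord_full_eq (x y : V) : (forall k, cV k x = cV k y) -> x = y.
Proof.
move=> xy; rewrite (coord_vbasis (memvf x)) (coord_vbasis (memvf y)).
by apply: eq_bigr => k _; rewrite xy.
Qed.

(** Pluecker coordinates computed from an arbitrary family of vectors. *)
Definition pl_of (b : 'I_m -> V) (s : {ffun 'I_m -> 'I_N}) : K :=
  \det (\matrix_(i < m, j < m) cV (s j) (b i)).

(** Changing the basis multiplies all the Pluecker coordinates by a nonzero
    scalar. *)
Lemma pluecker_basis (C : {vspace V}) (b : 'I_m -> V) :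
  \dim C = m -> C = <<[seq b i | i : 'I_m]>>%VS ->
  exists c, c != 0 /\ forall s, pluecker C s = c * pl_of b s.
Proof.
move=> dC CE; pose B := [tuple b i | i < m].
have BE : <<B>>%VS = C by rewrite CE.
have Bi (i : 'I_m) : B`_i = b i by rewrite -tnth_nth tnth_mktuple.
pose w (i : 'I_m) := (vbasis C)`_i.
have wC i : w i \in C by apply: vbasis_mem; rewrite mem_nth // size_tuple dC.
pose T := \matrix_(i < m, k < m) coord B k (w i).
have wE i : w i = \sum_k T i k *: b k.
  rewrite (coord_span (X := B) (v := w i)) ?BE //; apply: eq_bigr => k _.
  by rewrite mxE Bi.
exists (\det T); split.
  apply/negP => /det0P[v nv vT]; case/eqP: nv; apply/rowP => i; rewrite mxE.
  have : \sum_i v 0 i *: w i = 0.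
    under eq_bigr => j _ do rewrite wE scaler_sumr.
    rewrite exchange_big big1 //= => k _; under eq_bigr => j _ do rewrite scalerA.
    rewrite -scaler_suml; move/rowP/(_ k): vT; rewrite !mxE => ->.
    by rewrite scale0r.
  by move=> v0; apply: (vbasis_free dC v0).
move=> s; rewrite /pluecker /pl_of -det_mulmx; congr (\det _).
apply/matrixP => i j; rewrite !mxE -/(w i) wE linear_sum.
by apply: eq_bigr => k _; rewrite !mxE linearZ.
Qed.

End Pluecker.

(** If the subspaces spanned by the vectors u_i + s w_i, all of the same dimension,
    lie in a closed subset of the Grassmannian for s <> 0, then also for s = 0. *)
Lemma Gr_curve_closed (K : closedFieldType) (V : vectType K) m
    (Z : {vspace V} -> Prop) (D : K -> {vspace V}) (u w : 'I_m -> V) :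
  Gr_closed m Z ->
  (forall s, \dim (D s) = m /\ D s = <<[seq (u i + s *: w i)%R | i : 'I_m]>>%VS) ->
  (forall s, s != 0 -> Z (D s)) -> Z (D 0).
Proof.
move=> [F [Fh ZF]] DE DZ; apply/(ZF _ (DE 0).1) => p Fp.
pose h (s : {ffun 'I_m -> 'I_(\dim {:V})}) : {poly K} :=
  \det (\matrix_(i < m, j < m) ((coord (vbasis {:V}) (s j) (u i))%:P +
                                (coord (vbasis {:V}) (s j) (w i)) *: 'X)).
have [q qE] := evalp_curve p h; have [l hl] := Fh p Fp.
have hE t s : (h s).[t] = pl_of (fun i => u i + t *: w i) s.
  rewrite /h -horner_evalE -det_map_mx /pl_of; congr (\det _).
  apply/matrixP => i j; rewrite !mxE /= horner_evalE hornerD hornerC hornerZ hornerX.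
  by rewrite linearD linearZ /= mulrC.
have E t : exists c, c != 0 /\ evalp p (@pluecker _ V m (D t)) = c * q.[t].
  have [dD eD] := DE t; have [c [c0 cE]] := pluecker_basis dD eD.
  exists (c ^+ l); rewrite expf_neq0 //; split=> //.
  rewrite -qE -(evalp_homog _ _ hl); apply: evalp_eq => s.
  by rewrite cE hE.
have [c [_ ->]] := E 0; rewrite horner_off0 ?mulr0 // => t t0.
have := iffLR (ZF _ (DE t).1) (DZ t t0) p Fp.
have [c' [c0 ->]] := E t; move/eqP; rewrite mulf_eq0 (negbTE c0) => /eqP.
by [].
Qed.

Section Incidence.
Variables (K : fieldType) (V : vectType K) (m : nat).
Local Notation N := (\dim {:V}).
Local Notation cV := (coord (vbasis {:V})).

(** The Laplace expansion along the row x of the determinant of x together with m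
    further vectors, on the columns t; it is a linear form in the Pluecker
    coordinates of the span of these m vectors. *)
Definition inc_poly (x : V) (t : {ffun 'I_m.+1 -> 'I_N}) :
    coord_poly K {ffun 'I_m -> 'I_N} :=
  \sum_(k < m.+1) ((-1) ^+ k * cV (t k) x) *: pvar K [ffun i => t (lift k i)].

Lemma inc_poly_homog x t : inc_poly x t \is 1.-homog.
Proof. by apply: rpred_sum => k _; apply: rpredZ; apply: pvar_homog. Qed.

Lemma inc_poly_linear (I : finType) (a : I -> K) (x : I -> V) t y :
  evalp (inc_poly (\sum_i a i *: x i) t) y = \sum_i a i * evalp (inc_poly (x i) t) y.
Proof.
have E k : cV k (\sum_i a i *: x i) = \sum_i a i * cV k (x i).
  by rewrite linear_sum; apply: eq_bigr => i _; rewrite linearZ.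
rewrite /inc_poly evalp_sum.
under eq_bigr => k _ do rewrite evalpZ evalp_var E mulr_sumr mulr_suml.
rewrite exchange_big /=; apply: eq_bigr => i _; rewrite evalp_sum mulr_sumr.
by apply: eq_bigr => k _; rewrite evalpZ evalp_var !mulrA (mulrC (a i)).
Qed.

(** Membership in an m-dimensional subspace is expressed by these linear forms. *)
Lemma inc_polyP (C : {vspace V}) x : \dim C = m ->
  (x \in C) <-> forall t, evalp (inc_poly x t) (@pluecker K V m C) = 0.
Proof.
move=> dC; pose b (i : 'I_m.+1) := if unlift ord0 i is Some j then (vbasis C)`_j else x.
pose M t : 'M[K]_m.+1 := \matrix_(i, j) cV (t j) (b i).
have ME t : evalp (inc_poly x t) (@pluecker K V m C) = \det (M t).
  rewrite (expand_det_row _ ord0) /inc_poly evalp_sum; apply: eq_bigr => k _.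
  rewrite evalpZ evalp_var /cofactor add0n [RHS]mulrCA -mulrA; congr (_ * (_ * _)).
    by rewrite mxE /b unlift_none.
  rewrite /pluecker; congr (\det _).
  by apply/matrixP => i j; rewrite !mxE ffunE /b liftK.
have wC (j : 'I_m) : (vbasis C)`_j \in C.
  by apply: vbasis_mem; rewrite mem_nth // size_tuple dC.
split=> [Cx t|H].
  rewrite ME; apply/eqP/det0P.
  have [a [i [ai a0]]] : exists a : 'I_m.+1 -> K, exists i, a i != 0 /\ \sum_i a i *: b i = 0.
    have nf : ~~ free [tuple b i | i < m.+1].
      apply/negP => /eqP fr; have : (<<[tuple b i | i < m.+1]>> <= C)%VS.
        apply/span_subvP => _ /mapP[i _ ->]; rewrite /b.
        by case: unliftP => [j _|_].
      by move/dimvS; rewrite fr size_tuple dC ltnn.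
    apply: NNPP => nex; case/negP: nf; apply/freeP => a a0 i.
    apply/eqP/negPn/negP => ai; apply: nex; exists a, i; split=> //.
    by rewrite -[RHS]a0; apply: eq_bigr => j _; rewrite -tnth_nth tnth_mktuple.
  exists (\row_i a i).
    by apply/eqP => /rowP/(_ i); rewrite !mxE => /eqP; rewrite (negbTE ai).
  apply/rowP => j; rewrite !mxE; have H := congr1 (cV (t j)) a0.
  transitivity (cV (t j) (\sum_i a i *: b i)); last by rewrite H linear0.
  rewrite linear_sum; apply: eq_bigr => k _; rewrite !mxE linearZ.
  by [].
apply: contraT => nx; pose L : 'M[K]_(m.+1, N) := \matrix_(i, j) cV j (b i).
have fL : row_free L.
  apply: inj_row_free => v vL; have vb : \sum_i v 0 i *: b i = 0.
    apply: coord_full_eq => k; transitivity ((v *m L) 0 k); last first.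
      by rewrite vL mxE linear0.
    rewrite linear_sum mxE; apply: eq_bigr => i _.
    by rewrite linearZ mxE.
  have b0 : b ord0 = x by rewrite /b unlift_none.
  have bl j : b (lift ord0 j) = (vbasis C)`_j by rewrite /b liftK.
  rewrite big_ord_recl b0 in vb.
  have {}vb : v 0 ord0 *: x + \sum_(j < m) v 0 (lift ord0 j) *: (vbasis C)`_j = 0.
    rewrite -[RHS]vb; congr (_ + _); apply: eq_bigr => j _.
    by rewrite bl.
  have v00 : v 0 ord0 = 0.
    apply/eqP; apply: contraNT nx => v00.
    have : v 0 ord0 *: x \in C.
      move/eqP: vb; rewrite addr_eq0 => /eqP->; rewrite rpredN.
      by apply: rpred_sum => j _; apply/rpredZ/wC.
    by rewrite rpredZeq (negbTE v00).
  move: vb; rewrite v00 scale0r add0r => /(vbasis_free dC) vl.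
  apply/rowP => i; rewrite mxE; case: (unliftP ord0 i) => [j ->|->] //.
have [g] := free_minor fL; have := H (finfun g); rewrite ME.
have -> : M (finfun g) = colsub g L by apply/matrixP => i j; rewrite !mxE ffunE.
by move->; rewrite eqxx.
Qed.

(** The subspaces D for which s independent linear combinations of the families
    x_i lie in D form a closed subset of the Grassmannian. *)
Lemma incidence_closed (B : finType) k s (x : 'I_k -> B -> V) : (s <= k)%N ->
  Gr_closed m (fun D => exists L : 'M[K]_(s, k), row_free L /\
     forall a b, \sum_i L a i *: x i b \in D).
Proof.
move=> sk; pose p i (bt : B * {ffun 'I_m.+1 -> 'I_N}) := inc_poly (x i bt.1) bt.2.
have [F [Fh FP]] := relations_closed p sk; exists F; split.
  by move=> q Fq; apply: Fh Fq => i bt; apply: inc_poly_homog.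
move=> D dD; rewrite -FP; split=> -[L [fL LP]]; exists L; split=> // a b.
  rewrite -inc_poly_linear; move: (b.2); apply: (iffLR (inc_polyP _ dD)).
  exact: LP.
apply/(inc_polyP _ dD) => t; rewrite inc_poly_linear.
exact: (LP a (b, t)).
Qed.

End Incidence.

(** * Tori act diagonalizably *)

(** Lagrange interpolation, with possibly repeated nodes. *)
Lemma interpolation (K : fieldType) (T : eqType) (s : seq T) (a b : T -> K) :
  (forall m m', m \in s -> m' \in s -> a m = a m' -> b m = b m') ->
  exists L : {poly K}, forall m, m \in s -> L.[a m] = b m.
Proof.
elim: s => [|m s IH] ab; first by exists 0.
have [|L LP] := IH; first by move=> x y xs ys; apply: ab; rewrite inE ?xs ?ys orbT.
have [/mapP[m' m's am]|nas] := boolP (a m \in map a s).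
  exists L => x; rewrite inE => /orP[/eqP->|/LP//].
  by rewrite am LP // (ab m m') ?mem_head // inE m's orbT.
pose Q := \prod_(x <- s) ('X - (a x)%:P).
have Qm : Q.[a m] != 0.
  rewrite /Q horner_prod prodf_seq_neq0; apply/allP => x xs /=.
  rewrite hornerXsubC subr_eq0; apply: contraNneq nas => ->.
  exact: map_f.
exists (L + ((b m - L.[a m]) / Q.[a m]) *: Q) => x; rewrite inE hornerD hornerZ.
have [->|nxm /= xs] := eqVneq x m; first by rewrite divfK // addrC subrK.
have -> : Q.[a x] = 0.
  by rewrite /Q horner_prod (big_rem x) //= hornerXsubC subrr mul0r.
by rewrite mulr0 addr0 LP.
Qed.

(** Among N and N + 1 at least one is prime to the characteristic, so that there are
    primitive roots of unity of arbitrarily large order. *)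
Lemma big_prim_root (K : closedFieldType) N : exists M (w : K),
  [/\ (N <= M)%N, (M%:R : K) != 0 & M.-primitive_root w].
Proof.
have [M [NM M0]] : exists M, (N <= M)%N /\ (M%:R : K) != 0.
  have [N0|N0] := eqVneq (N%:R : K) 0; last by exists N.
  by exists N.+1; rewrite leqnSn -addn1 natrD N0 add0r oner_eq0.
exists M; have M_gt0 : (0 < M)%N by case: M M0 {NM} => //; rewrite eqxx.
have [rs] := closed_field_poly_normal ('X^M - 1 : {poly K}).
rewrite (monicP _) ?monicXnsubC // scale1r => Dp.
have rn1 : all M.-unity_root rs.
  by apply/allP => z; rewrite -root_prod_XsubC -Dp.
have sz_r : (M <= size rs)%N.
  by rewrite -ltnS -(size_prod_XsubC rs id) -Dp size_XnsubC.
have [|z] := hasP (has_prim_root M_gt0 rn1 _ sz_r); last by exists z.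
by rewrite -separable_prod_XsubC -Dp cyclotomic.separable_Xn_sub_1.
Qed.

Lemma digits_lt r B (d : 'I_r -> nat) : (forall i, (d i < B)%N) ->
  (\sum_i d i * B ^ i < B ^ r)%N.
Proof.
elim: r d => [|r IH] d dB; first by rewrite big_ord0.
rewrite big_ord_recr /= expnS.
have lt := IH _ (fun i => dB (widen_ord (leqnSn r) i)).
apply: (@leq_trans (B ^ r + d ord_max * B ^ r)); first by rewrite ltn_add2r.
by rewrite -mulSn leq_mul2r dB orbT.
Qed.

Lemma digits_inj r B (d d' : 'I_r -> nat) :
  (forall i, (d i < B)%N) -> (forall i, (d' i < B)%N) ->
  (\sum_i d i * B ^ i = \sum_i d' i * B ^ i)%N -> d =1 d'.
Proof.
elim: r d d' => [|r IH] d d' dB dB'; first by move=> _ [].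
rewrite !big_ord_recr /= addnC [RHS]addnC => E.
have lt := digits_lt (fun i => dB (widen_ord (leqnSn r) i)).
have lt' := digits_lt (fun i => dB' (widen_ord (leqnSn r) i)).
have B0 : (0 < B ^ r)%N by apply: leq_ltn_trans lt.
have := congr1 (fun x => x %/ B ^ r)%N E; rewrite !divnMDl // !divn_small // !addn0 => Em.
have := congr1 (fun x => x %% B ^ r)%N E; rewrite !modnMDl !modn_small // => El.
have {}El := IH _ _ (fun i => dB _) (fun i => dB' _) El.
move=> i; case: (unliftP ord_max i) => [j ->|-> //].
have -> : lift ord_max j = widen_ord (leqnSn r) j by apply: val_inj; exact: lift_max.
exact: El.
Qed.

Section Eigen.
Variables (K : fieldType) (V : vectType K) (f : 'End(V)) (M : nat) (w : K).
Hypothesis M0 : (M%:R : K) != 0.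
Hypothesis wP : M.-primitive_root w.
Hypothesis fM : forall x, iter M f x = x.

(** An endomorphism f with f^M = 1, where M is prime to the characteristic, is
    diagonalizable on each stable subspace: x is the sum of its projections
    (1/M) sum_j w^(-k j) f^j x onto the eigenspaces of the w^k. *)
Lemma eigen_split (U : {vspace V}) x : (f @: U <= U)%VS -> x \in U ->
  exists y : 'I_M -> V, x = \sum_k y k /\
    forall k, y k \in U /\ exists c : K, f (y k) = c *: y k.
Proof.
move=> fU Ux; have M_gt0 := prim_order_gt0 wP.
have w0 : w != 0.
  apply/eqP => w0; have := prim_expr_order wP.
  by rewrite w0 expr0n eqn0Ngt M_gt0 => /eqP; rewrite eq_sym oner_eq0.
have vM : w^-1 ^+ M = 1 by rewrite exprVn prim_expr_order // invr1.
have itU j : iter j f x \in U.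
  by elim: j => //= j IH; apply: (subvP fU); apply: memv_img.
exists (fun k => M%:R^-1 *: \sum_(j < M) (w^-1 ^+ k) ^+ j *: iter j f x); split.
  rewrite -scaler_sumr exchange_big /=.
  apply: (canRL (scalerK _)); first by rewrite ?M0.
  under eq_bigr => j _ do rewrite -scaler_suml.
  rewrite (bigD1 (Ordinal M_gt0)) //= [X in _ + X]big1 ?addr0 => [|j nj].
     rewrite (eq_bigr (fun=> 1)) => [|k _]; last exact: expr0.
    by rewrite sumr_const card_ord.
  have -> : \sum_(k < M) (w^-1 ^+ k) ^+ j = \sum_(k < M) (w^-1 ^+ j) ^+ k :> K.
    by apply: eq_bigr => k _; rewrite -!exprM mulnC.
  suff -> : \sum_(k < M) (w^-1 ^+ j) ^+ k = 0 :> K by rewrite scale0r.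
  have := subrX1 (w^-1 ^+ j) M; rewrite -exprM mulnC exprM vM expr1n subrr => /esym/eqP.
  rewrite mulf_eq0 => /orP[|/eqP//].
  rewrite subr_eq0 exprVn -invr1 (inj_eq invr_inj) -(prim_order_dvd wP) => dv.
  by case/negP: nj; apply/eqP/val_inj => /=; move: dv; rewrite /dvdn modn_small // => /eqP.
move=> k; split.
  by apply: rpredZ; apply: rpred_sum => j _; apply: rpredZ.
exists (w ^+ k); rewrite linearZ linear_sum /= scalerA mulrC -scalerA; congr (_ *: _).
pose g j := (w^-1 ^+ k) ^+ j *: iter j f x.
have gM : g M = g 0%N.
  by rewrite /g fM -exprM mulnC exprM vM expr1n expr0.
rewrite scaler_sumr (eq_bigr (fun j : 'I_M => w ^+ k *: g j.+1)); last first.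
  move=> j _; rewrite linearZ /= /g exprS !scalerA mulrA exprVn divff ?mul1r //.
  exact: expf_neq0.
rewrite -!scaler_sumr; congr (_ *: _).
have E : \sum_(j < M) g j.+1 + g 0%N = \sum_(j < M) g j + g 0%N.
  by rewrite -{2}gM -(big_ord_recr M (fun j => g j)) big_ord_recl addrC.
exact: (addIr _ E).
Qed.

End Eigen.

Section Torus.
Variables (K : closedFieldType) (A : falgType K) (P : fdmod A).

Lemma entry_eq (f g : 'End(P)) : (forall ij, entry f ij = entry g ij) -> f = g.
Proof.
move=> fg; apply/lfunP => x; rewrite (coord_vbasis (memvf x)) !linear_sum.
apply: eq_bigr => j _; rewrite !linearZ /=; congr (_ *: _).
by apply: coord_full_eq => i; apply: (fg (i, j)).
Qed.

Lemma entry_linear (I : Type) (s : seq I) (Q : pred I) (a : I -> K)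
    (f : I -> 'End(P)) ij :
  entry (\sum_(k <- s | Q k) a k *: f k) ij = \sum_(k <- s | Q k) a k * entry (f k) ij.
Proof.
rewrite /entry sum_lfunE linear_sum; apply: eq_bigr => k _.
by rewrite scale_lfunE linearZ.
Qed.

(** The k-th iterate of f as a linear map. *)
Definition liter (f : 'End(P)) k : 'End(P) :=
  iter k (fun g => f \o g)%VF \1%VF.

Lemma literE f k x : liter f k x = iter k f x.
Proof. by elim: k => [|k IH]; rewrite /= ?id_lfunE // comp_lfunE IH. Qed.

Section Iso.
Variables (G : 'End(P) -> Prop) (r : nat) (phi : {ffun 'I_r -> K} -> 'End(P)).
Hypothesis Ga : forall f, G f -> mod_aut f.
Hypothesis iso : Gm_iso phi G.

Let one : {ffun 'I_r -> K} := [ffun _ => 1].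
Let one_Gm : Gm one.
Proof. by move=> i; rewrite ffunE oner_eq0. Qed.
Let pow (a : {ffun 'I_r -> K}) k : {ffun 'I_r -> K} := [ffun i => a i ^+ k].
Let pow_Gm a k : Gm a -> Gm (pow a k).
Proof. by move=> ga i; rewrite ffunE expf_neq0. Qed.

Let phi_one : phi one = \1%VF.
Proof.
have [phiG phiM _ _] := iso.
have oo : [ffun i => one i * one i] = one by apply/ffunP => i; rewrite !ffunE mulr1.
have := phiM _ _ one_Gm one_Gm; rewrite oo => E.
have [_ /bij_lfunK[fK _]] := Ga (phiG _ one_Gm).
by apply/lfunP => x; apply: (can_inj fK); rewrite id_lfunE -comp_lfunE -E.
Qed.

Let phi_pow a k : Gm a -> phi (pow a k) = liter (phi a) k.
Proof.
move=> ga; have [phiG phiM _ _] := iso; elim: k => [|k IH] /=.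
  rewrite -phi_one; congr phi; apply/ffunP => i; rewrite !ffunE expr0 //.
rewrite -IH -phiM //; last exact: pow_Gm.
by congr phi; apply/ffunP => i; rewrite !ffunE exprS.
Qed.

(* The exponents of the coordinates and of their inverses in a monomial m of the
   coordinate ring of (K^* )^r, and the value of m at x. *)
Let num (m : 'X_{1..#|{: 'I_r + 'I_r}|}) i := m (enum_rank (inl i : 'I_r + 'I_r)).
Let den (m : 'X_{1..#|{: 'I_r + 'I_r}|}) i := m (enum_rank (inr i : 'I_r + 'I_r)).
Let mon (x : {ffun 'I_r -> K}) (m : 'X_{1..#|{: 'I_r + 'I_r}|}) : K :=
  \prod_(k < #|{: 'I_r + 'I_r}|) Gm_coord x (enum_val k) ^+ m k.

Let monE x m : mon x m = (\prod_i x i ^+ num m i) * \prod_i (x i)^-1 ^+ den m i.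
Proof.
rewrite /mon (reindex (@enum_rank {: 'I_r + 'I_r})) /=; last first.
  by exists enum_val => k _; rewrite ?enum_rankK ?enum_valK.
under eq_bigr => k _ do rewrite enum_rankK.
by rewrite big_sumType.
Qed.

(* Multiplication by a power of all the coordinates clears denominators. *)
Let mon_shift x m D : Gm x -> (forall i, den m i <= D)%N ->
  mon x m * \prod_i x i ^+ D = \prod_i x i ^+ (num m i + (D - den m i)).
Proof.
move=> gx denD; rewrite monE -mulrA -!big_split /=; apply: eq_bigr => i _.
rewrite exprD; congr (_ * _); rewrite -[in x i ^+ D](subnKC (denD i)) exprD mulrA.
by rewrite exprVn mulVf ?mul1r // expf_neq0.
Qed.

Let monX x m k : mon (pow x k) m = mon x m ^+ k.
Proof.
rewrite /mon -prodrXl; apply: eq_bigr => i _; rewrite -exprM mulnC exprM.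
by congr (_ ^+ _); case: (enum_val i) => j /=; rewrite ffunE ?exprVn.
Qed.

(** Some element f of the torus satisfies f^M = 1 with M prime to the characteristic,
    and all the elements of the torus are polynomials in f. Only finitely many
    monomials occur in the entries of phi. At a = (w, w^B, w^(B^2), ...), where w is
    a root of unity of large order, they take different values unless they are
    equal as functions, by uniqueness of expansions in base B. Interpolation thus
    yields, for each x, a polynomial L with L(m(a)) = m(x) for these monomials m,
    whence phi(x) = L(phi(a)). *)
Lemma torus_gen : exists f M (w : K), [/\ G f, (M%:R : K) != 0,
  M.-primitive_root w, forall x, iter M f x = x &
  forall h, G h -> exists L : {poly K}, forall x,
    h x = \sum_(k < size L) L`_k *: iter k f x].
Proof.
have [phiG phiM phiE [psi [psiG _ _]]] := iso.
have [p pE] := fin_all_exists phiE.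
pose S := flatten [seq (msupp (p ij) : seq _) |
  ij <- enum (predT : pred ('I_(\dim {:P}) * 'I_(\dim {:P})))].
have pS ij m : m \in msupp (p ij) -> m \in S.
  by move=> mp; apply/flatten_mapP; exists ij; rewrite // mem_enum.
pose D := (\max_(m <- S) \max_(k < #|{: 'I_r + 'I_r}|) m k)%N.
have SD m k : m \in S -> (m k <= D)%N.
  move=> mS; apply: leq_trans (leq_bigmax k) _.
  by rewrite /D (big_rem m) //= leq_maxl.
pose B := (D + D).+1; have [M [w [BM M0 wP]]] := big_prim_root K (B ^ r).
have w0 : w != 0.
  apply/eqP => w0; have := prim_expr_order wP.
  rewrite w0 expr0n eqn0Ngt (prim_order_gt0 wP) => /eqP.
  by rewrite eq_sym oner_eq0.
pose a : {ffun 'I_r -> K} := [ffun i : 'I_r => w ^+ (B ^ i)].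
have ga : Gm a by move=> i; rewrite ffunE expf_neq0.
pose dig m i := (num m i + (D - den m i))%N.
have digB m i : m \in S -> (dig m i < B)%N.
  by move=> mS; rewrite ltnS leq_add ?leq_subr // SD.
have sep x m m' : Gm x -> m \in S -> m' \in S -> mon a m = mon a m' ->
    mon x m = mon x m'.
  move=> gx mS m'S E.
  have shift y k : Gm y -> k \in S ->
      mon y k * \prod_i y i ^+ D = \prod_i y i ^+ dig k i.
    by move=> gy kS; apply: mon_shift => // i; apply: SD.
  have aE k : k \in S -> \prod_i a i ^+ dig k i = w ^+ (\sum_i dig k i * B ^ i)%N.
    move=> kS; rewrite -prodrXr; apply: eq_bigr => i _.
    by rewrite ffunE -exprM mulnC.
  have /eqP : w ^+ (\sum_i dig m i * B ^ i)%N = w ^+ (\sum_i dig m' i * B ^ i)%N.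
    by rewrite -!aE // -!shift // E.
  rewrite (eq_prim_root_expr wP) !modn_small; last 2 first.
  - by apply: leq_trans BM; apply: digits_lt => i; apply: digB.
  - by apply: leq_trans BM; apply: digits_lt => i; apply: digB.
  move/eqP/digits_inj => dE.
  have y0 : \prod_i x i ^+ D != 0 by apply/prodf_neq0 => i _; rewrite expf_neq0.
  apply: (mulIf y0); rewrite !shift //; apply: eq_bigr => i _.
  by rewrite dE // => j; apply: digB.
exists (phi a), M, w; split => //; first exact: phiG.
  move=> x; rewrite -literE -phi_pow //; suff -> : pow a M = one by rewrite phi_one id_lfunE.
  apply/ffunP => i; rewrite !ffunE -exprM mulnC exprM.
  by rewrite (prim_expr_order wP) expr1n.
move=> h Gh; have [gx <-] := psiG h Gh; set x := psi h in gx *.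
have [L LP] := interpolation (fun m m' mS m'S E => sep x m m' gx mS m'S E).
exists L => v; suff -> : phi x = \sum_(k < size L) L`_k *: liter (phi a) k.
  by rewrite sum_lfunE; apply: eq_bigr => k _; rewrite scale_lfunE literE.
apply: entry_eq => ij; rewrite entry_linear pE // evalpE big_seq.
rewrite (eq_bigr (fun m => \sum_(k < size L) L`_k * ((p ij)@_m * mon (pow a k) m))).
  rewrite -big_seq exchange_big; apply: eq_bigr => k _ /=.
  rewrite -mulr_sumr; congr (_ * _); rewrite -phi_pow // pE ?evalpE //.
  exact: pow_Gm.
move=> m /pS mS; rewrite -[\prod_k _]/(mon x m) -(LP m mS) horner_coef mulr_sumr.
by apply: eq_bigr => k _; rewrite monX mulrCA.
Qed.

Lemma torus_comm f h : G f -> G h -> (f \o h = h \o f)%VF.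
Proof.
have [phiG phiM phiE [psi [psiG _ _]]] := iso.
move=> /psiG[gx <-] /psiG[gy <-]; rewrite -!phiM //; congr phi.
by apply/ffunP => i; rewrite !ffunE mulrC.
Qed.

End Iso.
End Torus.

Section Basic.
Variables (K : closedFieldType) (A : falgType K) (n : nat).
Variables (J : left_ideal A) (e : 'I_n -> A).
Hypothesis hJ : is_jacobson J.
Hypothesis he : basic_with e.
Local Notation inJ x := (x \in (J : {vspace A})).
Local Notation eid := (e_idem he).

Section Exchange.
Variables (I : finType) (idx : I -> 'I_n) (P : fdmod A).
Implicit Types z : I -> P.

Lemma free_span_full z (U : submod P) : free_basis e idx z ->
  (forall r, z r \in (U : {vspace P})) -> U = fullv :> {vspace P}.
Proof.
move=> hz zU; apply/vspaceP => x; rewrite memvf -[x](fcoord_sum hz).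
by apply: rpred_sum => r _; apply: sub_stable.
Qed.

Lemma free_basis_aut z (h : 'End(P)) : free_basis e idx z -> mod_aut h ->
  free_basis e idx (h \o z).
Proof.
move=> [ze zs zi] [hh bh]; have [fK gK] := bij_lfunK bh; split=> [r|x|a].
- by rewrite /= -hh ze.
- have [a aE] := zs ((h^-1)%VF x); exists a.
  rewrite -[x]gK aE linear_sum; apply: eq_bigr => r _; exact: hh.
move=> a0; apply: zi; apply: (can_inj fK); rewrite linear0 -[RHS]a0 linear_sum.
by apply: eq_bigr => r _; apply: hh.
Qed.

(** A basis element may be replaced by any top element whose coefficient on it is
    not in the radical. *)
Lemma free_exchange z r w : free_basis e idx z -> mact (e (idx r)) w = w ->
  ~~ inJ (fcoord e idx z r w) ->
  free_basis e idx (fun q => if q == r then w else z q).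
Proof.
move=> hz ew nJ; set y := fun q => _.
have ey q : mact (e (idx q)) (y q) = y q.
  by rewrite /y; case: eqP => [->|_] //; apply: (free_gen hz).
pose h := fext e idx z y.
have hh : mod_hom h by apply: (fext_hom eid hz).
have hz' q : h (z q) = y q by apply: (fext_gen eid hz).
suff bh : bijective h.
  have := free_basis_aut hz (conj hh bh); rewrite /free_basis /= => -[H1 H2 H3].
  split=> [q|x|a]; first by rewrite -hz'.
    by have [a ->] := H2 x; exists a; apply: eq_bigr => q _; rewrite hz'.
  by move=> a0; apply: H3; rewrite -[RHS]a0; apply: eq_bigr => q _; rewrite hz'.
apply: surj_bij; apply: (@free_span_full z (img_sub hh (full_sub P)) hz) => q.
have yU p : y p \in (img_sub hh (full_sub P) : {vspace P}).
  by rewrite -hz' memv_img ?memvf.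
have [->|nqr] := eqVneq q r; last by have := yU q; rewrite /y (negbTE nqr).
have [|| u [_ _ _ uE]] := @e_local _ _ _ _ _ hJ he (idx r) (fcoord e idx z r w) _ _ nJ.
- by rewrite -(fcoordM eid hz) ew.
- exact: (fcoord_e eid).
have : mact u w \in (img_sub hh (full_sub P) : {vspace P}).
  by apply: sub_stable; have := yU r; rewrite /y eqxx.
rewrite -[w](fcoord_sum hz) linear_sum (bigD1 r) //= -mactM uE (free_gen hz).
rewrite rpredDr // rpred_sum // => p npr; apply: (@sub_stable _ _ _ (img_sub hh (full_sub P))).
apply: (@sub_stable _ _ _ (img_sub hh (full_sub P))).
by have := yU p; rewrite /y (negbTE npr).
Qed.

Lemma hom_e_space (f : 'End(P)) (i : 'I_n) : mod_hom f ->
  (f @: limg (mactl P (e i)) <= limg (mactl P (e i)))%VS.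
Proof.
move=> hf; apply/subvP => _ /memv_imgP[_ /memv_imgP[x _ ->] ->].
by rewrite mactlE hf -mactlE memv_img ?memvf.
Qed.

Lemma mem_e_space i (x : P) : (x \in limg (mactl P (e i))) = (mact (e i) x == x).
Proof.
apply/memv_imgP/eqP => [[y _ ->]|<-]; first by rewrite mactlE -mactM eid.
by exists x; rewrite ?memvf ?mactlE.
Qed.

(** Every torus is diagonal with respect to some basis of top elements: each z_r in
    turn is exchanged for one of its components in the eigenspaces of a generator
    f of the torus. *)
Lemma torus_diag z (G : 'End(P) -> Prop) : free_basis e idx z -> torus G ->
  exists z', free_basis e idx z' /\
    forall h, G h -> forall r, exists c : K, h (z' r) = c *: z' r.
Proof.
move=> hz [[Gaut _ _ _ _] [k [phi iso]]].
have [f [M [w [Gf M0 wP fM hL]]]] := torus_gen Gaut iso.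
have [hf _] := Gaut f Gf.
suff [z' [hz' z'f]] : exists z', free_basis e idx z' /\
    forall r, r \in enum I -> exists c : K, f (z' r) = c *: z' r.
  exists z'; split=> // h /hL[L LP] r.
  have [|c fc] := z'f r; first by rewrite mem_enum.
  have it j : iter j f (z' r) = c ^+ j *: z' r.
    by elim: j => [|j IH]; rewrite ?expr0 ?scale1r //= IH linearZ /= fc scalerA exprSr.
  exists L.[c]; rewrite LP horner_coef scaler_suml; apply: eq_bigr => j _.
  by rewrite it scalerA.
elim: (enum I) => [|r s [z1 [hz1 z1f]]]; first by exists z.
have [|y [yE yP]] := eigen_split M0 wP fM (hom_e_space (idx r) hf) (x := z1 r).
  by rewrite mem_e_space (free_gen hz1).
have [k0 nJ] : exists k0, ~~ inJ (fcoord e idx z1 r (y k0)).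
  apply: NNPP => nex; case/negP: (e_notJ hJ he (idx r)).
  have := fcoord_gen eid hz1 r r; rewrite eqxx => <-.
  rewrite [in X in fcoord _ _ _ _ X]yE linear_sum; apply: rpred_sum => k0 _.
  by apply: contraT => nJ; case: nex; exists k0.
have [yU [c fc]] := yP k0.
have ew : mact (e (idx r)) (y k0) = y k0 by apply/eqP; rewrite -mem_e_space.
exists (fun q => if q == r then y k0 else z1 q); split; first exact: free_exchange.
move=> q; rewrite inE; case: eqP => [_ _|_ /= qs]; first by exists c.
exact: z1f.
Qed.

End Exchange.

Section DiagTorus.
Variables (m : nat) (idx : 'I_m -> 'I_n) (P : fdmod A) (z : 'I_m -> P).
Hypothesis hz : free_basis e idx z.

(** The torus of automorphisms which are diagonal in the basis z. *)
Definition diag_torus (f : 'End(P)) : Prop :=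
  mod_aut f /\ forall r, exists c : K, f (z r) = c *: z r.

(** The diagonal endomorphism with entries x. *)
Definition diag_elt (x : 'I_m -> K) : 'End(P) := \sum_r x r *: gen_proj e idx z r.

Lemma diag_elt_hom x : mod_hom (diag_elt x).
Proof. by apply: hom_sum => r; apply: hom_scale; apply: (gen_proj_hom he hz). Qed.

Lemma diag_elt_gen x r : diag_elt x (z r) = x r *: z r.
Proof.
rewrite sum_lfunE (bigD1 r) //= big1 => [|q nqr].
  by rewrite scale_lfunE gen_projE (fcoord_gen eid hz) eqxx (free_gen hz) addr0.
by rewrite scale_lfunE gen_projE (fcoord_gen eid hz) (negbTE nqr) mact0l scaler0.
Qed.

Lemma gen_neq0 r : z r != 0.
Proof.
apply/eqP => z0; have := fcoord_gen eid hz r r; rewrite z0 linear0 eqxx.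
by move/esym/eqP; rewrite (negbTE (e_neq0 he _)).
Qed.

Lemma diag_elt_comp x y : diag_elt (fun r => x r * y r) = (diag_elt x \o diag_elt y)%VF.
Proof.
apply: (hom_eq hz) => [||r]; first exact: diag_elt_hom.
  by apply: hom_comp; apply: diag_elt_hom.
by rewrite comp_lfunE !diag_elt_gen linearZ /= diag_elt_gen scalerA mulrC.
Qed.

Lemma diag_elt_one x : (forall r, x r = 1) -> diag_elt x = \1%VF.
Proof.
move=> x1; apply: (hom_eq hz) => [||r]; [exact: diag_elt_hom | exact: hom_id |].
by rewrite diag_elt_gen x1 scale1r id_lfunE.
Qed.

Lemma diag_elt_torus x : (forall r, x r != 0) -> diag_torus (diag_elt x).
Proof.
move=> x0; split=> [|r]; last by exists (x r); rewrite diag_elt_gen.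
split; first exact: diag_elt_hom.
exists (diag_elt (fun r => (x r)^-1)) => y; rewrite -comp_lfunE -diag_elt_comp.
  by rewrite diag_elt_one ?id_lfunE // => r; rewrite mulVf.
by rewrite diag_elt_one ?id_lfunE // => r; rewrite mulfV.
Qed.

Lemma diag_torus_elt f x : diag_torus f -> (forall r, f (z r) = x r *: z r) ->
  f = diag_elt x /\ forall r, x r != 0.
Proof.
move=> [[hf bf] _] fx; split.
  apply: (hom_eq hz) => [||r]; [exact: hf | exact: diag_elt_hom |].
  by rewrite diag_elt_gen.
move=> r; apply/eqP => xr; have := fx r; rewrite xr scale0r.
have [/eqP/lker0P fI _] := bij_lker0 bf.
by rewrite -[0](linear0 f) => /fI/eqP; rewrite (negbTE (gen_neq0 r)).
Qed.

Lemma entry_coord (f : 'End(P)) x i :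
  coord (vbasis {:P}) i (f x) =
  \sum_l coord (vbasis {:P}) l x * entry f (i, l).
Proof.
rewrite {1}(coord_vbasis (memvf x)) !linear_sum; apply: eq_bigr => l _.
by rewrite !linearZ.
Qed.

(* A coordinate of f x, as a linear polynomial in the entries of f. *)
Let val_poly x i : coord_poly K ('I_(\dim {:P}) * 'I_(\dim {:P}))%type :=
  \sum_l coord (vbasis {:P}) l x *: pvar K (i, l).
Let val_polyE f x i :
  evalp (val_poly x i) (entry f) = coord (vbasis {:P}) i (f x).
Proof.
rewrite entry_coord evalp_sum; apply: eq_bigr => l _.
by rewrite evalpZ evalp_var.
Qed.

Lemma diag_torus_algebraic : algebraic_subgroup diag_torus.
Proof.
split=> [f []//||f g [[hf bf] fz] [[hg bg] gz]|f [[hf bf] fz]|].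
- split; last by move=> r; exists 1; rewrite id_lfunE scale1r.
  by split; [exact: hom_id | exists \1%VF => x; rewrite !id_lfunE].
- split=> [|r].
    split; first exact: hom_comp.
    by apply: (eq_bij (bij_comp bf bg)) => x; rewrite comp_lfunE.
  have [a ga] := gz r; have [b fb] := fz r; exists (a * b).
  by rewrite comp_lfunE ga linearZ /= fb scalerA.
- split=> [|r]; first by split; [exact: hom_inv | exact: bij_lfunV].
  have [a fa] := fz r; have [fK gK] := bij_lfunK bf.
  have a0 : a != 0.
    apply/eqP => a0; have := fK (z r); rewrite fa a0 scale0r linear0 => /esym/eqP.
    by rewrite (negbTE (gen_neq0 r)).
  by exists a^-1; apply: (can_inj fK); rewrite gK linearZ /= fa scalerA mulVf // scale1r.
(* f z_r is proportional to z_r if and only if the 2 x 2 minors vanish *)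
exists (fun f => forall r i j, coord (vbasis {:P}) i (f (z r)) * coord (vbasis {:P}) j (z r) =
    coord (vbasis {:P}) j (f (z r)) * coord (vbasis {:P}) i (z r)); split.
  exists (fun p => exists r i j, p = coord (vbasis {:P}) j (z r) *: val_poly (z r) i -
     coord (vbasis {:P}) i (z r) *: val_poly (z r) j) => f.
  have E r i j : evalp (coord (vbasis {:P}) j (z r) *: val_poly (z r) i -
     coord (vbasis {:P}) i (z r) *: val_poly (z r) j) (entry f) =
     coord (vbasis {:P}) i (f (z r)) * coord (vbasis {:P}) j (z r) -
     coord (vbasis {:P}) j (f (z r)) * coord (vbasis {:P}) i (z r).
    by rewrite evalpD -scaleNr !evalpZ !val_polyE mulNr mulrC (mulrC (coord _ i (z r))).
  split=> [H p [r [i [j ->]]]|H r i j]; first by rewrite E H subrr.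
  by apply/eqP; rewrite -subr_eq0 -E; apply/eqP/H; exists r, i, j.
move=> f [hf bf]; split=> [[_ fz] r i j|H].
  by have [a ->] := fz r; rewrite !linearZ /= -!mulrA (mulrC (coord _ i _)).
split=> // r; have [j zj] : exists j, coord (vbasis {:P}) j (z r) != 0.
  apply: NNPP => nex; case/eqP: (gen_neq0 r); apply: coord_full_eq => j.
  by rewrite linear0; apply/eqP/negPn/negP => zj; apply: nex; exists j.
exists (coord (vbasis {:P}) j (f (z r)) / coord (vbasis {:P}) j (z r)).
apply: coord_full_eq => i; rewrite linearZ /= mulrAC -H mulfK //.
Qed.

Lemma diag_torus_torus : torus diag_torus.
Proof.
split; first exact: diag_torus_algebraic.
have [k zk] : exists k : 'I_m -> 'I_(\dim {:P}),
    forall r, coord (vbasis {:P}) (k r) (z r) != 0.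
  have H r : exists j, coord (vbasis {:P}) j (z r) != 0.
    apply: NNPP => nex; case/eqP: (gen_neq0 r); apply: coord_full_eq => j.
    by rewrite linear0; apply/eqP/negPn/negP => zj; apply: nex; exists j.
  exact: (fin_all_exists H).
exists m, (fun x : {ffun 'I_m -> K} => diag_elt x); split=> [x gx|x y gx gy|ij|].
- exact: diag_elt_torus.
- rewrite -diag_elt_comp; apply: eq_bigr => r _.
  by rewrite ffunE.
- exists (\sum_r entry (gen_proj e idx z r) ij *: pvar K (inl r)) => x gx.
  rewrite /diag_elt entry_linear evalp_sum; apply: eq_bigr => r _.
  by rewrite evalpZ evalp_var mulrC.
pose psi (f : 'End(P)) : {ffun 'I_m -> K} :=
  [ffun r => coord (vbasis {:P}) (k r) (f (z r)) / coord (vbasis {:P}) (k r) (z r)].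
have psiE (f : 'End(P)) x : (forall r, f (z r) = x r *: z r) -> psi f =1 x.
  by move=> fx r; rewrite ffunE fx linearZ /= mulfK.
exists psi; split=> [f Tf|x gx|i].
- have [x fx] := fin_all_exists Tf.2; have [fE x0] := diag_torus_elt Tf fx.
  have px := psiE _ _ fx; split=> [r|]; first by rewrite px.
  by rewrite [RHS]fE; apply: eq_bigr => r _; rewrite px.
- by apply/ffunP; apply: psiE => r; rewrite diag_elt_gen.
exists ((coord (vbasis {:P}) (k i) (z i))^-1 *:
   \sum_l coord (vbasis {:P}) l (z i) *: pvar K (Some (k i, l))) => f Tf.
rewrite ffunE evalpZ mulrC; congr (_ * _); rewrite entry_coord evalp_sum.
by apply: eq_bigr => l _; rewrite evalpZ evalp_var.
Qed.

(** The diagonal torus is maximal: an element of a larger torus commutes with it,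
    hence preserves each A z_r and acts there as the sum of a scalar and a
    nilpotent map; since it is diagonalizable, the nilpotent part is zero. *)
Lemma diag_torus_maximal : maximal_torus diag_torus.
Proof.
split; first exact: diag_torus_torus.
move=> G [[Gaut _ _ _ _] [k [phi iso]]] TG h Gh; split; first exact: Gaut.
move=> r.
have [f [M [w [Gf M0 wP fM hL]]]] := torus_gen Gaut iso.
(* s scales z_r by a scalar b other than 1 and fixes the other basis elements *)
have [b nb0 nb1] : exists2 b : K, b != 0 & b != 1.
  have : 'X * ('X - 1%:P) != 0 :> {poly K} by rewrite mulf_neq0 ?polyX_eq0 ?polyXsubC_eq0.
  move/closed_nonrootP => [b]; rewrite rootM negb_or root_XsubC => /andP[b0 b1].
  by exists b => //; move: b0; rewrite /root hornerX.
pose s := diag_elt (fun q => if q == r then b else 1).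
have Gs : G s.
  by apply/TG/diag_elt_torus => q; case: (q == r); rewrite ?oner_eq0.
have sr : s (z r) = b *: z r by rewrite diag_elt_gen eqxx.
have pres g : G g -> g (z r) = mact (fcoord e idx z r (g (z r))) (z r).
  move=> Gg; have [hg _] := Gaut g Gg.
  have E : b *: g (z r) = s (g (z r)).
    by rewrite -[RHS]comp_lfunE -(torus_comm iso Gg Gs) comp_lfunE sr linearZ.
  rewrite -{1}[g (z r)](fcoord_sum hz) (bigD1 r) //= big1 ?addr0 // => q nqr.
  have := congr1 (fcoord e idx z q) E; rewrite linearZ /=.
  rewrite (hom_coord hz _ (diag_elt_hom _)) linear_sum (bigD1 q) //= big1 => [|p npq].
    rewrite addr0 diag_elt_gen (negbTE nqr) scale1r (fcoord_mact eid hz) eqxx.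
    rewrite (fcoord_e eid) => /eqP; rewrite -subr_eq0 -{2}[fcoord _ _ _ _ _]scale1r -scalerBl.
    by rewrite scaler_eq0 subr_eq0 (negbTE nb1) => /eqP->; rewrite mact0l.
  rewrite diag_elt_gen linearZ /= linearZ /= (fcoord_mact eid hz) [q == p]eq_sym (negbTE npq).
  exact: scaler0.
have [hh bh] := Gaut h Gh; have [hf bf] := Gaut f Gf.
have Uf : (f @: cyc (z r) <= cyc (z r))%VS.
  apply/subvP => _ /memv_imgP[_ /cyc_vsP[a ->] ->]; rewrite hf pres //.
  by apply/cyc_vsP; exists (a * fcoord e idx z r (f (z r))); rewrite mactM.
have [|y [yE yP]] := eigen_split M0 wP fM Uf (x := z r).
  by apply/cyc_vsP; exists 1; rewrite mact1.
set x := fcoord e idx z r (h (z r)).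
have [|c [Jc _]] := resid_ex hJ he (i := idx r) (x := x) _ (fcoord_e eid _ _ _ _).
  by rewrite /x -(fcoordM eid hz) -hh (free_gen hz).
exists c; rewrite [in LHS]yE [in RHS]yE linear_sum scaler_sumr; apply: eq_bigr => j _ /=.
have [/cyc_vsP[a ya] [l fl]] := yP j; have [L LP] := hL h Gh.
have hy : h (y j) = L.[l] *: y j.
  rewrite LP horner_coef scaler_suml; apply: eq_bigr => p _.
  rewrite -scalerA; congr (_ *: _); elim: (p : nat) => [|q IH].
    by rewrite expr0 scale1r.
  by rewrite /= IH linearZ /= fl scalerA exprSr.
rewrite hy; have [->|nl] := eqVneq L.[l] c; first by [].
suff -> : y j = 0 by rewrite !scaler0.
pose t := x - c *: e (idx r).
have stepE u : mact (u * t) (z r) = h (mact u (z r)) - c *: mact u (z r).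
  rewrite /t mulrBr mactBl mactM -pres // -hh; congr (_ - _).
  by rewrite -scalerAr mactZl (mact_gen hz).
have H N : mact (a * t ^+ N) (z r) = (L.[l] - c) ^+ N *: y j.
  elim: N => [|N IH]; first by rewrite !expr0 mulr1 scale1r ya.
  rewrite exprSr mulrA stepE IH linearZ /= hy (scalerA c) mulrC -scalerA -scalerBr.
  by rewrite -scalerBl scalerA -exprSr.
have [N tN] := jacobson_nilp hJ (Jc : inJ t).
have := H N; rewrite tN mulr0 mact0l => /esym/eqP; rewrite scaler_eq0.
by rewrite expf_eq0 subr_eq0 (negbTE nl) andbF => /eqP.
Qed.

End DiagTorus.
End Basic.

(** * Degenerations in the variety of modules *)

Section Blocks.
Variables (K : fieldType) (n : nat) (d : 'I_n -> nat).
Local Notation N := (\sum_i d i)%N.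

(** tagnat.sig1 s is the block containing the index s. *)
Lemma block_projE i : block_proj K d i =
  \matrix_(s, t) ((s == t) && (tagnat.sig1 s == i))%:R :> 'M[K]_N.
Proof.
apply/mxblockP => j k; rewrite /block_proj; have [<-|njk] := eqVneq j k.
  rewrite submxblock_diag; apply/matrixP => a b; rewrite !mxE tagnat.Rank1K.
  rewrite /tagnat.Rank (inj_eq (@tagnat.rank_inj _ _)) eq_Tagged /=.
  by case: (a == b); rewrite ?mulr0n ?mulr1n.
rewrite mxblockK (negbTE njk); apply/matrixP => a b; rewrite !mxE.
case: eqP => // E; have := congr1 (@tagnat.sig1 _ _) E.
by rewrite !tagnat.Rank1K => jk; rewrite jk eqxx in njk.
Qed.

Lemma mul_block_proj i m (X : 'M[K]_(N, m)) s t :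
  (block_proj K d i *m X) s t = (tagnat.sig1 s == i)%:R * X s t.
Proof.
rewrite block_projE mxE (bigD1 s) //= [X in _ + X]big1 ?addr0 => [|l ls].
  by rewrite mxE eqxx.
by rewrite mxE eq_sym (negbTE ls) mul0r.
Qed.

(** Matrices commuting with the block projections are block diagonal. *)
Lemma block_diag (G : 'M[K]_N) :
  (forall i, G *m block_proj K d i = block_proj K d i *m G) ->
  G = \mxdiag_i (submxblock G i i).
Proof.
move=> GB; apply/mxblockP => j k; have [<-|njk] := eqVneq j k.
  by rewrite submxblock_diag.
rewrite /mxdiag mxblockK (negbTE njk); apply/matrixP => a b; rewrite !mxE.
have := congr1 (fun X : 'M[K]_N => X (tagnat.Rank j a) (tagnat.Rank k b)) (GB j).
rewrite mul_block_proj tagnat.Rank1K eqxx mul1r => <-.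
rewrite mxE (bigD1 (tagnat.Rank k b)) //= [X in _ + X]big1 ?addr0 => [|l lb].
  by rewrite block_projE mxE tagnat.Rank1K eq_sym (negbTE njk) andbF mulr0.
by rewrite block_projE mxE (negbTE lb) mulr0.
Qed.

Lemma block_diag_unit (G G' : 'M[K]_N) :
  (forall i, G *m block_proj K d i = block_proj K d i *m G) ->
  (forall i, G' *m block_proj K d i = block_proj K d i *m G') ->
  G *m G' = 1%:M -> forall i, submxblock G i i \in unitmx.
Proof.
move=> hG hG' GG' i; suff /mulmx1_unit[] : submxblock G i i *m submxblock G' i i = 1%:M by [].
have E j k : j != k -> submxblock G j k = 0.
  move=> jk; rewrite (block_diag hG) /mxdiag mxblockK (negbTE jk) //.
have : submxblock (G *m G') i i = 1%:M.
  rewrite GG'; apply/matrixP => a b; rewrite !mxE /tagnat.Rank.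
  by rewrite (inj_eq (@tagnat.rank_inj _ _)) eq_Tagged.
rewrite -{1}(submxblockK G) -{1}(submxblockK G') mul_mxblock mxblockK.
rewrite (bigD1 i) //= [X in _ + X]big1 ?addr0 // => j ji.
by rewrite E ?mul0mx // eq_sym.
Qed.

End Blocks.

Section Represent.
Variables (K : fieldType) (A : falgType K) (n : nat) (e : 'I_n -> A).
Hypothesis e_orth : orthogonal_idempotents e.
Hypothesis e_sum : \sum_i e i = 1.
Implicit Types M : fdmod A.

Lemma e_idem_orth i : e i * e i = e i.
Proof. by rewrite e_orth eqxx. Qed.

Lemma mem_e_img M i (x : M) : (x \in limg (mactl M (e i))) = (mact (e i) x == x).
Proof.
apply/memv_imgP/eqP => [[y _ ->]|<-].
  by rewrite mactlE -mactM e_idem_orth.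
by exists x; rewrite ?memvf ?mactlE.
Qed.

Lemma e_dec M (x : M) : x = \sum_i mact (e i) x.
Proof. by rewrite -mact_suml e_sum mact1. Qed.

Lemma dim_dimvec M : \dim {:M} = (\sum_i dimvec e M i)%N.
Proof.
have -> : fullv = (\sum_i limg (mactl M (e i)))%VS.
  apply/vspaceP => x; rewrite memvf [x]e_dec; apply/esym.
  by apply: memv_sumr => i _; rewrite -mactlE memv_img ?memvf.
apply/directvP/directv_sum_independent => u Uu u0 i _.
have ui j : mact (e j) (u j) = u j by apply/eqP; rewrite -mem_e_img Uu.
rewrite -ui -[RHS](linear0 (mact (f := M) (e i))) -u0 linear_sum (bigD1 i) //=.
rewrite big1 ?addr0 // => j ji.
by rewrite -ui -mactM e_orth eq_sym (negbTE ji) mact0l.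
Qed.

Section Rep.
Variables (M : fdmod A) (d : 'I_n -> nat).
Local Notation N := (\sum_i d i)%N.
Variables (phi : 'Hom(M, 'cV[K]_N)).
Hypothesis bphi : bijective phi.

(** The matrix of an endomorphism of M in the coordinates phi. *)
Definition rep_mx (g : 'End(M)) : 'M[K]_N :=
  \matrix_(i, j) (phi (g ((phi^-1)%VF (delta_mx j 0)))) i 0.

Lemma rep_mxE g x : rep_mx g *m phi x = phi (g x).
Proof.
have [fK gK] := bij_lfunK bphi.
have {2}-> : x = (phi^-1)%VF (\sum_j phi x j 0 *: delta_mx j 0).
  rewrite -{1}[x]fK; congr (_ _); rewrite {1}[phi x]matrix_sum_delta.
  by apply: eq_bigr => j _; rewrite big_ord1.
rewrite !linear_sum; apply/colP => i; rewrite mxE summxE; apply: eq_bigr => j _.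
by rewrite !linearZ /= !mxE mulrC.
Qed.

Lemma rep_mx_eq (X Y : 'M[K]_N) : (forall x, X *m phi x = Y *m phi x) -> X = Y.
Proof.
have [fK gK] := bij_lfunK bphi => XY; apply/matrixP => i j.
have := congr1 (fun v : 'cV[K]_N => v i 0) (XY ((phi^-1)%VF (delta_mx j 0))).
by rewrite gK -!colE !mxE.
Qed.

Lemma rep_mx_comp g h : rep_mx (g \o h)%VF = rep_mx g *m rep_mx h.
Proof. by apply: rep_mx_eq => x; rewrite -mulmxA !rep_mxE comp_lfunE. Qed.

Lemma rep_mx_id : rep_mx \1%VF = 1%:M.
Proof. by apply: rep_mx_eq => x; rewrite rep_mxE id_lfunE mul1mx. Qed.

Fact rep_mactl_linear : linear (fun a : A => rep_mx (mactl M a)).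
Proof.
move=> k a b; apply: rep_mx_eq => x.
by rewrite mulmxDl -scalemxAl !rep_mxE !mactlE mactDl mactZl linearP.
Qed.
Definition rep_linear : {linear A -> 'M[K]_N} := HB.pack (fun a => rep_mx (mactl M a))
  (GRing.isSemilinear.Build K A 'M[K]_N _ _ (GRing.semilinear_linear rep_mactl_linear)).

(** The point of the module variety given by M and the coordinates phi. *)
Definition rep_point : 'Hom(A, 'M[K]_N) := linfun rep_linear.

Lemma rep_pointE a : rep_point a = rep_mx (mactl M a).
Proof. by rewrite lfunE. Qed.

Lemma rep_point_represents : represents rep_point M.
Proof.
exists phi; split=> // a x.
by rewrite rep_pointE rep_mxE mactlE.
Qed.

Lemma rep_point_mod :
  (forall i x, phi (mact (e i) x) = block_proj K d i *m phi x) -> mod_point e rep_point.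
Proof.
move=> phie; split=> [|a b|i]; rewrite !rep_pointE.
- by apply: rep_mx_eq => x; rewrite rep_mxE mactlE mact1 mul1mx.
- by apply: rep_mx_eq => x; rewrite -mulmxA !rep_mxE !mactlE mactM.
by apply: rep_mx_eq => x; rewrite rep_mxE mactlE phie.
Qed.

End Rep.

(** Every module has a point of the variety of modules: coordinates adapted to the
    decomposition into the e_i M. *)
Lemma rep_exists M : exists phi : 'Hom(M, 'cV[K]_(\sum_i dimvec e M i)),
  bijective phi /\
  forall i x, phi (mact (e i) x) = block_proj K (dimvec e M) i *m phi x.
Proof.
pose phi0 (x : M) : 'cV[K]_(\sum_i dimvec e M i) := \col_s
  coord (vbasis (limg (mactl M (e (tagnat.sig1 s))))) (tagnat.sig2 s)
    (mact (e (tagnat.sig1 s)) x).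
have lin0 : linear phi0.
  by move=> k x y; apply/colP => s; rewrite !mxE !linearP.
pose linM := GRing.isSemilinear.Build K M 'cV[K]_(\sum_i dimvec e M i) _ phi0
  (GRing.semilinear_linear lin0).
pose lin : {linear M -> 'cV[K]_(\sum_i dimvec e M i)} :=
  HB.pack phi0 linM.
exists (linfun lin); have phiE x : linfun lin x = phi0 x by rewrite lfunE.
split; last first.
  move=> i x; rewrite !phiE; apply/colP => s; rewrite mul_block_proj !mxE -mactM e_orth.
  by case: eqP => [_|_]; rewrite ?mul1r // mact0l linear0 mul0r.
have kphi : lker (linfun lin) = 0%VS.
  apply/vspaceP => x; rewrite memv_ker memv0 phiE; apply/eqP/eqP => [/colP x0|->]; last first.
    by apply/colP => s; rewrite !mxE !linear0.
  rewrite [x]e_dec big1 // => i _.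
  have xi : mact (e i) x \in limg (mactl M (e i)) by rewrite -mactlE memv_img ?memvf.
  rewrite (coord_vbasis xi) big1 // => k _.
  have := x0 (tagnat.Rank i k); rewrite !mxE.
  have E : forall i' (k' : 'I_(dimvec e M i')) ,
    @Tagged _ i' (fun i => 'I_(dimvec e M i)) k' = @Tagged _ i (fun i => 'I_(dimvec e M i)) k ->
    coord (vbasis (limg (mactl M (e i')))) k' (mact (e i') x) = 0 ->
    coord (vbasis (limg (mactl M (e i)))) k (mact (e i) x) = 0.
    move=> i' k' E; have Ei : i' = i by move/(congr1 tag): E.
    case: i / Ei k {xi} E => k E; suff -> : k = k' by [].
    by move/eqP: E; rewrite eq_Tagged /= => /eqP.
  move=> H; rewrite (E _ _ _ H) ?scale0r //.
  by rewrite -tagnat.sigE12 /tagnat.Rank tagnat.rankK.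
apply: lker0_bij => //; apply/eqP; rewrite eqEdim subvf /=.
rewrite limg_dim_eq ?kphi ?capv0 // dim_dimvec dimvf /=.
by rewrite /dim /= muln1.
Qed.

End Represent.

Lemma represents_iso (K : fieldType) (A : falgType K) (n : nat) (d : 'I_n -> nat)
    (rho : 'Hom(A, 'M[K]_(\sum_i d i))) (M M' : fdmod A) :
  represents rho M -> mod_iso M' M -> represents rho M'.
Proof.
move=> [phi [bphi phiE]] [h [hh bh]]; exists (phi \o h)%VF; split.
  by apply: (eq_bij (bij_comp bphi bh)) => x; rewrite comp_lfunE.
by move=> a x; rewrite !comp_lfunE hh phiE.
Qed.

(** * One-parameter limits are degenerations *)

Section Extension.
Variables (K : closedFieldType) (A : falgType K) (n : nat) (e : 'I_n -> A).
Hypothesis e_orth : orthogonal_idempotents e.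
Hypothesis e_sum : \sum_i e i = 1.
Variables (M : fdmod A) (X : submod M).

(** A projection onto X commuting with the e_i. *)
Definition ext_proj : 'End(M) :=
  \sum_i (mactl M (e i) \o projv X \o mactl M (e i))%VF.
Local Notation th := ext_proj.

Lemma ext_projE x : th x = \sum_i mact (e i) (projv X (mact (e i) x)).
Proof.
by rewrite sum_lfunE; apply: eq_bigr => i _; rewrite !comp_lfunE !mactlE.
Qed.

Lemma ext_proj_mem x : th x \in (X : {vspace M}).
Proof.
by rewrite ext_projE; apply: rpred_sum => i _; apply: sub_stable; apply: memv_proj.
Qed.

Lemma ext_proj_id x : x \in (X : {vspace M}) -> th x = x.
Proof.
move=> Xx; rewrite ext_projE [RHS](e_dec e_sum); apply: eq_bigr => i _.
by rewrite projv_id ?sub_stable // -mactM (e_idem_orth e_orth).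
Qed.

Lemma ext_proj_e i x : th (mact (e i) x) = mact (e i) (th x).
Proof.
rewrite !ext_projE linear_sum; apply: eq_bigr => j _ /=.
rewrite -!mactM !e_orth; case: eqVneq => [->|ij]; first by [].
by rewrite !mact0l !linear0.
Qed.

(** The complementary projection; its image X' represents M / X. *)
Definition ext_co : 'End(M) := \1%VF - th.
Local Notation th' := ext_co.

Lemma ext_coE x : th' x = x - th x.
Proof. by rewrite add_lfunE opp_lfunE id_lfunE. Qed.

Lemma ext_projK x : th (th x) = th x.
Proof. by rewrite ext_proj_id ?ext_proj_mem. Qed.

Lemma ext_proj_co x : th (th' x) = 0.
Proof. by rewrite ext_coE linearB /= ext_projK subrr. Qed.

Lemma ext_co_proj x : th' (th x) = 0.
Proof. by rewrite ext_coE ext_projK subrr. Qed.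

Lemma ext_coK x : th' (th' x) = th' x.
Proof. by rewrite {1}ext_coE ext_proj_co subr0. Qed.

Lemma ext_add x : th x + th' x = x.
Proof. by rewrite ext_coE addrC subrK. Qed.

Lemma ext_proj_act a x : th (mact a (th x)) = mact a (th x).
Proof. by rewrite ext_proj_id // sub_stable // ext_proj_mem. Qed.

Lemma ext_co_act a x : th' (mact a (th x)) = 0.
Proof. by rewrite ext_coE ext_proj_act subrr. Qed.

Lemma ext_co_act_co a x : th' (mact a (th' x)) = th' (mact a x).
Proof. by rewrite -{2}[x]ext_add !linearD /= ext_co_act add0r. Qed.

Lemma ext_mixE (c : K) x : (c *: th + th') x = c *: th x + th' x.
Proof. by rewrite add_lfunE scale_lfunE. Qed.

Lemma ext_proj_mix (c : K) x : th (c *: th x + th' x) = c *: th x.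
Proof. by rewrite linearD linearZ /= ext_projK ext_proj_co addr0. Qed.

Lemma ext_co_mix (c : K) x : th' (c *: th x + th' x) = th' x.
Proof. by rewrite linearD linearZ /= ext_co_proj ext_coK scaler0 add0r. Qed.

(** The action of A on M = X + X', with the component X' -> X multiplied by s. *)
Definition ext_act (s : K) (a : A) (x : M) : M :=
  mact a (th x) + th' (mact a (th' x)) + s *: th (mact a (th' x)).

Fact ext_act_linear s a : linear (ext_act s a).
Proof.
move=> k x y; rewrite /ext_act !linearP /= !scalerDr.
by rewrite [X in X + _ = _]addrACA [LHS]addrACA.
Qed.

Fact ext_act_linearl s x : linear (ext_act s ^~ x).
Proof.
move=> k a b; rewrite /ext_act !(mact_linearl _ k) !linearP /= !scalerDr.
by rewrite [X in X + _ = _]addrACA [LHS]addrACA.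
Qed.

Fact ext_act1 s x : ext_act s 1 x = x.
Proof. by rewrite /ext_act !mact1 ext_coK ext_proj_co scaler0 addr0 ext_add. Qed.

Fact ext_actM s a b x : ext_act s (a * b) x = ext_act s a (ext_act s b x).
Proof.
have E y : ext_act s b y = (mact b (th y) + s *: th (mact b (th' y))) + th' (mact b (th' y)).
  by rewrite /ext_act addrAC.
have thE : th (ext_act s b x) = mact b (th x) + s *: th (mact b (th' x)).
  by rewrite E !linearD !linearZ /= ext_proj_act ext_projK ext_proj_co addr0.
have coE : th' (ext_act s b x) = th' (mact b (th' x)).
  by rewrite ext_coE thE E addrC addKr.
rewrite {2}/ext_act thE coE /ext_act !mactM !linearD !linearZ /=.
have -> : mact a (mact b (th' x)) =
    mact a (th (mact b (th' x))) + mact a (th' (mact b (th' x))).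
  by rewrite -linearD ext_add.
rewrite !linearD /= ext_co_act add0r ext_proj_act.
by rewrite -!addrA; congr (_ + _); rewrite addrCA.
Qed.

(** The module M for s = 1, and the direct sum of X and M / X for s = 0. *)
Definition ext_mod (s : K) : fdmod A :=
  FdMod (ext_act_linear s) (ext_act_linearl s) (ext_act1 s) (ext_actM s).

(** An extension M of M / X by X degenerates to their direct sum: multiplication of X
    by s, for s <> 0, is an isomorphism from M onto the module with parameter s. *)
Lemma ext_degeneration : degeneration e M (ext_mod 0).
Proof.
have [phi [bphi phie]] := rep_exists e_orth e_sum M.
pose d := dimvec e M; have [fK gK] := bij_lfunK bphi.
pose phis s : 'Hom(ext_mod s, 'cV[K]_(\sum_i d i)) := phi.
have eE s i x : ext_act s (e i) x = mact (e i) x.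
  rewrite /ext_act; have -> : th' (mact (e i) (th' x)) = mact (e i) (th' x).
    by rewrite [LHS]ext_coE ext_proj_e ext_proj_co linear0 subr0.
  by rewrite ext_proj_e ext_proj_co linear0 scaler0 addr0 -linearD ext_add.
pose rho := rep_point bphi; pose sig s := rep_point (M := ext_mod s) (phi := phis s) bphi.
have sigE s a x : sig s a *m phi x = phi (ext_act s a x).
  by rewrite /sig rep_pointE (rep_mxE (M := ext_mod s) bphi) mactlE.
have rhoE a x : rho a *m phi x = phi (mact a x).
  by rewrite /rho rep_pointE (rep_mxE bphi) mactlE.
exists rho, (sig 0); split.
- exact: rep_point_mod.
- exact: rep_point_represents.
- split; first by apply: (rep_point_mod (M := ext_mod 0) bphi) => i x; rewrite /= eE.
  move=> Z Zcl Zorb.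
  pose h (k : 'I_(\dim {:A}) * ('I_(\sum_i d i) * 'I_(\sum_i d i))) : {poly K} :=
    let a := (vbasis {:A})`_(k.1) in
    let y := (phi^-1)%VF (delta_mx k.2.2 0) in
    (phi (mact a (th y) + th' (mact a (th' y))) k.2.1 0)%:P +
    (phi (th (mact a (th' y))) k.2.1 0) *: 'X.
  apply: (aff_curve_closed (g := sig) (h := h) Zcl) => [s k|s s0].
    rewrite /mod_coord /h /sig rep_pointE mxE mactlE -[mact _ _]/(ext_act s _ _).
    rewrite hornerD hornerC hornerZ hornerX /ext_act linearD linearZ /= mxE.
    by rewrite mxE (mulrC s).
  apply: Zorb; pose G := rep_mx phi (s *: th + th').
  pose G' := rep_mx phi (s^-1 *: th + th').
  have GG' : G *m G' = 1%:M.
    rewrite -rep_mx_comp // -(rep_mx_id bphi); congr rep_mx; apply/lfunP => x.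
    rewrite comp_lfunE id_lfunE !ext_mixE ext_proj_mix ext_co_mix.
    by rewrite scalerA mulfV // scale1r ext_add.
  have comm c i : rep_mx phi (c *: th + th') *m block_proj K d i =
      block_proj K d i *m rep_mx phi (c *: th + th').
    apply: (rep_mx_eq bphi) => x; rewrite -!mulmxA -phie !(rep_mxE bphi) -phie.
    congr (phi _); rewrite !ext_mixE !ext_coE !ext_proj_e.
    by rewrite linearD linearB linearZ.
  exists (fun i => submxblock G i i); split.
    exact: (block_diag_unit (comm s) (comm s^-1) GG').
  move=> a; rewrite -(block_diag (comm s)).
  have GV : invmx G = G'.
    by rewrite -[LHS]mulmx1 -GG' mulmxA mulVmx ?mul1mx //; case/mulmx1_unit: GG'.
  rewrite GV; apply: (rep_mx_eq bphi) => x; rewrite sigE -!mulmxA (rep_mxE bphi).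
  rewrite rhoE (rep_mxE bphi); congr (phi _).
  rewrite !ext_mixE [mact a _]linearD linearZ /= !linearD !linearZ /= ext_proj_act ext_co_act.
  rewrite !scaler0 add0r scalerA mulVf // scale1r /ext_act.
  by rewrite addrAC.
exact: (rep_point_represents (M := ext_mod 0) bphi).
Qed.

End Extension.

Section LimitDegeneration.
Variables (K : closedFieldType) (A : falgType K) (n : nat) (e : 'I_n -> A).
Hypothesis e_orth : orthogonal_idempotents e.
Hypothesis e_sum : \sum_i e i = 1.

(** Let X be the image of ker f in M = P / C. The quotient of P by the limit of C is
    the direct sum of X and M / X. *)
Lemma lim_degeneration (P M : fdmod A) (f : 'End(P)) (hf : mod_hom f)
    (C : submod P) : (forall x, f (f x) = f x) -> mod_iso M (quo C) ->
  degeneration e M (quo (lim_sub hf C)).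
Proof.
move=> ff MC; have [F [hF imF kF]] := mod_iso_quo_surj MC.
pose X := img_sub hF (ker_sub hf); pose th := ext_proj e X; pose co := ext_co e X.
have FX x : F (x - f x) \in (X : {vspace M}).
  by rewrite memv_img // memv_ker linearB /= ff subrr.
have thF x : th (F (x - f x)) = F (x - f x) by apply: ext_proj_id.
pose psi : 'Hom(P, ext_mod e_orth e_sum X 0) :=
  (F \o (\1%VF - f) + (co \o (F \o f)))%VF.
have psiE x : psi x = F (x - f x) + co (F (f x)).
  by rewrite add_lfunE !comp_lfunE add_lfunE opp_lfunE id_lfunE.
have thpsi x : th (psi x) = F (x - f x).
  by rewrite psiE linearD /= thF ext_proj_co // addr0.
have copsi x : co (psi x) = co (F (f x)).
  by rewrite /co ext_coE -/th thpsi psiE addrC addKr.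
have hpsi : mod_hom psi.
  move=> a x; rewrite [RHS]/(ext_act e X 0 a (psi x)) /ext_act -/th -/co thpsi copsi.
  rewrite scale0r addr0 psiE hf -linearB !hF; congr (_ + _).
  by rewrite ext_co_act_co.
have lim_iso : mod_iso (quo (lim_sub hf C)) (ext_mod e_orth e_sum X 0).
  apply: (quo_iso hpsi).
    apply/vspaceP => y; rewrite memvf.
    have /memv_imgP[p _ pE] : (y : M) \in limg F by rewrite imF memvf.
    have /memv_imgP[k + kE] : th y \in (X : {vspace M}) by apply: ext_proj_mem.
    rewrite memv_ker => /eqP fk.
    apply/memv_imgP; exists (k + f p); first exact: memvf.
    have fkp : f (k + f p) = f p by rewrite linearD /= fk ff add0r.
    rewrite psiE fkp addrK -kE -[LHS](ext_add e X) -/th -/co; congr (_ + _).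
    have co0 : co (F (p - f p)) = 0 by rewrite /co ext_coE -/th thF subrr.
    by apply/eqP; rewrite pE -subr_eq0 -!linearB /= co0.
  apply/vspaceP => x; rewrite memv_ker; apply/eqP/idP => [x0|].
    have Fx0 : F (x - f x) = 0 by rewrite -thpsi x0 linear0.
    have : co (F (f x)) = 0 by rewrite -copsi x0 linear0.
    move/eqP; rewrite ext_coE subr_eq0 => /eqP Fx.
    have /memv_imgP[k + kE] : F (f x) \in (X : {vspace M}) by rewrite Fx ext_proj_mem.
    rewrite memv_ker => /eqP fk; rewrite -(subrK (f x) x) addrC; apply: memv_add.
      apply/memv_imgP; exists (f x - k); last by rewrite linearB /= ff fk subr0.
      by rewrite -kF memv_ker linearB /= kE subrr.
    rewrite memv_cap memv_ker linearB /= ff subrr eqxx andbT.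
    by rewrite -kF memv_ker Fx0.
  move=> /memv_addP[_ /memv_imgP[c Cc ->] [w]]; rewrite memv_cap memv_ker.
  move=> /andP[Cw /eqP fw] ->.
  have fcw : f (f c + w) = f c by rewrite linearD /= ff fw addr0.
  rewrite psiE fcw [f c + w]addrC addrK.
  have -> : F w = 0 by apply/eqP; rewrite -memv_ker kF.
  have Fc0 : F c = 0 by apply/eqP; rewrite -memv_ker kF.
  have -> : F (f c) = - F (c - f c) by rewrite linearB /= Fc0 sub0r opprK.
  by rewrite linearN /= /co ext_coE -/th thF subrr subr0.
have [rho [sigma [H1 H2 H3 H4]]] := ext_degeneration e_orth e_sum X.
by exists rho, sigma; split=> //; apply: represents_iso H4 lim_iso.
Qed.

End LimitDegeneration.

(** * Invariants under degeneration *)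

Section Semicontinuity.
Variables (K : fieldType) (A : falgType K).
Implicit Types M : fdmod A.

(** The subspace of the elements of M killed by the b_j. *)
Definition ann_space (B : finType) (b : B -> A) M : {vspace M} :=
  (\bigcap_j lker (mactl M (b j)))%VS.

Lemma mem_ann (B : finType) (b : B -> A) M x :
  reflect (forall j, mact (b j) x = 0) (x \in ann_space b M).
Proof.
rewrite memvE; apply: (iffP subv_bigcapP) => [H j|H j _].
  by have := H j isT; rewrite -memvE memv_ker mactlE => /eqP.
by rewrite -memvE memv_ker mactlE H.
Qed.

Lemma free_in (V : vectType K) (U : {vspace V}) s :
  (exists y : 'I_s -> V, (forall i, y i \in U) /\
     forall a : 'I_s -> K, \sum_i a i *: y i = 0 -> a =1 fun=> 0) <-> (s <= \dim U)%N.
Proof.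
split=> [[y [yU yf]]|le].
  have : free [tuple y i | i < s].
    apply/freeP => a a0; apply: yf; rewrite -[RHS]a0; apply: eq_bigr => i _.
    by rewrite -tnth_nth tnth_mktuple.
  move=> /eqP fr; have : (<<[tuple y i | i < s]>> <= U)%VS.
    by apply/span_subvP => _ /mapP[i _ ->].
  by move/dimvS; rewrite fr size_tuple.
have sz : size (take s (vbasis U)) == s by rewrite size_takel ?size_tuple.
pose X := Tuple sz; have fX : free X.
  have := basis_free (vbasisP U).
  by rewrite -{1}(cat_take_drop s (vbasis U)) => /catl_free.
exists (fun i => X`_i); split=> [i|a a0]; last exact: (freeP fX).
by apply/vbasis_mem/mem_take; apply: (@mem_nth _ 0 X); rewrite size_tuple.
Qed.

Variables (n : nat) (d : 'I_n -> nat).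
Local Notation N := (\sum_i d i)%N.

(** The dimension of this subspace in terms of a point rho of the variety. *)
Lemma represents_ann (rho : 'Hom(A, 'M[K]_N)) M (B : finType) (b : B -> A) s :
  represents rho M ->
  (s <= \dim (ann_space b M))%N <->
  exists L : 'M[K]_(s, N), row_free L /\
    forall a j r, \sum_i L a i * rho (b j) r i = 0.
Proof.
move=> [phi [bphi phiE]]; have [fK gK] := bij_lfunK bphi; rewrite -free_in.
split=> [[y [yU yf]]|[L [fL LP]]].
  exists (\matrix_(a, i) phi (y a) i 0); split.
    apply: inj_row_free => v vL; apply/rowP => a; rewrite mxE.
    apply: (yf (fun a => v 0 a)); apply: (can_inj fK); rewrite linear0 linear_sum.
    apply/colP => i; rewrite summxE mxE; transitivity ((v *m \matrix_(a, i) phi (y a) i 0) 0 i).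
      by rewrite mxE; apply: eq_bigr => k _; rewrite !linearZ !mxE.
    by rewrite vL mxE.
  move=> a j r; transitivity ((rho (b j) *m phi (y a)) r 0).
    by rewrite mxE; apply: eq_bigr => i _; rewrite !mxE mulrC.
  by rewrite -phiE; have /mem_ann -> := yU a; rewrite linear0 mxE.
exists (fun a => (phi^-1)%VF (\col_i L a i)); split=> [a|c c0].
  apply/mem_ann => j; apply: (can_inj fK); rewrite phiE gK linear0.
  apply/colP => r; rewrite !mxE -[RHS](LP a j r); apply: eq_bigr => i _.
  by rewrite !mxE mulrC.
move=> a; have := congr1 phi c0; rewrite linear0 linear_sum => c0'.
suff : \row_a c a = 0 by move/rowP/(_ a); rewrite !mxE.
apply: (row_free_inj fL); rewrite mul0mx; apply/rowP => i; rewrite !mxE.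
have := congr1 (fun v : 'cV[K]_N => v i 0) c0'; rewrite summxE mxE => c0i.
rewrite -[RHS]c0i; apply: eq_bigr => k _.
by rewrite linearZ /= gK !mxE.
Qed.

End Semicontinuity.

Section Dimvec.
Variables (K : fieldType) (A : falgType K) (n : nat) (e : 'I_n -> A).
Implicit Types M N : fdmod A.

Lemma img_mactl M N (f : 'Hom(M, N)) a : mod_hom f -> limg f = fullv ->
  (f @: limg (mactl M a))%VS = limg (mactl N a).
Proof.
move=> hf imf; rewrite -!limg_comp.
have -> : (f \o mactl M a)%VF = (mactl N a \o f)%VF.
  by apply/lfunP => x; rewrite !comp_lfunE !mactlE hf.
by rewrite limg_comp imf.
Qed.

Lemma dimvec_surj M N (f : 'Hom(M, N)) i : mod_hom f -> limg f = fullv ->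
  (\dim (limg (mactl M (e i)) :&: lker f) + dimvec e N i = dimvec e M i)%N.
Proof. by move=> hf imf; rewrite /dimvec -(img_mactl _ hf imf) limg_ker_dim. Qed.

Lemma dimvec_iso M N i : mod_iso M N -> dimvec e M i = dimvec e N i.
Proof.
move=> [f [hf bf]]; have [kf imf] := bij_lker0 bf.
by rewrite -(dimvec_surj i hf imf) kf capv0 dimv0.
Qed.

(** The dimension of the space killed by given elements of A does not decrease
    under degeneration. *)
Lemma degeneration_ann (d : 'I_n -> nat) M M' (B : finType) (b : B -> A) :
  degeneration_in e d M M' ->
  (\dim (ann_space b M) <= \dim (ann_space b M'))%N.
Proof.
move=> [rho [sigma [_ Mrho [_ Hcl] Msigma]]]; set s := \dim _.
have sN : (s <= \sum_i d i)%N.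
  have [phi [bphi _]] := Mrho; have := dimvS (subvf (ann_space b M)).
  rewrite -(bij_dim fullv bphi); have [_ ->] := bij_lker0 bphi.
  by rewrite dimvf /dim /= muln1.
pose p (i : 'I_(\sum_i d i)) (jr : B * 'I_(\sum_i d i)) :
    coord_poly K ('I_(\dim {:A}) * ('I_(\sum_i d i) * 'I_(\sum_i d i)))%type :=
  \sum_l coord (vbasis {:A}) l (b jr.1) *: pvar K (l, (jr.2, i)).
have pE (r : 'Hom(A, 'M[K]_(\sum_i d i))) i jr : evalp (p i jr) (mod_coord r) = r (b jr.1) jr.2 i.
  rewrite evalp_sum {2}(coord_vbasis (memvf (b jr.1))) linear_sum summxE.
  by apply: eq_bigr => l _; rewrite evalpZ evalp_var linearZ mxE.
have [F [_ FP]] := relations_closed p sN.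
apply/(represents_ann _ _ Msigma).
pose Z (r : 'Hom(A, 'M[K]_(\sum_i d i))) := exists L : 'M[K]_(s, \sum_i d i),
  row_free L /\ forall a j q, \sum_i L a i * r (b j) q i = 0.
have ZE r : Z r <-> forall q, F q -> evalp q (mod_coord r) = 0.
  rewrite -FP; split=> -[L [fL LP]]; exists L; split=> // a.
    by move=> [j q]; rewrite -[RHS](LP a j q); apply: eq_bigr => i _; rewrite pE.
  by move=> j q; rewrite -[RHS](LP a (j, q)); apply: eq_bigr => i _; rewrite pE.
apply: (Hcl Z); first by exists F.
move=> r [g [ug rE]]; apply/(represents_ann (M := M)); last exact: leqnn.
have [phi [bphi phiE]] := Mrho.
pose G : 'M[K]_(\sum_i d i) := \mxdiag_i g i.
have uG : G \in unitmx.
  pose G' : 'M[K]_(\sum_i d i) := \mxdiag_i invmx (g i).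
  suff /mulmx1_unit[] : G *m G' = 1%:M by [].
  rewrite /G /G' /mxdiag mul_mxblock; apply/mxblockP => j k; rewrite mxblockK.
  rewrite (bigD1 j) //= big1 ?addr0 => [|l /negbTE jl]; last by rewrite eq_sym jl mul0mx.
  rewrite eqxx conform_mx_id; have [<-|njk] := eqVneq j k.
    rewrite conform_mx_id mulmxV ?ug //; apply/matrixP => a c; rewrite !mxE.
    by rewrite /tagnat.Rank (inj_eq (@tagnat.rank_inj _ _)) eq_Tagged.
  rewrite mulmx0; apply/matrixP => a c; rewrite !mxE; case: eqP => // E.
  have := congr1 (@tagnat.sig1 _ _) E.
  by rewrite !tagnat.Rank1K => jk; rewrite jk eqxx in njk.
exists (linfun (mulmx G) \o phi)%VF; split.
  apply: lker0_bij.
    apply/vspaceP => x; rewrite memv_ker comp_lfunE memv0 lfunE /=.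
    have [fK _] := bij_lfunK bphi.
    apply/eqP/eqP => [x0|->]; last by rewrite linear0 mulmx0.
    apply: (can_inj fK); rewrite linear0 -[phi x](mulKmx uG) x0 mulmx0 //.
  apply/vspaceP => y; rewrite memvf; have [_ gK] := bij_lfunK bphi.
  apply/memv_imgP; exists ((phi^-1)%VF (invmx G *m y)); first exact: memvf.
  by rewrite comp_lfunE lfunE /= gK mulKVmx.
move=> a x; rewrite !comp_lfunE !lfunE /= phiE rE -/G.
by rewrite -!mulmxA (mulmxA (invmx G)) mulVmx // mul1mx.
Qed.

Hypothesis e_orth : orthogonal_idempotents e.
Hypothesis e_sum : \sum_i e i = 1.

Lemma degeneration_dimvec M M' i : degeneration e M M' ->
  dimvec e M' i = dimvec e M i.
Proof.
move=> dg; have le j : (dimvec e M j <= dimvec e M' j)%N.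
  have E L : limg (mactl L (e j)) = ann_space (fun _ : 'I_1 => 1 - e j) L.
    apply/vspaceP => x; rewrite (mem_e_img e_orth); apply/eqP/mem_ann => [xe _|/(_ ord0)].
      by rewrite mactBl mact1 xe subrr.
    by rewrite mactBl mact1 => /eqP; rewrite subr_eq0 => /eqP.
  by rewrite /dimvec !E; apply: degeneration_ann dg.
have eqd : (\sum_j dimvec e M j = \sum_j dimvec e M' j)%N.
  rewrite -(dim_dimvec e_orth e_sum M').
  have [rho [sigma [_ _ _ [phi [bphi _]]]]] := dg.
  rewrite -(bij_dim fullv bphi); have [_ ->] := bij_lker0 bphi.
  by rewrite dimvf /dim /= muln1.
have [_ H] := leqif_sum (fun j (_ : xpredT j) => leqif_eq (le j)).
by move/eqP: eqd; rewrite H => /forallP/(_ i)/=/eqP.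
Qed.

End Dimvec.

(** In spaces F_l of dimension > l, independent vectors can be chosen. *)
Lemma adapted_basis (K : fieldType) (V : vectType K) t (F : 'I_t -> {vspace V}) :
  (forall l : 'I_t, (l < \dim (F l))%N) ->
  exists w : 'I_t -> V, (forall l, w l \in F l) /\ free [tuple w l | l < t].
Proof.
elim: t F => [|t IH] F dF.
  exists (fun=> 0); split=> [[]//|]; rewrite (tuple0 [tuple _ | _ < _]); exact: nil_free.
have [w [wF fw]] := IH (fun l => F (widen_ord (leqnSn t) l)) (fun l => dF _).
have /subvPn[v Fv nv] : ~~ (F ord_max <= <<[tuple w l | l < t]>>)%VS.
  apply/negP => /dimvS; rewrite (eqP fw) size_tuple leqNgt => /negP[].
  exact: (dF ord_max).
exists (fun l => if unlift ord_max l is Some k then w k else v); split=> [l|].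
  case: unliftP => [k ->|->] //.
  by have := wF k; congr (_ \in F _); apply: val_inj; rewrite /= /bump leqNgt ltn_ord.
have fwv : free (v :: [tuple w l | l < t]) by rewrite free_cons nv.
suff pE : perm_eq (v :: [tuple w l | l < t])
    [tuple (if unlift ord_max l is Some k then w k else v) | l < t.+1].
  by rewrite -(perm_free pE).
rewrite /= enum_ordSr map_rcons unlift_none perm_sym perm_rcons perm_cons.
rewrite -map_comp (@eq_map _ _ _ w) // => l /=.
have -> : widen_ord (leqnSn t) l = lift ord_max l.
  by apply: val_inj; apply/esym/lift_max.
by rewrite liftK.
Qed.

(** * Tops, and nested direct sums of one isotypic type *)

Section Basic.
Variables (K : closedFieldType) (A : falgType K) (n : nat).
Variables (J : left_ideal A) (e : 'I_n -> A).
Hypothesis hJ : is_jacobson J.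
Hypothesis he : basic_with e.
Local Notation inJ x := (x \in (J : {vspace A})).
Local Notation eid := (e_idem he).

Lemma e_orthogonal : orthogonal_idempotents e.
Proof. by have [[]] := he. Qed.
Local Notation eorth := e_orthogonal.
Local Notation esum := (e_sum he).

Lemma top_surj (P M : fdmod A) (f : 'Hom(P, M)) : mod_hom f -> limg f = fullv ->
  (lker f <= rad J P)%VS -> mod_iso (top J P) (top J M).
Proof.
move=> hf imf kf; apply: (@quo_iso _ _ _ _ _ (qpi (rad J M) \o f)%VF).
- by apply: hom_comp => //; apply: qpi_hom.
- by rewrite limg_comp imf qpi_img.
apply/vspaceP => x; rewrite memv_ker comp_lfunE qpi_eq0 -(rad_img_surj J hf imf).
apply/memv_imgP/idP => [[y ry fx]|rx]; last by exists x.
rewrite -(subrK y x) rpredD //; apply: (subvP kf).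
by rewrite memv_ker linearB /= fx subrr.
Qed.

Lemma top_quo (P M : fdmod A) (C : submod P) : (C <= rad J P)%VS ->
  mod_iso M (quo C) -> mod_iso (top J P) (top J M).
Proof.
move=> Crad MC; have [f [hf imf kf]] := mod_iso_quo_surj MC.
by apply: (top_surj hf imf); rewrite kf.
Qed.

Section Free.
Variables (I : finType) (idx : I -> 'I_n) (P : fdmod A) (z : I -> P).
Hypothesis hz : free_basis e idx z.

(** Modulo the radical, e_i x is a combination of the z_r with idx r = i. *)
Lemma top_gen_span i x : exists a : I -> K,
  mact (e i) x - \sum_(r | idx r == i) a r *: z r \in (rad J P : {vspace P}).
Proof.
have H r : exists c : K, inJ (e i * fcoord e idx z r x - c *: e i) /\
    (i != idx r -> c = 0).
  apply: (resid_ex hJ he); first by rewrite mulrA eid.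
  by rewrite -mulrA (fcoord_e eid).
have [a aP] := fin_all_exists H; exists a.
apply/(mem_radP hJ he hz) => q; rewrite linearB linear_sum /= (fcoordM eid hz).
have [Ja a0] := aP q; rewrite (eq_bigr (fun r => if r == q then a q *: e (idx q) else 0)).
  have [qi|nqi] := boolP (idx q == i).
    rewrite (bigD1 q) //= eqxx big1 => [|r /andP[_ /negbTE->]] //.
    by rewrite addr0 (eqP qi).
  rewrite big1 ?subr0 => [|r /eqP ri].
    by have := Ja; rewrite a0 ?scale0r ?subr0 // 1?eq_sym.
  by case: eqP => // rq; rewrite -rq ri eqxx in nqi.
move=> r _; rewrite linearZ /= (fcoord_gen eid hz) eq_sym.
by case: eqP => [->|_]; rewrite ?scaler0.
Qed.

Lemma top_free_dimvec i : dimvec e (top J P) i = #|[pred r | idx r == i]|.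
Proof.
pose q := qpi (rad J P); pose D := [pred r | idx r == i].
have hq : mod_hom q by apply: qpi_hom.
have imq : limg q = fullv by apply: qpi_img.
apply/eqP; rewrite eqn_leq; apply/andP; split.
  have -> : #|D| = size [seq q (z r) | r <- enum D] by rewrite size_map -cardE.
  apply: leq_trans (dim_span _); apply: dimvS; rewrite -(img_mactl (e i) hq imq).
  apply/subvP => _ /memv_imgP[_ /memv_imgP[x _ ->] ->]; rewrite mactlE.
  have [a Ja] := top_gen_span i x.
  have -> : q (mact (e i) x) = q (\sum_(r | idx r == i) a r *: z r).
    by apply/eqP; rewrite -subr_eq0 -linearB qpi_eq0.
  rewrite linear_sum; apply: rpred_sum => r ri; rewrite linearZ; apply: rpredZ.
  by apply/memv_span/map_f; rewrite mem_enum.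
apply/free_in; exists (fun k => q (z (enum_val k))); split=> [k|a a0 k].
  have kD := enum_valP k; rewrite /= -(img_mactl (e i) hq imq) memv_img //.
  rewrite (mem_e_img eorth); apply/eqP; have := free_gen hz (enum_val k).
  by move/eqP: kD => ->.
have : \sum_k a k *: z (enum_val k) \in (rad J P : {vspace P}).
  rewrite -qpi_eq0 linear_sum -[X in _ == X]a0; apply/eqP; apply: eq_bigr => l _.
  by rewrite linearZ.
move=> /(mem_radP hJ he hz)/(_ (enum_val k)); rewrite linear_sum (bigD1 k) //=.
rewrite big1 => [|l nlk]; last first.
  rewrite linearZ /= (fcoord_gen eid hz) (inj_eq enum_val_inj) eq_sym (negbTE nlk).
  exact: scaler0.
rewrite addr0 linearZ /= (fcoord_gen eid hz) eqxx rpredZeq.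
by rewrite (negbTE (e_notJ hJ he _)) orbF => /eqP.
Qed.

Lemma top_free_dim : \dim {:top J P} = #|I|.
Proof.
rewrite (dim_dimvec eorth esum); under eq_bigr => i _ do rewrite top_free_dimvec.
under eq_bigr => i _ do rewrite -sum1_card.
rewrite (exchange_big_dep predT) //= -sum1_card; apply: eq_bigr => r _.
by rewrite (big_pred1 (idx r)) => // i; rewrite inE eq_sym.
Qed.

End Free.

Section Nested.
Variables (t : nat) (i : 'I_n) (P : fdmod A) (z : 'I_t -> P).
Hypothesis hz : free_basis e (fun=> i) z.
Variable C : 'I_t -> left_ideal A.
Hypothesis Ce : forall r c, c \in (C r : {vspace A}) -> c * e i = c.
Hypothesis Cdec : forall j l : 'I_t, (j <= l)%N -> (C l <= C j)%VS.
Hypothesis CJ : forall j l c x, c \in (C j : {vspace A}) -> inJ x ->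
  e i * x = x -> x * e i = x -> c * x \in (C l : {vspace A}).
Hypothesis Crad : (Dsub z C <= rad J P)%VS.

(* Elements of A whose common kernel in a module N is the space of the x in e_i N
   with C_l x = 0. *)
Let b l (o : option 'I_(\dim (C l : {vspace A}))) : A :=
  if o is Some k then (vbasis (C l))`_k else 1 - e i.

Let annP l (N : fdmod A) (x : N) : x \in ann_space (b (l := l)) N <->
  mact (e i) x = x /\ forall c, c \in (C l : {vspace A}) -> mact c x = 0.
Proof.
split=> [/mem_ann H|[ex Hx]].
  split=> [|c Cc].
    by have := H None; rewrite mactBl mact1 => /eqP; rewrite subr_eq0 => /eqP.
  rewrite (coord_vbasis Cc) mact_suml big1 // => k _.
  by rewrite mactZl (H (Some k)) scaler0.
apply/mem_ann => -[k|]; last by rewrite mactBl mact1 ex subrr.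
by apply: Hx; apply: vbasis_mem; rewrite mem_nth // size_tuple.
Qed.

(** A nested direct sum has no proper top-stable degeneration: the elements of
    e_i M killed by C_l contain e_i J M, and their dimension can only increase
    under degeneration; since the top stays the same, a degeneration M' of M
    still has top elements w_0, ..., w_(t-1) with C_l w_l = 0. They define a surjection
    from M onto M', which is bijective by equality of dimensions. *)
Lemma nested_no_degeneration (M : fdmod A) : mod_iso M (quo (Dsub z C)) ->
  no_proper_top_stable_degeneration J e M.
Proof.
move=> MD M' dg tops; have [F [hF imF kF]] := mod_iso_quo_surj MD.
pose q (N : fdmod A) : 'Hom(N, top J N) := qpi (rad J N).
have hq N : mod_hom (q N) by apply: qpi_hom.
have imq N : limg (q N) = fullv by apply: qpi_img.
have kq (N : fdmod A) : lker (q N) = rad J N :> {vspace N} by apply: qpi_ker.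
pose R (N : fdmod A) := (limg (mactl N (e i)) :&: rad J N)%VS.
have dR (N : fdmod A) : (\dim (R N) + dimvec e (top J N) i = dimvec e N i)%N.
  by rewrite -(dimvec_surj e i (hq N) (imq N)) kq.
have dRM : \dim (R M') = \dim (R M).
  apply/eqP; rewrite -(eqn_add2r (dimvec e (top J M') i)) dR.
  by rewrite (dimvec_iso e i tops) dR (degeneration_dimvec eorth esum i dg).
pose E l (N : fdmod A) := ann_space (b (l := l)) N.
have ER l (N : fdmod A) : (E l N :&: lker (q N) <= R N)%VS.
  rewrite kq; apply: capvS; last exact: subvv.
  apply/subvP => x /annP[ex _]; rewrite (mem_e_img eorth); exact/eqP.
have RE l : (R M <= E l M :&: lker (q M))%VS.
  apply/subvP => x; rewrite /R memv_cap (mem_e_img eorth) => /andP[/eqP ex rx].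
  rewrite memv_cap kq rx andbT; apply/annP; split=> // c Cc.
  have := rx; rewrite -(rad_img_surj J hF imF) => /memv_imgP[p rp xE].
  rewrite -ex -mactM xE -hF; apply/eqP; rewrite -memv_ker kF.
  apply/(mem_Dsub eid hz Ce) => r; rewrite (fcoordM eid hz) -mulrA.
  apply: CJ Cc _ _ _; first by apply: idealM; apply: (iffLR (mem_radP hJ he hz p) rp r).
    by rewrite mulrA eid.
  by rewrite -mulrA (fcoord_e eid).
(* the images of z_0, ..., z_l in M are killed by C_l and independent in the top *)
have dimE (l : 'I_t) : (l < \dim (q M @: E l M)%VS)%N.
  apply/free_in; pose wd : 'I_l.+1 -> 'I_t := widen_ord (ltn_ord l).
  exists (fun k => q M (F (z (wd k)))); split=> [k|a a0].
    apply: memv_img; apply/annP; split=> [|c Cc]; first by rewrite -hF (free_gen hz).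
    rewrite -hF; apply/eqP; rewrite -memv_ker kF; apply: mem_Dsub_gen.
    by apply: (subvP (Cdec _)) Cc; rewrite /= -ltnS ltn_ord.
  have rz : \sum_k a k *: z (wd k) \in (rad J P : {vspace P}).
    have : F (\sum_k a k *: z (wd k)) \in (rad J M : {vspace M}).
      rewrite -kq memv_ker linear_sum linear_sum -[X in _ == X]a0; apply/eqP.
      by apply: eq_bigr => k _; rewrite !linearZ.
    rewrite -(rad_img_surj J hF imF) => /memv_imgP[p rp pE].
    rewrite -(subrK p (\sum_k _)) rpredD //; apply: (subvP Crad).
    by rewrite -kF memv_ker linearB /= pE subrr.
  have wI : injective wd by move=> x y /(congr1 val) /= /val_inj.
  move=> k; have := (iffLR (mem_radP hJ he hz _) rz) (wd k).
  rewrite linear_sum (bigD1 k) //= big1 => [|s nsk]; last first.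
    rewrite linearZ /= (fcoord_gen eid hz) (inj_eq wI) eq_sym (negbTE nsk).
    exact: scaler0.
  rewrite addr0 linearZ /= (fcoord_gen eid hz) eqxx rpredZeq.
  by rewrite (negbTE (e_notJ hJ he _)) orbF => /eqP.
have dimE' (l : 'I_t) : (l < \dim (q M' @: E l M')%VS)%N.
  apply: leq_trans (dimE l) _.
  have le := degeneration_ann (b (l := l)) dg; rewrite -!/(E l _) in le.
  rewrite -(leq_add2l (\dim (R M'))).
  apply: (@leq_trans (\dim (E l M'))); last first.
    by rewrite -(limg_ker_dim (q M') (E l M')) leq_add2r dimvS.
  apply: leq_trans le; rewrite dRM -(limg_ker_dim (q M) (E l M)) leq_add2r.
  exact: dimvS.
have [w' [w'E fw']] := adapted_basis dimE'.
have H l : exists x, x \in E l M' /\ w' l = q M' x.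
  by have /memv_imgP[x Ex ->] := w'E l; exists x.
have [w wP] := fin_all_exists H.
have we r : mact (e i) (w r) = w r by have [/annP[]] := wP r.
pose h := fext e (fun=> i) z w; have hh : mod_hom h by apply: (fext_hom eid hz).
have hzw r : h (z r) = w r by apply: (fext_gen eid hz).
have imh : limg h = fullv.
  apply: (nakayama hJ (U := img_sub hh (full_sub P))); apply/eqP.
  rewrite eqEsubv subvf /=; apply/subvP => y _.
  have spanw : <<[tuple w' l | l < t]>>%VS = fullv.
    apply/eqP; rewrite eqEdim subvf /= (eqP fw') size_tuple.
    by rewrite (mod_iso_dim tops) -(mod_iso_dim (top_quo Crad MD)) (top_free_dim hz) card_ord.
  have : q M' y \in <<[tuple w' l | l < t]>>%VS by rewrite spanw memvf.
  move/coord_span => yE.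
  pose x := \sum_(l < t) coord [tuple w' l | l < t] l (q M' y) *: z l.
  suff rx : y - h x \in (rad J M' : {vspace M'}).
    by rewrite -(subrK (h x) y) addrC memv_add ?memv_img ?memvf.
  rewrite -kq memv_ker linearB /= subr_eq0 {1}yE /x !linear_sum; apply/eqP; apply: eq_bigr => l _.
  have -> : [tuple w' l | l < t]`_l = q M' (w l).
    by rewrite -tnth_nth tnth_mktuple; have [_ ->] := wP l.
  by rewrite !linearZ /= hzw.
apply: mod_iso_trans (mod_iso_sym MD); apply: mod_iso_sym.
apply: (quo_iso hh imh); apply/esym/eqP; rewrite eqEdim; apply/andP; split.
  apply: Dsub_sub => r c Cc; rewrite memv_ker hh hzw.
  by have [/annP[_ -> //]] := wP r.
rewrite -(leq_add2r (\dim {:M'})).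
have -> : (\dim (lker h) + \dim {:M'} = \dim {:P})%N.
  by rewrite -(limg_ker_dim h fullv) capfv imh.
rewrite -(dim_quo (Dsub z C)) leq_add2l -(mod_iso_dim MD).
rewrite !(dim_dimvec eorth esum); apply/eq_leq/eq_bigr => k _.
by rewrite (degeneration_dimvec eorth esum k dg).
Qed.

End Nested.
End Basic.

(** * Direct sums of families of modules *)

Section OrdFun.
Variables (m : nat) (T : 'I_m.+1 -> Type) (x0 : T ord0).
Variable xs : forall j, T (lift ord0 j).

(** The family on 'I_(m+1) with value x0 at 0 and xs j at j + 1. *)
Definition ord_fun (i : 'I_m.+1) : T i :=
  match unliftP ord0 i with
  | UnliftSome j E => eq_rect_r T (xs j) E
  | UnliftNone E => eq_rect_r T x0 E
  end.

Lemma ord_fun0 : ord_fun ord0 = x0.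
Proof.
rewrite /ord_fun; case: unliftP => [j E|E]; last by rewrite (eq_axiomK E).
by case/negP: (neq_lift ord0 j); apply/eqP.
Qed.

Lemma ord_funS j : ord_fun (lift ord0 j) = xs j.
Proof.
rewrite /ord_fun; case: unliftP => [k E|E]; last first.
  by case/negP: (neq_lift ord0 j); apply/eqP/esym.
by have jk := lift_inj E; case: k / jk E => E; rewrite (eq_axiomK E).
Qed.

End OrdFun.

Section DirectSums.
Variables (K : fieldType) (A : falgType K).

(** S is the direct sum of the N_i, with injections inj and projections prj. *)
Definition is_dsum_with (I : finType) (N : I -> fdmod A) (S : fdmod A)
    (inj : forall i, 'Hom(N i, S)) (prj : forall i, 'Hom(S, N i)) : Prop :=
  [/\ forall i, mod_hom (inj i), forall i, mod_hom (prj i),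
      forall i y, prj i (inj i y) = y,
      forall i j y, i != j -> prj i (inj j y) = 0
    & forall x, x = \sum_i inj i (prj i x)].

Definition is_dsum (I : finType) (N : I -> fdmod A) (S : fdmod A) : Prop :=
  exists inj prj, @is_dsum_with I N S inj prj.

Definition pair_inl (M N : fdmod A) (x : M) : dsum2 M N := (x, 0).
Definition pair_inr (M N : fdmod A) (y : N) : dsum2 M N := (0, y).
Fact pair_inl_linear (M N : fdmod A) : linear (@pair_inl M N).
Proof.
by move=> k x y; apply: injective_projections; rewrite /= ?scaler0 ?addr0.
Qed.
Fact pair_inr_linear (M N : fdmod A) : linear (@pair_inr M N).
Proof.
by move=> k x y; apply: injective_projections; rewrite /= ?scaler0 ?addr0.
Qed.
Definition lin_inl (M N : fdmod A) : {linear M -> dsum2 M N} :=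
  HB.pack (@pair_inl M N) (GRing.isSemilinear.Build K M (dsum2 M N) _ _
    (GRing.semilinear_linear (@pair_inl_linear M N))).
Definition lin_inr (M N : fdmod A) : {linear N -> dsum2 M N} :=
  HB.pack (@pair_inr M N) (GRing.isSemilinear.Build K N (dsum2 M N) _ _
    (GRing.semilinear_linear (@pair_inr_linear M N))).
Definition pair_fst (M N : fdmod A) (p : dsum2 M N) : M := p.1.
Definition pair_snd (M N : fdmod A) (p : dsum2 M N) : N := p.2.
Fact pair_fst_linear (M N : fdmod A) : linear (@pair_fst M N). Proof. by []. Qed.
Fact pair_snd_linear (M N : fdmod A) : linear (@pair_snd M N). Proof. by []. Qed.
Definition lin_fst (M N : fdmod A) : {linear dsum2 M N -> M} :=
  HB.pack (@pair_fst M N) (GRing.isSemilinear.Build K (dsum2 M N) M _ _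
    (GRing.semilinear_linear (@pair_fst_linear M N))).
Definition lin_snd (M N : fdmod A) : {linear dsum2 M N -> N} :=
  HB.pack (@pair_snd M N) (GRing.isSemilinear.Build K (dsum2 M N) N _ _
    (GRing.semilinear_linear (@pair_snd_linear M N))).

(** The iterated sums by which direct sums of families are defined. *)
Lemma big_is_dsum m (N : 'I_m -> fdmod A) :
  is_dsum N (\big[@dsum2 K A/zero_mod A]_(i < m) N i).
Proof.
elim: m N => [|m IH] N.
  rewrite big_ord0; exists (fun i => 0), (fun i => 0); split; try by case.
  by move=> x; rewrite big_ord0 [x]thinmx0.
rewrite big_ord_recl; set S := \big[_/_]_(i < m) _.
have [inj [prj [hi hp pi1 pi0 ps]]] := IH (fun j => N (lift ord0 j)).
rewrite -/S in inj prj hi hp pi1 pi0 ps *.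
pose U := dsum2 (N ord0) S.
pose i0 : 'Hom(N ord0, U) := linfun (lin_inl (N ord0) S).
pose iS j : 'Hom(N (lift ord0 j), U) := (linfun (lin_inr (N ord0) S) \o inj j)%VF.
pose p0 : 'Hom(U, N ord0) := linfun (lin_fst (N ord0) S).
pose pS j : 'Hom(U, N (lift ord0 j)) := (prj j \o linfun (lin_snd (N ord0) S))%VF.
have i0E x : i0 x = (x, 0) by rewrite lfunE.
have iSE j x : iS j x = (0, inj j x) by rewrite comp_lfunE lfunE.
have p0E x : p0 x = x.1 by rewrite lfunE.
have pSE j x : pS j x = prj j x.2 by rewrite comp_lfunE lfunE.
pose ii := ord_fun (T := fun i => 'Hom(N i, U)) i0 iS.
pose pp := ord_fun (T := fun i => 'Hom(U, N i)) p0 pS.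
have ii0 : ii ord0 = i0 := ord_fun0 _ _.
have iiS j : ii (lift ord0 j) = iS j := ord_funS _ _ _.
have pp0 : pp ord0 = p0 := ord_fun0 _ _.
have ppS j : pp (lift ord0 j) = pS j := ord_funS _ _ _.
exists ii, pp; split.
- move=> i; case: (unliftP ord0 i) => [j ->|->].
    rewrite iiS => a x; rewrite !iSE hi.
    by congr pair; rewrite /= linear0.
  by rewrite ii0 => a x; rewrite !i0E; congr pair; rewrite /= linear0.
- move=> i; case: (unliftP ord0 i) => [j ->|->].
    by rewrite ppS => a x; rewrite !pSE /= hp.
  by rewrite pp0 => a x; rewrite !p0E.
- move=> i; case: (unliftP ord0 i) => [j ->|->] y.
    by rewrite ppS iiS pSE iSE pi1.
  by rewrite pp0 ii0 p0E i0E.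
- move=> i k y; case: (unliftP ord0 i) => [j ->|->]; move: y;
    case: (unliftP ord0 k) => [l ->|->] y.
  + by rewrite (inj_eq lift_inj) => jl; rewrite ppS iiS pSE iSE pi0.
  + by rewrite ppS ii0 pSE i0E linear0.
  + by rewrite pp0 iiS p0E iSE.
  by rewrite eqxx.
move=> x; rewrite big_ord_recl pp0 ii0 i0E p0E.
under eq_bigr => j _ do rewrite iiS ppS iSE pSE.
have -> : \sum_j ((0, inj j (prj j x.2)) : U) = (0, \sum_j inj j (prj j x.2)).
  rewrite -[RHS]/(lin_inr (N ord0) S _) linear_sum.
  by apply: eq_bigr.
by rewrite -ps; case: x => x y; congr pair; rewrite /= ?addr0 ?add0r.
Qed.

Lemma is_dsum_iso (I : finType) (N N' : I -> fdmod A) S S' :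
  is_dsum N S -> is_dsum N' S' -> (forall i, mod_iso (N i) (N' i)) -> mod_iso S S'.
Proof.
move=> [inj [prj [hi hp pi1 pi0 ps]]] [inj' [prj' [hi' hp' pi1' pi0' ps']]] H.
have [f fP] := fin_all_exists H.
have hf i : mod_hom (f i) by have [] := fP i.
have bf i : bijective (f i) by have [] := fP i.
pose F : 'Hom(S, S') := \sum_i (inj' i \o (f i \o prj i))%VF.
have FE x : F x = \sum_i inj' i (f i (prj i x)).
  by rewrite sum_lfunE; apply: eq_bigr => i _; rewrite !comp_lfunE.
have pF i x : prj' i (F x) = f i (prj i x).
  rewrite FE linear_sum (bigD1 i) //= pi1' big1 ?addr0 // => j ji.
  by rewrite pi0' // eq_sym.
exists F; split.
  move=> a x; rewrite !FE linear_sum; apply: eq_bigr => i _.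
  by rewrite hp hf hi'.
apply: lker0_bij.
  apply/vspaceP => x; rewrite memv_ker memv0; apply/eqP/eqP => [x0|->]; last exact: linear0.
  rewrite [x]ps big1 // => i _; have := pF i x; rewrite x0 linear0 => E.
  have [fK _] := bij_lfunK (bf i).
  by rewrite -[prj i x]fK -E !linear0.
apply/vspaceP => y; rewrite memvf; apply/memv_imgP.
exists (\sum_i inj i ((f i)^-1%VF (prj' i y))); first exact: memvf.
rewrite [LHS]ps' FE; apply: eq_bigr => i _; congr (_ _).
rewrite linear_sum (bigD1 i) //= pi1 big1 ?addr0 => [|j ji].
  by have [_ ->] := bij_lfunK (bf i).
by rewrite pi0 // eq_sym.
Qed.

Lemma is_dsum_nest m (t : 'I_m -> nat) (N : forall i, 'I_(t i) -> fdmod A)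
    (S : 'I_m -> fdmod A) (U : fdmod A) :
  (forall i, is_dsum (@N i) (S i)) -> is_dsum S U ->
  is_dsum (fun p : {i : 'I_m & 'I_(t i)} => @N (tag p) (tagged p)) U.
Proof.
move=> H [inj [prj [hi hp pi1 pi0 ps]]].
have [jnj H'] := fin_all_exists H; have [qrj jP] := fin_all_exists H'.
exists (fun p => (inj (tag p) \o jnj (tag p) (tagged p))%VF).
exists (fun p => (qrj (tag p) (tagged p) \o prj (tag p))%VF); split.
- by move=> p; apply: hom_comp => //; have [] := jP (tag p).
- by move=> p; apply: hom_comp => //; have [] := jP (tag p).
- by move=> p y; rewrite !comp_lfunE pi1; have [_ _ -> ] := jP (tag p).
- move=> [i j] [k l] y /=; rewrite !comp_lfunE => npq.
  have [ik|ik] := eqVneq i k; last by rewrite pi0 // linear0.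
  case: k / ik l y npq => l y npq; rewrite pi1.
  have [_ _ _ -> //] := jP i; apply: contraNneq npq => ->; exact: eqxx.
move=> x; rewrite {1}[x]ps.
transitivity (\sum_i \sum_(j < t i) inj i (jnj i j (qrj i j (prj i x)))).
  apply: eq_bigr => i _; have [_ _ _ _ E] := jP i.
  by rewrite {1}[prj i x]E linear_sum.
rewrite sig_big_dep /=; apply: eq_bigr => p _.
by rewrite !comp_lfunE.
Qed.

End DirectSums.

(** * Direct sums of quotients of indecomposable projectives *)

Section DimvecSum.
Variables (K : fieldType) (A : falgType K) (n : nat) (e : 'I_n -> A).

Lemma dimvec_dsum (I : finType) (N : I -> fdmod A) S i : is_dsum N S ->
  dimvec e S i = (\sum_k dimvec e (N k) i)%N.
Proof.
move=> [inj [prj [hi hp pi1 pi0 ps]]].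
pose U k : {vspace S} := (inj k @: limg (mactl (N k) (e i)))%VS.
have dU k : \dim (U k) = dimvec e (N k) i.
  apply: limg_dim_eq; suff -> : lker (inj k) = 0%VS by rewrite capv0.
  by apply/eqP/lker0P => x y E; rewrite -[x]pi1 E pi1.
have SE : limg (mactl S (e i)) = (\sum_k U k)%VS.
  apply/eqP; rewrite eqEsubv; apply/andP; split.
    apply/subvP => _ /memv_imgP[x _ ->]; rewrite mactlE {1}[x]ps linear_sum.
    apply: memv_sumr => k _; rewrite /= -hi memv_img // -mactlE.
    by rewrite memv_img ?memvf.
  apply/subv_sumP => k _; apply/subvP => _ /memv_imgP[_ /memv_imgP[x _ ->] ->].
  by rewrite mactlE hi -mactlE memv_img ?memvf.
rewrite /dimvec SE -(eq_bigr _ (fun k _ => dU k)).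
apply/directvP/directv_sum_independent => u Uu u0 k _.
have : prj k (\sum_l u l) = 0 by rewrite u0 linear0.
have uE l : exists y, u l = inj l y.
  by have /memv_imgP[y _ ->] := Uu l isT; exists y.
rewrite linear_sum (bigD1 k) //= big1 => [|l lk].
  by have [y ->] := uE k; rewrite pi1 addr0 => ->; rewrite linear0.
by have [y ->] := uE l; rewrite pi0 // eq_sym.
Qed.

End DimvecSum.

Section Basic.
Variables (K : closedFieldType) (A : falgType K) (n : nat).
Variables (J : left_ideal A) (e : 'I_n -> A).
Hypothesis hJ : is_jacobson J.
Hypothesis he : basic_with e.
Local Notation inJ x := (x \in (J : {vspace A})).
Local Notation eid := (e_idem he).
Local Notation esum := (e_sum he).

(** A submodule of A e_i as a left ideal of A, and conversely. *)
Definition lam_ideal i (C : submod (Lam (e i))) : left_ideal A :=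
  img_sub (@sub_incl_hom K A (regular A) (Lam_ideal (e i))) C.
Definition ideal_lam i (C : left_ideal A) : submod (Lam (e i)) :=
  preim_sub (@sub_incl_hom K A (regular A) (Lam_ideal (e i))) C.

Lemma mem_lam_ideal i (C : submod (Lam (e i))) (u : Lam (e i)) :
  (vsval u \in (lam_ideal C : {vspace A})) = (u \in (C : {vspace Lam (e i)})).
Proof.
apply/memv_imgP/idP => [[v Cv]|Cu]; last by exists u; rewrite // sub_inclE.
by rewrite sub_inclE => /subvs_inj ->.
Qed.

Lemma mem_ideal_lam i (C : left_ideal A) (u : Lam (e i)) :
  (u \in (ideal_lam i C : {vspace Lam (e i)})) = (vsval u \in (C : {vspace A})).
Proof. by rewrite -memv_preim sub_inclE. Qed.

Lemma lam_ideal_e i (C : submod (Lam (e i))) c :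
  c \in (lam_ideal C : {vspace A}) -> c * e i = c.
Proof.
move=> /memv_imgP[u _ ->]; rewrite sub_inclE; apply/(lam_memP he).
exact: subvsP.
Qed.

Lemma lam_val_e i (u : Lam (e i)) : vsval u * e i = vsval u.
Proof. by apply/(lam_memP he)/subvsP. Qed.

Lemma lam_proj_e i a : a * e i = a ->
  exists u : Lam (e i), vsval u = a.
Proof.
move=> ae; exists (mact a (lam_gen e i)).
by rewrite (lam_actE he).
Qed.

Lemma ideal_lamK i (C : left_ideal A) :
  (forall c, c \in (C : {vspace A}) -> c * e i = c) ->
  lam_ideal (ideal_lam i C) = C :> {vspace A}.
Proof.
move=> Ce; apply/vspaceP => c; apply/idP/idP => [|Cc].
  by move=> /memv_imgP[u Cu ->]; rewrite sub_inclE -mem_ideal_lam.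
have [u uc] := lam_proj_e (Ce c Cc).
by rewrite -uc mem_lam_ideal mem_ideal_lam uc.
Qed.

Lemma rad_lam_ideal i c : c \in (lam_ideal (rad J (Lam (e i))) : {vspace A}) <->
  inJ c /\ c * e i = c.
Proof.
split=> [/memv_imgP[u ru ->]|[Jc ce]].
  rewrite sub_inclE; split; last exact: lam_val_e.
  apply: (subvP (rad_regular hJ)); rewrite -sub_inclE.
  apply: (subvP (rad_img J (@sub_incl_hom K A (regular A) (Lam_ideal (e i))))).
  exact: memv_img.
have [u uc] := lam_proj_e ce; rewrite -uc mem_lam_ideal.
have -> : u = mact c (lam_gen e i).
  by apply: subvs_inj; rewrite (lam_actE he) uc ce.
exact: mem_rad.
Qed.

Section Free.
Variables (I : finType) (idx : I -> 'I_n) (P : fdmod A) (z : I -> P).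
Hypothesis hz : free_basis e idx z.

(** A direct sum of quotients A e_(idx p) / C_p is the quotient of the free module
    on the z_p by the submodule generated by the C_p z_p. *)
Lemma dsum_quo_iso (C : forall p, submod (Lam (e (idx p)))) (S : fdmod A) :
  is_dsum (fun p => quo (C p)) S ->
  mod_iso (quo (Dsub z (fun p => lam_ideal (C p)))) S.
Proof.
move=> [inj [prj [hi hp pi1 pi0 ps]]].
pose y p := inj p (qpi (C p) (lam_gen e (idx p))).
have ge p : mact (e (idx p)) (lam_gen e (idx p)) = lam_gen e (idx p).
  by apply: subvs_inj; rewrite (lam_actE he) (lam_genE he) eid.
have yE a p : mact a (y p) = inj p (qpi (C p) (mact a (lam_gen e (idx p)))).
  by rewrite /y -hi -qpi_hom.
pose F := fext e idx z y; have hF : mod_hom F by apply: (fext_hom eid hz).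
have FE x : F x = \sum_p inj p (qpi (C p) (mact (fcoord e idx z p x) (lam_gen e (idx p)))).
  by rewrite /F fextE; apply: eq_bigr => p _; rewrite yE.
have pF p x : prj p (F x) = qpi (C p) (mact (fcoord e idx z p x) (lam_gen e (idx p))).
  rewrite FE linear_sum (bigD1 p) //= pi1 big1 ?addr0 // => q qp.
  by rewrite pi0 // eq_sym.
apply: (quo_iso hF).
  apply/vspaceP => s; rewrite memvf; apply/memv_imgP.
  have H p : exists a, prj p s = qpi (C p) (mact a (lam_gen e (idx p))).
    have [u ->] := qpi_surj (prj p s); exists (vsval u); congr (qpi _ _).
    by apply: subvs_inj; rewrite (lam_actE he) lam_val_e.
  have [a aP] := fin_all_exists H.
  exists (\sum_p mact (a p) (z p)); first exact: memvf.
  rewrite linear_sum [LHS]ps; apply: eq_bigr => p _.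
  rewrite aP /= (fext_mact eid hz) ?yE //.
  by rewrite ge.
have Ce p c : c \in (lam_ideal (C p) : {vspace A}) -> c * e (idx p) = c.
  exact: lam_ideal_e.
have cE p x : vsval (mact (fcoord e idx z p x) (lam_gen e (idx p))) = fcoord e idx z p x.
  by rewrite (lam_actE he) (fcoord_e eid).
apply/vspaceP => x; rewrite memv_ker; apply/eqP/idP => [x0|Dx].
  apply/(mem_Dsub eid hz Ce) => p; rewrite -cE mem_lam_ideal -qpi_eq0 -pF x0.
  by rewrite linear0.
rewrite FE big1 // => p _; suff -> : qpi (C p) (mact (fcoord e idx z p x) (lam_gen e (idx p))) = 0.
  by rewrite linear0.
apply/eqP; rewrite qpi_eq0 -mem_lam_ideal cE.
by move: p; apply/(mem_Dsub eid hz Ce).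
Qed.

Lemma Dsub_rad : Dsub z (fun p => lam_ideal (rad J (Lam (e (idx p))))) = rad J P :> {vspace P}.
Proof.
have Ce p c : c \in (lam_ideal (rad J (Lam (e (idx p)))) : {vspace A}) -> c * e (idx p) = c.
  exact: lam_ideal_e.
apply/vspaceP => x; apply/idP/idP => [/(mem_Dsub eid hz Ce) Dx|/(mem_radP hJ he hz) Jx].
  by apply/(mem_radP hJ he hz) => r; have /rad_lam_ideal[] := Dx r.
apply/(mem_Dsub eid hz Ce) => r; apply/rad_lam_ideal; split; first exact: Jx.
exact: (fcoord_e eid).
Qed.

(** The top of P is the direct sum of the simple modules of its basis. *)
Lemma top_dsum (S : fdmod A) : is_dsum (fun p => Simple J (e (idx p))) S ->
  mod_iso (top J P) S.
Proof.
move=> dS; have := dsum_quo_iso (C := fun p => rad J (Lam (e (idx p)))) dS.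
apply: mod_iso_trans; apply: quo_eq_iso; apply/esym; exact: Dsub_rad.
Qed.

End Free.

Lemma dimvec_simple i k : dimvec e (Simple J (e i)) k = (i == k).
Proof.
rewrite (top_free_dimvec hJ he (lam_free he i)) /=.
case: (i == k); last by apply: eq_card0.
by rewrite (eq_card (B := predT)) // card_ord.
Qed.

Section Semisimple.
Variable t : 'I_n -> nat.
Local Notation T := (semisimple_of J e t).

Lemma semisimple_dsum :
  is_dsum (fun p : {i : 'I_n & 'I_(t i)} => Simple J (e (tag p))) T.
Proof.
apply: (is_dsum_nest (N := fun i (j : 'I_(t i)) => Simple J (e i)) _ (big_is_dsum _)).
by move=> i; apply: big_is_dsum.
Qed.

Lemma dimvec_semisimple i : dimvec e T i = t i.
Proof.
rewrite (dimvec_dsum _ _ semisimple_dsum).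
transitivity (\sum_(k < n) \sum_(j < t k) (k == i))%N.
  by rewrite sig_big_dep /=; apply: eq_bigr => p _; rewrite dimvec_simple.
rewrite (bigD1 i) //= eqxx sum_nat_const card_ord muln1 big1 ?addn0 // => k /negbTE->.
by rewrite sum_nat_const muln0.
Qed.

Lemma semisimple_rad j (x : T) : inJ j -> mact j x = 0.
Proof.
move=> Jj; have [inj [prj [hi hp pi1 pi0 ps]]] := semisimple_dsum.
rewrite [mact j x]ps big1 // => p _; rewrite hp.
have [u ->] := qpi_surj (prj p x).
suff -> : mact j (qpi (rad J (Lam (e (tag p)))) u) = 0 by rewrite linear0.
by rewrite -qpi_hom; apply/eqP; rewrite qpi_eq0 mem_rad.
Qed.

(** The basis of a projective cover of T has t_i elements of type i. *)
Lemma cover_count (I : finType) (idx : I -> 'I_n) (P : fdmod A) (z : I -> P) :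
  free_basis e idx z -> projective_cover P T ->
  mod_iso (top J P) T /\ forall i, #|[pred r | idx r == i]| = t i.
Proof.
move=> hz [_ [f [hf imf fsup]]].
have radf : (rad J P <= lker f)%VS.
  by apply: rad_sub => j x Jj; rewrite memv_ker hf semisimple_rad.
have frad : (lker f <= rad J P)%VS.
  apply/subvP => v fv; apply/(mem_radP hJ he hz) => r; apply: contraT => nJ.
  have he_r : e (idx r) * fcoord e idx z r v \notin (J : {vspace A}).
    apply: contra nJ => Jv; rewrite -[fcoord _ _ _ _ _]mul1r -esum mulr_suml.
    apply: rpred_sum => i _; have [->//|ni] := eqVneq i (idx r).
    rewrite -(fcoord_e eid idx z r v) mulrA; exact: e_offdiag.
  have [||u [_ _ _ uE]] :=
      @e_local _ _ _ _ _ hJ he (idx r) (e (idx r) * fcoord e idx z r v) _ _ he_r.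
  - by rewrite mulrA eid.
  - by rewrite -mulrA (fcoord_e eid).
  have full : preim_sub (fcoord_hom eid hz r) J = fullv :> {vspace P}.
    apply: fsup; apply/eqP; rewrite eqEsubv subvf /=; apply/subvP => x _.
    pose w := mact (fcoord e idx z r x * u) (mact (e (idx r)) v).
    rewrite -(subrK w x); apply: memv_add.
      rewrite -memv_preim linearB /= /w !(fcoordM eid hz) -mulrA uE (fcoord_e eid).
      by rewrite subrr mem0v.
    by rewrite memv_ker /w !hf; move: fv; rewrite memv_ker => /eqP->; rewrite !linear0.
  have : z r \in (preim_sub (fcoord_hom eid hz r) J : {vspace P}).
    by rewrite full memvf.
  by rewrite -memv_preim (fcoord_gen eid hz) eqxx (negbTE (e_notJ hJ he _)).
have topT : mod_iso (top J P) T.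
  by apply: (quo_iso hf imf); apply/eqP; rewrite eqEsubv frad radf.
split=> // i; rewrite -(top_free_dimvec hJ he hz) (dimvec_iso e i topT).
exact: dimvec_semisimple.
Qed.

End Semisimple.

(** Distinguished sequences satisfy the definition of a basis used here. *)
Lemma distinguished_free (P : fdmod A) m (idx : 'I_m -> 'I_n) (z : 'I_m -> P) :
  distinguished_sequence e idx z -> free_basis e idx z.
Proof.
move=> [ze ziso zdir zfull]; split=> [r|x|a a0 r]; first by rewrite -ze.
  have : x \in (\sum_r (cyc (z r) : {vspace P}))%VS by rewrite zfull memvf.
  move=> /memv_sumP[u Uu ->].
  have H r : exists a, u r = mact a (z r) by apply/cyc_vsP/Uu.
  have [a aP] := fin_all_exists H; exists (finfun a).
  by apply: eq_bigr => r _; rewrite ffunE.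
have ar0 : mact (a r) (z r) = 0.
  have /directv_sum_independent H := zdir.
  apply: (H (fun r => mact (a r) (z r))) => // q _.
  by apply/cyc_vsP; exists (a q).
have gre p : mact (e (idx p)) (z p) = z p by rewrite -ze.
have lfr := lam_free he (idx r).
(* the surjection A e_(idx r) -> A z_r is injective, by equality of dimensions *)
pose F := fext e (fun _ : 'I_1 => idx r) (fun _ => lam_gen e (idx r)) (fun _ => z r).
have FE (u : Lam (e (idx r))) : F u = mact (vsval u) (z r).
  have -> : u = mact (vsval u) (lam_gen e (idx r)).
    by apply: subvs_inj; rewrite (lam_actE he) lam_val_e.
  by rewrite (@fext_mact _ _ _ _ eid _ _ _ _ lfr _ _ _ ord0) //= (lam_actE he) lam_val_e.
have imF : limg F = cyc (z r) :> {vspace P}.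
  apply/vspaceP => x; apply/memv_imgP/cyc_vsP => [[u _ ->]|[b ->]].
    by exists (vsval u).
  exists (mact b (lam_gen e (idx r))); first exact: memvf.
  by rewrite FE (lam_actE he) mactM -ze.
have kF : lker F = 0%VS.
  apply/eqP; rewrite -dimv_eq0 -(eqn_add2r (\dim (limg F))) add0n.
  have := limg_ker_dim F fullv; rewrite capfv => ->; rewrite imF.
  rewrite -(mod_iso_dim (ziso r)); apply/eqP.
  by rewrite !dimvf /dim /=.
have [u uE] := lam_proj_e (i := idx r) (a := a r * e (idx r))
  (etrans (esym (mulrA _ _ _)) (congr1 _ (eid _))).
have : u \in lker F by rewrite memv_ker FE uE mactM -ze ar0.
by rewrite kF memv0 -uE => /eqP->; rewrite linear0.
Qed.

Lemma free_basis_reindex (I I' : finType) (idx : I -> 'I_n) (idx' : I' -> 'I_n)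
    (P : fdmod A) (z : I -> P) (b : I' -> I) : bijective b ->
  (forall p, idx (b p) = idx' p) -> free_basis e idx z -> free_basis e idx' (z \o b).
Proof.
move=> [c bK cK] bidx [ze zs zi]; split=> [p|x|a a0 p].
- by rewrite /= -bidx ze.
- have [a ->] := zs x; exists [ffun p => a (b p)].
  rewrite (reindex b) /=; last by exists c => ? _.
  by apply: eq_bigr => p _; rewrite ffunE.
rewrite -bidx; have := zi [ffun r => a (c r)].
rewrite -[X in X = 0](_ : \sum_p mact (a p) (z (b p)) = _).
  by move=> /(_ a0 (b p)); rewrite ffunE bK.
rewrite [RHS](reindex b) /=; last by exists c => ? _.
by apply: eq_bigr => q _; rewrite ffunE bK.
Qed.

Lemma Dsub_reindex (I I' : finType) (P : fdmod A) (z : I -> P) (b : I' -> I)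
    (C : I -> left_ideal A) : bijective b ->
  Dsub z C = Dsub (z \o b) (C \o b) :> {vspace P}.
Proof.
move=> [c bK cK]; rewrite /= (reindex b) /=; last by exists c => ? _.
by [].
Qed.

End Basic.

(** * Nested families of left ideals *)

(** Pairwise comparable subspaces, sorted by descending dimension. *)
Lemma chain_sort (K : fieldType) (V : vectType K) t (C : 'I_t -> {vspace V}) :
  (forall j l, (C j <= C l)%VS \/ (C l <= C j)%VS) ->
  exists s : {perm 'I_t}, forall j l : 'I_t, (j <= l)%N -> (C (s l) <= C (s j))%VS.
Proof.
case: t C => [|t] C cmp; first by exists 1%g; case.
pose r (a b : 'I_t.+1) := (\dim (C b) <= \dim (C a))%N.
pose q := sort r (enum 'I_t.+1).
have sq : size q = t.+1 by rewrite size_sort size_enum_ord.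
have uq : uniq q by rewrite sort_uniq enum_uniq.
have inj : injective (fun j : 'I_t.+1 => nth ord0 q j).
  move=> j l /eqP; rewrite nth_uniq ?sq //.
  by move=> /eqP/val_inj.
exists (perm inj) => j l jl; rewrite !permE.
have tr : transitive r by move=> a b c ba ac; exact: leq_trans ac ba.
have srt : sorted r q by apply: sort_sorted => a b; apply: leq_total.
have refl : reflexive r by move=> a; rewrite /r leqnn.
have : r (nth ord0 q j) (nth ord0 q l).
  by apply: (sorted_leq_nth tr refl) => //; rewrite inE sq.
rewrite /r; case: (cmp (nth ord0 q l) (nth ord0 q j)) => // le dle.
suff -> : C (nth ord0 q j) = C (nth ord0 q l) by [].
by apply/eqP; rewrite eqEdim le.
Qed.

Lemma Dsub_eq (K : fieldType) (A : falgType K) (I : finType) (P : fdmod A) (z : I -> P)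
    (C C' : I -> left_ideal A) : (forall p, C p = C' p :> {vspace A}) ->
  Dsub z C = Dsub z C' :> {vspace P}.
Proof. by move=> CC'; apply: eq_bigr => p _; rewrite /= CC'. Qed.

Section Basic.
Variables (K : closedFieldType) (A : falgType K) (n : nat).
Variables (J : left_ideal A) (e : 'I_n -> A).
Hypothesis hJ : is_jacobson J.
Hypothesis he : basic_with e.
Local Notation inJ x := (x \in (J : {vspace A})).
Local Notation eid := (e_idem he).

(** If P and a quotient P / D have isomorphic tops, then D <= rad P, by comparing
    dimensions. *)
Lemma rad_of_top (P M T : fdmod A) (D : submod P) : mod_iso (top J P) T ->
  mod_iso (top J M) T -> mod_iso M (quo D) -> (D <= rad J P)%VS.
Proof.
move=> PT MT MD; have [f [hf imf kf]] := mod_iso_quo_surj MD.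
have dP := limg_ker_dim f fullv; rewrite capfv imf kf in dP.
have dR := limg_ker_dim f (rad J P); rewrite (rad_img_surj J hf imf) kf in dR.
have tP := dim_quo (rad J P); have tM := dim_quo (rad J M).
have := mod_iso_dim (mod_iso_trans PT (mod_iso_sym MT)) => tPM.
rewrite /top in tPM; rewrite tPM in tP.
have capD : (rad J P :&: D <= D)%VS by apply: capvSr.
have dD : (\dim D <= \dim (rad J P :&: D))%N.
  move: dP; rewrite -tM -tP -dR addnA => /eqP; rewrite eqn_add2r eqn_add2r.
  by move=> /eqP->.
have E : (rad J P :&: D)%VS = D.
  by apply/eqP; rewrite eqEdim capD.
by rewrite -E capvSl.
Qed.

(** A module with the same top as P is a quotient of P by a submodule of rad P. *)
Lemma rad_presentation (I : finType) (idx : I -> 'I_n) (P M : fdmod A) (z : I -> P) :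
  free_basis e idx z -> mod_iso (top J P) (top J M) ->
  exists C : submod P, (C <= rad J P)%VS /\ mod_iso M (quo C).
Proof.
move=> hz [g [hg bg]]; have [kg img] := bij_lker0 bg.
pose f := (g \o qpi (rad J P))%VF.
have hf : mod_hom f by apply: hom_comp => //; apply: qpi_hom.
have fE x : f x = g (qpi (rad J P) x) by rewrite comp_lfunE.
have kf x : f x = 0 -> x \in (rad J P : {vspace P}).
  rewrite fE => fx; rewrite -qpi_eq0; apply/eqP.
  by have [gK _] := bij_lfunK bg; rewrite -[LHS]gK fx linear0.
have [h [hh hE]] := free_lift eid hz (@qpi_hom _ _ M (rad J M)) (qpi_img _) hf.
have imh : limg h = fullv.
  apply: (nakayama hJ (U := img_sub hh (full_sub P))); apply/eqP.
  rewrite eqEsubv subvf andTb; apply/subvP => y _.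
  have [x xE] : exists x, qpi (rad J M) y = f x.
    have /memv_imgP[u _ uE] : qpi (rad J M) y \in limg g by rewrite img memvf.
    by by have [x xu] := qpi_surj u; exists x; rewrite fE -xu -uE.
  rewrite -(subrK (h x) y) addrC; apply: memv_add; first by rewrite memv_img ?memvf.
  by rewrite -qpi_eq0 linearB /= hE xE subrr.
exists (ker_sub hh); split.
  by apply/subvP => x /=; rewrite memv_ker => /eqP hx; apply: kf; rewrite -hE hx linear0.
by apply: mod_iso_sym; apply: (quo_iso hh).
Qed.

Section Sigma.
Variable t : 'I_n -> nat.
Local Notation sig := {i : 'I_n & 'I_(t i)}.

(** The conditions on the left ideals of a nested decomposition, seen in A: the
    ideals C_(i,j) descend in j, and right multiplication by an element of e_i J e_k
    maps C_(i,j) into C_(k,l) for (i,j) <> (k,l). *)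
Definition nested_ideals (C : sig -> left_ideal A) : Prop :=
  [/\ forall p c, c \in (C p : {vspace A}) -> c * e (tag p) = c,
      forall i (j l : 'I_(t i)), (j <= l)%N ->
        (C (Tagged (fun i => 'I_(t i)) l) <= C (Tagged (fun i => 'I_(t i)) j))%VS
    & forall p q x c, p != q -> inJ x -> e (tag p) * x = x -> x * e (tag q) = x ->
        c \in (C p : {vspace A}) -> c * x \in (C q : {vspace A})].

(** If there are at least two ideals of type i, then they absorb right
    multiplication by elements of e_i J e_i without restriction on the indices:
    one passes through another index of the same type. *)
Lemma nested_absorb C i (j l : 'I_(t i)) c x : nested_ideals C -> (2 <= t i)%N ->
  c \in (C (Tagged (fun i => 'I_(t i)) j) : {vspace A}) -> inJ x ->
  e i * x = x -> x * e i = x ->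
  c * x \in (C (Tagged (fun i => 'I_(t i)) l) : {vspace A}).
Proof.
move=> [Ce Cdec Crad] t2 Cc Jx ex xe.
have C1 (j' l' : 'I_(t i)) : j' != l' ->
    c \in (C (Tagged (fun i => 'I_(t i)) j') : {vspace A}) ->
    c * x \in (C (Tagged (fun i => 'I_(t i)) l') : {vspace A}).
  move=> jl; apply: (Crad (Tagged (fun i => 'I_(t i)) j')) => //.
  by rewrite eq_Tagged.
have [jl|] := eqVneq j l; last by move=> jl; apply: C1 Cc.
rewrite -{l}jl.
have [j0|jn0] := eqVneq (j : nat) 0%N.
  apply: (subvP (Cdec i j (Ordinal t2) _)); first by rewrite j0.
  by apply: (C1 j) => //; rewrite -val_eqE /= j0.
apply: (C1 (Ordinal (ltnW t2)) j); first by rewrite -val_eqE /= eq_sym.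
exact: (subvP (Cdec i (Ordinal (ltnW t2)) j (leq0n _))).
Qed.

Variables (P : fdmod A) (zz : sig -> P).
Hypothesis hzz : free_basis e (fun p => tag p) zz.

(** Homomorphisms from A e_i to A e_k are right multiplications by elements of
    e_i A e_k, and their image is in the radical when the element is in J. *)
Lemma nested_decompositionP M : nested_decomposition J e t M <->
  exists C, nested_ideals C /\ mod_iso M (quo (Dsub zz C)).
Proof.
have dsum (C : forall i : 'I_n, 'I_(t i) -> submod (Lam (e i))) :
    mod_iso (quo (Dsub zz (fun p => lam_ideal (C (tag p) (tagged p)))))
      (\big[@dsum2 K A/zero_mod A]_(i < n) \big[@dsum2 K A/zero_mod A]_(j < t i) quo (C i j)).
  apply: (dsum_quo_iso he hzz (C := fun p => C (tag p) (tagged p))).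
  apply: (is_dsum_nest (N := fun i (j : 'I_(t i)) => quo (C i j)) _ (big_is_dsum _)).
  by move=> i; apply: big_is_dsum.
split=> [[C [MC Cdec Crad]]|[C [[Ce Cdec Crad] MC]]].
  exists (fun p => lam_ideal (C (tag p) (tagged p))); split; last first.
    by apply: mod_iso_trans MC _; apply: mod_iso_sym.
  split=> [p c|i j l jl|p q x c npq Jx ex xe]; first exact: (lam_ideal_e he).
    by apply: limgS; apply: Cdec.
  move=> /memv_imgP[u Cu ->]; rewrite sub_inclE.
  have [f [hf fE]] := lam_hom he ex xe; rewrite -fE mem_lam_ideal.
  have/subvP sub : (f @: C (tag p) (tagged p) <= C (tag q) (tagged q))%VS.
    apply: Crad => //.
      by case: (p) (q) npq => i j [k l] /eqP npq; apply: npq.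
    apply/subvP => _ /memv_imgP[v _ ->]; rewrite -mem_lam_ideal.
    apply/(rad_lam_ideal hJ he); rewrite fE; split; last by rewrite -mulrA xe.
    exact: idealM.
  by apply: sub; apply: memv_img.
exists (fun i j => ideal_lam e i (C (Tagged (fun i => 'I_(t i)) j))); split.
- apply: mod_iso_trans MC _; apply: mod_iso_trans (dsum _).
  apply: quo_eq_iso; apply: Dsub_eq => -[i j].
  by apply/esym/(ideal_lamK he); apply: (Ce (existT _ i j)).
- move=> i j l jl; apply/subvP => u; rewrite !mem_ideal_lam.
  by apply: subvP; apply: Cdec.
move=> i j k l npq f hf frad; apply/subvP => _ /memv_imgP[u Cu ->].
pose x := vsval (f (lam_gen e i)).
have gE : mact (e i) (lam_gen e i) = lam_gen e i.
  by apply: subvs_inj; rewrite (lam_actE he) (lam_genE he) eid.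
have ue : u = mact (vsval u) (lam_gen e i).
  by apply: subvs_inj; rewrite (lam_actE he) lam_val_e.
have fE : vsval (f u) = vsval u * x by rewrite {1}ue hf sub_actE.
have [Jx xe] : inJ x /\ x * e k = x.
  apply/(rad_lam_ideal hJ he); rewrite mem_lam_ideal; apply: (subvP frad).
  by rewrite memv_img ?memvf.
rewrite mem_ideal_lam fE; move: Cu; rewrite mem_ideal_lam.
apply: (Crad (existT _ i j) (existT _ k l)) => //; first exact/eqP.
by rewrite /= /x -{2}gE hf sub_actE.
Qed.

End Sigma.

(** Permuting the indices j makes pairwise comparable C_(i,j) descend in j. *)
Lemma sort_nested (t : 'I_n -> nat) (P : fdmod A) (zz : {i : 'I_n & 'I_(t i)} -> P)
    (C : {i : 'I_n & 'I_(t i)} -> left_ideal A) M :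
  free_basis e (fun p => tag p) zz ->
  (forall p c, c \in (C p : {vspace A}) -> c * e (tag p) = c) ->
  (forall p q, tag p = tag q -> (C p <= C q)%VS \/ (C q <= C p)%VS) ->
  (forall p q x c, p != q -> inJ x -> e (tag p) * x = x -> x * e (tag q) = x ->
        c \in (C p : {vspace A}) -> c * x \in (C q : {vspace A})) ->
  mod_iso M (quo (Dsub zz C)) -> nested_decomposition J e t M.
Proof.
move=> hzz Ce Ccmp Crad MC.
pose ET i (j : 'I_(t i)) := existT (fun i => 'I_(t i)) i j.
have H i : exists s : {perm 'I_(t i)}, forall j l : 'I_(t i), (j <= l)%N ->
    (C (ET i (s l)) <= C (ET i (s j)))%VS.
  by apply: (chain_sort (C := fun j => C (ET i j) : {vspace A})) => j l; apply: Ccmp.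
have [s sP] := fin_all_exists H.
pose b (p : {i : 'I_n & 'I_(t i)}) := ET (tag p) (s (tag p) (tagged p)).
have bb : bijective b.
  exists (fun p => ET (tag p) ((s (tag p))^-1 (tagged p))%g) => -[i j];
    by rewrite /b /ET /= ?permK ?permKV.
have hb : free_basis e (fun p => tag p) (zz \o b).
  by apply: (free_basis_reindex bb _ hzz).
apply/(nested_decompositionP hb); exists (C \o b); split.
  split=> [p c|i j l|p q x c npq]; first exact: (Ce (b p)).
    exact: sP.
  by apply: (Crad (b p) (b q)); rewrite (bij_eq bb).
by apply: mod_iso_trans MC _; apply: quo_eq_iso; apply: Dsub_reindex.
Qed.

(** The consequences of the stability under limits, for some presentation of M. *)
Lemma lim_stable_ideals (I : finType) (idx : I -> 'I_n) (P : fdmod A) (z : I -> P)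
    (hz : free_basis e idx z) (M : fdmod A) (C : submod P) :
  lim_stable J he hz M -> (C <= rad J P)%VS -> mod_iso M (quo C) ->
  exists C' : I -> left_ideal A,
  [/\ forall p c, c \in (C' p : {vspace A}) -> c * e (idx p) = c,
      forall p q, idx p = idx q -> (C' p <= C' q)%VS \/ (C' q <= C' p)%VS,
      forall p q x c, p != q -> inJ x -> e (idx p) * x = x -> x * e (idx q) = x ->
        c \in (C' p : {vspace A}) -> c * x \in (C' q : {vspace A}),
      (Dsub z C' <= rad J P)%VS & mod_iso M (quo (Dsub z C'))].
Proof.
move=> hM Crad MC; have [C' [Ce C'rad MC']] := lim_gen_diag hM Crad MC.
exists C'; split=> //.
  by move=> p q; apply: (comparable hJ hM Ce C'rad MC').
by move=> p q x c; apply: (radical_sub hJ hM Ce C'rad MC').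
Qed.

Section Blocks.
Variables (t : 'I_n -> nat) (I : finType) (idx : I -> 'I_n).
Hypothesis cnt : forall i, #|[pred r | idx r == i]| = t i.

(** A numbering of the basis by pairs (i, j), with t_i elements of type i. *)
Lemma block_bij : exists b : {i : 'I_n & 'I_(t i)} -> I,
  bijective b /\ forall p, idx (b p) = tag p.
Proof.
pose b (p : {i : 'I_n & 'I_(t i)}) : I :=
  enum_val (cast_ord (esym (cnt (tag p))) (tagged p)).
have idxb p : idx (b p) = tag p.
  by have /eqP := enum_valP (cast_ord (esym (cnt (tag p))) (tagged p)).
exists b; split=> //; apply: inj_card_bij.
  move=> [i j] [k l] E; have ik : i = k by have := idxb (existT _ i j); rewrite E idxb.
  case: k / ik l E => l /enum_val_inj/cast_ord_inj /= jl.
  by rewrite /= in jl; rewrite jl.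
rewrite -sum1_card (partition_big idx predT) //=.
rewrite card_tagged sumnE big_map big_enum /=; apply: leq_sum => i _.
by rewrite sum1_card card_ord -(cnt i).
Qed.

End Blocks.
End Basic.

(** * Nested and isotypic decompositions *)

Section Basic.
Variables (K : closedFieldType) (A : falgType K) (n : nat).
Variables (J : left_ideal A) (e : 'I_n -> A).
Hypothesis hJ : is_jacobson J.
Hypothesis he : basic_with e.
Local Notation inJ x := (x \in (J : {vspace A})).
Local Notation eid := (e_idem he).
Local Notation eorth := (e_orthogonal he).
Local Notation esum := (e_sum he).

Lemma Dsub_radP (I : finType) (idx : I -> 'I_n) (P : fdmod A) (z : I -> P)
    (C : I -> left_ideal A) : free_basis e idx z ->
  (forall p c, c \in (C p : {vspace A}) -> c * e (idx p) = c) ->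
  (Dsub z C <= rad J P)%VS <-> forall p c, c \in (C p : {vspace A}) -> inJ c.
Proof.
move=> hz Ce; split=> [/subvP Crad p c Cc|CJ].
  have /(mem_radP hJ he hz)/(_ p) := Crad _ (mem_Dsub_gen z Cc).
  by rewrite (fcoord_mact eid hz) eqxx Ce.
by apply: Dsub_sub => r c Cc; apply: mem_rad; apply: CJ Cc.
Qed.

Lemma offdiag_J i k x : i != k -> e i * x = x -> x * e k = x -> inJ x.
Proof. by move=> ik ex xe; rewrite -xe -ex e_offdiag. Qed.

Section Parts.
Variables (t : 'I_n -> nat) (m : nat) (idx : 'I_m -> 'I_n).
Variables (P : fdmod A) (z : 'I_m -> P).
Local Notation sig := {i : 'I_n & 'I_(t i)}.
Local Notation ET j := (Tagged (fun i => 'I_(t i)) j).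
Variable b : sig -> 'I_m.
Hypothesis bb : bijective b.
Hypothesis idxb : forall p, idx (b p) = tag p.
Hypothesis hz : free_basis e idx z.
Local Notation zz := (z \o b).

Let hzz : free_basis e (fun p => tag p) zz.
Proof. exact: (free_basis_reindex bb _ hz). Qed.

Let P_ i := P_part e z i.

Let Pvs i : {vspace P} :=
  sum_sub (fun r => z r == mact (e i) (z r)) (fun r => cyc (z r)).

Let part_idx i r : (z r == mact (e i) (z r)) = (idx r == i).
Proof.
apply/eqP/eqP => [zr|<-]; last by rewrite (free_gen hz).
have := fcoord_gen eid hz r r; rewrite zr (fcoord_mact eid hz) eqxx => E.
apply/eqP; rewrite eq_sym; apply: contraT => /(e_orth he) E0.
by move: (e_neq0 he (idx r)); rewrite -E E0 eqxx.
Qed.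

Let gen_in i (j : 'I_(t i)) : z (b (ET j)) \in Pvs i.
Proof.
have H : z (b (ET j)) == mact (e i) (z (b (ET j))).
  by rewrite part_idx idxb.
apply: (subvP (sumv_sup (b (ET j)) H (subvv _))).
by apply/cyc_vsP; exists 1; rewrite mact1.
Qed.

(** The basis of the part of type i of P. *)
Definition part_basis i (j : 'I_(t i)) : P_ i := vsproj (Pvs i) (z (b (ET j))).

Let part_val i (j : 'I_(t i)) : vsval (part_basis j) = z (b (ET j)).
Proof. by rewrite vsprojK ?gen_in. Qed.

Let part_act i a (x : P_ i) : vsval (mact a x) = mact a (vsval x).
Proof. exact: sub_actE. Qed.

Let part_coord i x p : x \in Pvs i -> tag p != i ->
  fcoord e (fun p => tag p) zz p x = 0.
Proof.
move=> /memv_sumP[u Uu ->] pi; rewrite linear_sum big1 // => r /=.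
rewrite part_idx => /eqP ri; have [|a ->] := cyc_vsP _ _ (Uu r _).
  by rewrite part_idx ri.
have [c bK cK] := bb; rewrite -{1}[r]cK -/(zz (c r)) (fcoord_mact eid hzz).
by case: eqP => // E; move: pi; rewrite E -idxb cK ri eqxx.
Qed.

Lemma part_free i : free_basis e (fun _ : 'I_(t i) => i) (@part_basis i).
Proof.
have vs_sum (a : 'I_(t i) -> A) : vsval (\sum_j mact (a j) (part_basis j)) =
    \sum_j mact (a j) (zz (ET j)).
  rewrite linear_sum; apply: eq_bigr => j _.
  by apply: etrans (part_act _ _) _; rewrite part_val.
split=> [j|x|a a0 j].
- apply: subvs_inj; rewrite part_act part_val.
  exact: (free_gen hzz (ET j)).
- pose c (j : 'I_(t i)) := fcoord e (fun p => tag p) zz (ET j) (vsval x).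
  exists (finfun c); apply: subvs_inj; rewrite vs_sum.
  under eq_bigr => j _ do rewrite ffunE.
  rewrite -{1}[vsval x](fcoord_sum hzz).
  transitivity (\sum_k \sum_(l < t k)
      mact (fcoord e (fun p => tag p) zz (ET l) (vsval x)) (zz (ET l))).
    by rewrite sig_big_dep /=; apply: eq_bigr => -[k l] _.
  rewrite (bigD1 i) //= [X in _ + X]big1 ?addr0 // => k ki.
  rewrite big1 // => l _; rewrite (part_coord (i := i)) ?mact0l //.
  exact: subvsP.
have := vs_sum a; rewrite a0 linear0 => /esym E0.
have := congr1 (fcoord e (fun p => tag p) zz (ET j)) E0.
rewrite linear0 linear_sum (bigD1 j) //= big1 ?addr0.
  by rewrite (fcoord_mact eid hzz) eqxx.
move=> l lj; rewrite (fcoord_mact eid hzz); case: eqP => // /eqP.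
by rewrite eq_Tagged /= eq_sym (negbTE lj).
Qed.

(** P / (+) C_p z_p is the direct sum of the quotients of its parts. *)
Lemma part_dsum (C : sig -> left_ideal A) :
  (forall p c, c \in (C p : {vspace A}) -> c * e (tag p) = c) ->
  mod_iso (quo (Dsub zz C)) (\big[@dsum2 K A/zero_mod A]_(i < n)
     quo (Dsub (@part_basis i) (fun j => C (ET j)))).
Proof.
move=> Ce; pose C' i (j : 'I_(t i)) := ideal_lam e i (C (ET j)).
have CE p : C p = lam_ideal (C' (tag p) (tagged p)) :> {vspace A}.
  by case: p => i j; apply/esym/(ideal_lamK he); apply: (Ce (ET j)).
have S1 : is_dsum (fun p : sig => quo (C' (tag p) (tagged p)))
    (\big[@dsum2 K A/zero_mod A]_(i < n) \big[@dsum2 K A/zero_mod A]_(j < t i) quo (C' i j)).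
  apply: (is_dsum_nest (N := fun i (j : 'I_(t i)) => quo (C' i j)) _ (big_is_dsum _)).
  by move=> i; apply: big_is_dsum.
apply: mod_iso_trans (quo_eq_iso (Dsub_eq _ CE)) _.
apply: mod_iso_trans (dsum_quo_iso he hzz S1) _.
apply: (is_dsum_iso (big_is_dsum _) (big_is_dsum _)) => i.
apply: mod_iso_sym.
apply: mod_iso_trans (quo_eq_iso (Dsub_eq _ (fun j => CE (ET j)))) _.
exact: (dsum_quo_iso he (part_free i) (big_is_dsum _)).
Qed.

Variable M : fdmod A.
Hypothesis topM : mod_iso (top J P) (top J M).

Lemma nested_isotypic : nested_decomposition J e t M ->
  isotypic_decomposition J e t z M.
Proof.
move=> /(nested_decompositionP hJ he hzz)[C [CN MC]]; have [Ce Cdec Crad] := CN.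
have CJ : forall p c, c \in (C p : {vspace A}) -> inJ c.
  by apply/(Dsub_radP hzz Ce); apply: rad_of_top topM (mod_iso_refl _) MC.
have CPrad i : (Dsub (@part_basis i) (fun j => C (ET j)) <= rad J (P_ i))%VS.
  apply/(Dsub_radP (part_free i)) => [j c|j c]; first exact: (Ce (ET j)).
  exact: CJ.
exists (fun i => quo (Dsub (@part_basis i) (fun j => C (ET j)))).
exists (fun i => Dsub (@part_basis i) (fun j => C (ET j))); split.
- by apply: mod_iso_trans MC _; apply: part_dsum.
- move=> i; apply: mod_iso_trans (mod_iso_sym (top_quo (CPrad i) (mod_iso_refl _))) _.
  by apply: (top_dsum hJ he (part_free i)); apply: big_is_dsum.
- by move=> i; split; [apply: CPrad | apply: mod_iso_refl].
- move=> i ti.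
  apply: (nested_no_degeneration hJ he (part_free i) (C := fun j => C (ET j))).
  + by move=> j c; apply: (Ce (ET j)).
  + by move=> j l; apply: Cdec.
  + move=> j l c x Cc Jx ex xe.
    exact: nested_absorb CN ti Cc Jx ex xe.
  + exact: CPrad.
  + exact: mod_iso_refl.
move=> i k /eqP ik f hf; rewrite sub_limgP; apply: Dsub_sub => j c Cc.
rewrite -memv_preim hf.
have Cke (l : 'I_(t k)) c' : c' \in (C (ET l) : {vspace A}) -> c' * e k = c'.
  exact: (Ce (ET l)).
apply/(mem_Dsub eid (part_free k) Cke) => l; rewrite (fcoordM eid (part_free k)).
have ex : e i * fcoord e (fun _ => k) (@part_basis k) l (f (part_basis j)) =
    fcoord e (fun _ => k) (@part_basis k) l (f (part_basis j)).
  by rewrite -(fcoordM eid (part_free k)) -hf (free_gen (part_free i)).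
have xe := fcoord_e eid (fun _ => k) (@part_basis k) l (f (part_basis j)).
apply: (Crad (ET j) (ET l)) => //; last exact: offdiag_J ik ex xe.
by apply: contra ik => /eqP/(congr1 tag)/= ->.
Qed.

(** With at most one top element the limits are trivial; otherwise they are
    top-stable degenerations. *)
Lemma part_lim_stable i (N : fdmod A) :
  ((2 <= t i)%N -> no_proper_top_stable_degeneration J e N) ->
  lim_stable J he (part_free i) N.
Proof.
move=> nd D Drad ND r; have [t2|t1] := ltnP 1 (t i).
  apply: mod_iso_sym; apply: (nd t2).
    apply: (lim_degeneration eorth esum) => // x.
    apply: (fcoord_eq (part_free i)) => q.
    by rewrite !(fcoord_cogen_proj he (part_free i)); case: (q == r).
  apply: mod_iso_trans (top_quo Drad ND).
  apply: mod_iso_sym; apply: (top_quo _ (mod_iso_refl _)).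
  exact: lim_gen_rad.
apply: mod_iso_trans ND _; apply: quo_eq_iso.
have p0 x : cogen_proj e (fun _ : 'I_(t i) => i) (@part_basis i) r x = 0.
  apply: (fcoord_eq (part_free i)) => q; rewrite (fcoord_cogen_proj he (part_free i)) linear0.
  have [//|/negP[]] := eqVneq q r; apply/eqP/val_inj => /=.
  have := ltn_ord q; have := ltn_ord r; case: (t i) t1 (q : nat) (r : nat) => [|[|//]] _;
    by case=> [|?] [|?].
apply/eqP; rewrite eqEsubv; apply/andP; split.
  apply/subvP => x Dx; rewrite -[x]add0r memv_add ?mem0v //.
  by rewrite memv_cap Dx memv_ker p0 eqxx.
rewrite subv_add capvSl andbT; apply/subvP => _ /memv_imgP[x _ ->].
by rewrite p0 mem0v.
Qed.

Lemma isotypic_nested : isotypic_decomposition J e t z M ->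
  nested_decomposition J e t M.
Proof.
move=> [N [D [MN Ntop DN Nnd Dhom]]].
have H i : exists C : 'I_(t i) -> left_ideal A,
  [/\ forall p c, c \in (C p : {vspace A}) -> c * e i = c,
      forall p q : 'I_(t i), i = i -> (C p <= C q)%VS \/ (C q <= C p)%VS,
      forall p q x c, p != q -> inJ x -> e i * x = x -> x * e i = x ->
        c \in (C p : {vspace A}) -> c * x \in (C q : {vspace A}),
      (Dsub (@part_basis i) C <= rad J (P_ i))%VS & mod_iso (N i) (quo (Dsub (@part_basis i) C))].
  have [Drad ND] := DN i.
  exact: (lim_stable_ideals hJ (part_lim_stable (Nnd i)) Drad ND).
have [C CP] := fin_all_exists H.
pose C' (p : sig) := C (tag p) (tagged p).
have C'e p c : c \in (C' p : {vspace A}) -> c * e (tag p) = c.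
  by have [Ce _ _ _ _] := CP (tag p); apply: Ce.
have MC : mod_iso M (quo (Dsub zz C')).
  apply: mod_iso_trans MN _; apply: mod_iso_sym.
  apply: mod_iso_trans (part_dsum C'e) _.
  apply: (is_dsum_iso (big_is_dsum _) (big_is_dsum _)) => i.
  by apply: mod_iso_sym; have [] := CP i.
apply: (sort_nested hJ he hzz C'e _ _ MC).
  move=> [i j] [k l] /= ik; case: k / ik l => l.
  by have [_ cmp _ _ _] := CP i; apply: cmp.
move=> [i j] [k l] x c npq Jx /= ex xe Cc.
have [ik|ik] := eqVneq i k.
  case: k / ik l npq xe => l npq xe.
  have [_ _ Crad _ _] := CP i; apply: (Crad j l) => //.
  by apply: contra npq => /eqP->.
(* for i <> k, the condition on homomorphisms P_i -> P_k is transported to the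
   direct sums of the C_(i,j) and of the C_(k,l) by automorphisms g and h *)
have lift k' : exists g : 'End(P_ k'), mod_aut g /\
    Dsub (@part_basis k') (C k') = (g @: D k')%VS :> {vspace P_ k'}.
  have [_ _ _ Crad NC] := CP k'; have [Drad ND] := DN k'.
  apply: (lift_iso hJ he (part_free k')) => //.
  exact: mod_iso_trans (mod_iso_sym ND) NC.
have [g [[hg bg] gE]] := lift i; have [h [[hh bh] hE]] := lift k.
(* f is given by z_(i,j) |-> x z_(k,l) *)
pose y (j' : 'I_(t i)) : P_ k := if j' == j then mact x (part_basis l) else 0.
pose f := fext e (fun _ => i) (@part_basis i) y.
have hf : mod_hom f by apply: (fext_hom eid (part_free i)).
have [hK hV] := bij_lfunK bh.
have hf0 : mod_hom (h^-1 \o (f \o g))%VF.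
  by apply: hom_comp (hom_inv hh bh) (hom_comp hf hg).
have /subvP f0D := Dhom i k (elimN eqP ik) _ hf0.
have ey : mact (e i) (y j) = y j by rewrite /y eqxx -mactM ex.
have : f (mact c (part_basis j)) \in (Dsub (@part_basis k) (C k) : {vspace P_ k}).
  have : mact c (part_basis j) \in (Dsub (@part_basis i) (C i) : {vspace P_ i}).
    exact: mem_Dsub_gen.
  rewrite gE => /memv_imgP[u Du ->]; rewrite hE -[f _]hV memv_img //.
  have := f0D _ (memv_img (h^-1 \o (f \o g))%VF Du).
  by rewrite !comp_lfunE.
rewrite (fext_mact eid (part_free i) c ey) /y eqxx -mactM.
have [Ce _ _ _ _] := CP k; move=> /(mem_Dsub eid (part_free k) Ce)/(_ l).
by rewrite (fcoord_mact eid (part_free k)) eqxx -mulrA xe.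
Qed.

End Parts.
End Basic.

(** * Limits under the diagonal torus *)

Section LimitCurve.
Variables (K : closedFieldType) (V : vectType K) (f : 'End(V)).
Hypothesis ff : forall x, f (f x) = f x.

(** For a projection f, the map which is 1 on the image and s on the kernel of f. *)
Definition lim_curve s : 'End(V) := f + s *: (\1%VF - f).

Lemma lim_curveE s x : lim_curve s x = f x + s *: (x - f x).
Proof. by rewrite add_lfunE scale_lfunE add_lfunE opp_lfunE id_lfunE. Qed.

Lemma lim_curveM s r x : lim_curve s (lim_curve r x) = lim_curve (s * r) x.
Proof.
have fE : f (lim_curve r x) = f x.
  by rewrite lim_curveE linearD linearZ linearB /= !ff subrr scaler0 addr0.
by rewrite [LHS]lim_curveE fE lim_curveE addrAC subrr add0r lim_curveE scalerA.
Qed.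

Lemma lim_curve1 x : lim_curve 1 x = x.
Proof. by rewrite lim_curveE scale1r addrC subrK. Qed.

Lemma lim_curve_bij s : s != 0 -> bijective (lim_curve s).
Proof.
move=> s0; exists (lim_curve s^-1) => x; rewrite lim_curveM ?mulVf ?mulfV //;
  exact: lim_curve1.
Qed.

(** The limit of U has the dimension of U. *)
Lemma lim_dim (U : {vspace V}) : \dim (f @: U + U :&: lker f) = \dim U.
Proof.
rewrite -(limg_ker_dim f U) addnC dimv_disjoint_sum //.
apply/eqP; rewrite -subv0; apply/subvP => x.
rewrite memv_cap => /andP[/memv_imgP[y _ ->]].
by rewrite memv_cap memv_ker ff memv0 => /andP[].
Qed.

(** The limit of the subspaces (f + s (1 - f)) C for s -> 0 in the Grassmannian. *)
Lemma lim_Gr_closed (C : {vspace V}) (Z : {vspace V} -> Prop) :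
  Gr_closed (\dim C) Z -> (forall s, s != 0 -> Z (lim_curve s @: C)%VS) ->
  Z (f @: C + C :&: lker f)%VS.
Proof.
move=> hZ Zs; pose Y := (C :&: lker f)%VS; pose X := (C :\: lker f)%VS.
have XY : (X :&: Y = 0)%VS.
  apply/eqP; rewrite -subv0 -(capv_diff C (lker f)).
  by apply: capvS => //; apply: capvSr.
have CXY : (X + Y = C)%VS by apply: addv_diff_cap.
pose p := daddv_pi X Y; pose q := daddv_pi Y X.
have pq x : x \in C -> p x + q x = x by move=> Cx; apply: daddv_pi_add => //; rewrite CXY.
have YX : (Y :&: X = 0)%VS by rewrite capvC.
have pC x : p x \in C by rewrite -CXY; apply: (subvP (addvSl _ _)); apply: memv_pi.
have qY x : q x \in Y by apply: memv_pi.
have qC x : q x \in C by apply: (subvP (capvSl C (lker f))); apply: qY.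
have pY y : y \in Y -> p y = 0.
  move=> Yy; have Cy : y \in C by apply: (subvP (capvSl C (lker f))).
  have := pq _ Cy; rewrite [q y]daddv_pi_id // => /eqP.
  by rewrite -subr_eq0 addrK => /eqP.
have pp x : p (p x) = p x by apply: daddv_pi_proj.
have qp x : q (p x) = 0.
  have := pq _ (pC x); rewrite pp => /eqP.
  by rewrite -subr_eq0 addrAC subrr add0r => /eqP.
have fq x : f (q x) = 0 by have := qY x; rewrite memv_cap memv_ker => /andP[_ /eqP].
have fY y : y \in Y -> f y = 0 by rewrite memv_cap memv_ker => /andP[_ /eqP].
(* a curve of linear maps which on X is f + s (1 - f) and on Y the identity *)
pose U := ((f \o p) + q)%VF; pose W := ((\1 - f) \o p)%VF.
have UE x : U x = f (p x) + q x by rewrite add_lfunE comp_lfunE.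
have WE x : W x = p x - f (p x) by rewrite comp_lfunE add_lfunE opp_lfunE id_lfunE.
pose D s := ((U + s *: W)%VF @: C)%VS.
have DE s x : (U + s *: W)%VF x = lim_curve s (p x) + q x.
  by rewrite add_lfunE scale_lfunE UE WE lim_curveE addrAC.
have DE0 x : (U + 0 *: W)%VF x = f (p x) + q x.
  by rewrite DE lim_curveE scale0r; congr (_ + _); apply: addr0.
have D0 : D 0 = (f @: C + Y)%VS.
  apply/vspaceP => x; apply/memv_imgP/memv_addP => [[c Cc ->]|].
    rewrite DE0.
    by exists (f (p c)); rewrite ?memv_img //; exists (q c).
  move=> [_ /memv_imgP[c Cc ->] [y Yy ->]].
  exists (p c + y); first by rewrite rpredD // (subvP (capvSl C (lker f))).
  rewrite DE0; have -> : p (p c + y) = p c by rewrite linearD /= pp (pY y Yy) addr0.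
  rewrite linearD /= qp add0r.
  by rewrite [q y]daddv_pi_id // -{1}(pq c Cc) linearD /= fq addr0.
have Ds s : s != 0 -> D s = (lim_curve s @: C)%VS.
  move=> s0; apply/vspaceP => x; apply/memv_imgP/memv_imgP => -[c Cc ->].
    exists (p c + s^-1 *: q c); first by rewrite rpredD // rpredZ.
    rewrite DE linearD linearZ /= [lim_curve s (q c)]lim_curveE fq add0r subr0.
    by rewrite scalerA mulVf // scale1r.
  exists (p c + s *: q c); first by rewrite rpredD // rpredZ.
  rewrite DE; have -> : p (p c + s *: q c) = p c.
    by rewrite linearD linearZ /= pp (pY _ (qY c)) scaler0 addr0.
  rewrite !linearD !linearZ /= qp add0r.
  rewrite [q (q c)]daddv_pi_id // -{1}(pq c Cc) linearD /=.
  by rewrite [lim_curve s (q c)]lim_curveE fq add0r subr0.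
rewrite -/Y -D0; apply: (Gr_curve_closed hZ (D := D)
  (u := fun i : 'I_(\dim C) => U (vbasis C)`_i) (w := fun i => W (vbasis C)`_i)).
  move=> s; split.
    have [->|s0] := eqVneq s 0; first by rewrite D0 /Y lim_dim.
    by rewrite Ds // bij_dim //; apply: lim_curve_bij.
  rewrite /D -{1}(span_basis (vbasisP C)) limg_span; congr (<<_>>%VS).
  apply: (@eq_from_nth _ 0); first by rewrite size_map size_tuple size_map size_enum_ord.
  rewrite size_map size_tuple => i lti.
  rewrite (nth_map 0) ?size_tuple // (nth_map (Ordinal lti)) ?size_enum_ord //.
  rewrite (_ : nth _ _ _ = Ordinal lti); last by apply: val_inj; rewrite /= nth_enum_ord.
  by rewrite add_lfunE scale_lfunE.
by move=> s s0; rewrite Ds //; apply: Zs.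
Qed.

End LimitCurve.

Section Basic.
Variables (K : closedFieldType) (A : falgType K) (n : nat).
Variables (J : left_ideal A) (e : 'I_n -> A).
Hypothesis hJ : is_jacobson J.
Hypothesis he : basic_with e.
Local Notation inJ x := (x \in (J : {vspace A})).
Local Notation eid := (e_idem he).
Local Notation eorth := (e_orthogonal he).
Local Notation esum := (e_sum he).

(** Presentations of M by submodules of rad P are points of the variety Grass. *)
Lemma quo_Grass (P M : fdmod A) (d : 'I_n -> nat) (C : submod P) :
  (forall i, dimvec e M i = d i) -> (C <= rad J P)%VS -> mod_iso M (quo C) ->
  Grass J e d C.
Proof.
move=> hd Crad MC; split=> // [|i]; last by rewrite -(dimvec_iso e i MC) hd.
rewrite /Gr -(dim_quo C) (dim_dimvec eorth esum (quo C)).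
rewrite [X in (_ + X - _)%N](eq_bigr d) ?addnK // => i _.
by rewrite -(dimvec_iso e i MC) hd.
Qed.

Lemma dimvec_lim (P : fdmod A) (f : 'End(P)) (hf : mod_hom f) (C : submod P) i :
  (forall x, f (f x) = f x) ->
  dimvec e (quo (lim_sub hf C)) i = dimvec e (quo C) i.
Proof.
move=> ff; pose E := mactl P (e i).
have EE x : E (E x) = E x by rewrite !mactlE -mactM eid.
have Ef x : E (f x) = f (E x) by rewrite !mactlE hf.
have capE (D : submod P) : (limg E :&: D = E @: D)%VS.
  apply/vspaceP => x; rewrite memv_cap; apply/andP/memv_imgP => [[/memv_imgP[y _ ->] Dy]|].
    by exists (E y); rewrite // EE.
  by move=> [y Dy ->]; rewrite memv_img ?memvf // mactlE sub_stable.
have E_lim : (E @: lim_sub hf C = f @: (E @: C) + (E @: C) :&: lker f)%VS.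
  rewrite /= limgD; congr (_ + _)%VS.
    rewrite -!limg_comp; congr (_ @: _)%VS; apply/lfunP => x.
    by rewrite !comp_lfunE Ef.
  apply/vspaceP => x; apply/memv_imgP/idP => [[y]|].
    rewrite !memv_cap !memv_ker => /andP[Cy /eqP fy] ->.
    by rewrite memv_img //= -Ef fy linear0.
  rewrite memv_cap => /andP[/memv_imgP[y Cy ->] kx].
  exists (E y); last by rewrite EE.
  by rewrite memv_cap kx andbT mactlE sub_stable.
have H (D : submod P) : (\dim (E @: D) + dimvec e (quo D) i = dimvec e P i)%N.
  by rewrite -(dimvec_surj e i (@qpi_hom _ _ _ D) (qpi_img D)) qpi_ker capE.
apply/eqP; rewrite -(eqn_add2l (\dim (E @: C))) H -[in X in (X + _)%N](lim_dim ff) -E_lim.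
by rewrite H.
Qed.

Section Torus.
Variables (m : nat) (idx : 'I_m -> 'I_n) (P : fdmod A) (z : 'I_m -> P).
Hypothesis hz : free_basis e idx z.
Variables (d : 'I_n -> nat) (M : fdmod A).
Hypothesis hd : forall i, dimvec e M i = d i.

(** The limits of C along the basis elements lie in the closure of the orbit of C
    under a maximal torus. *)
Lemma no_proper_lim_stable : no_proper_torus_degeneration J e d P M ->
  lim_stable J he hz M.
Proof.
move=> nd C Crad MC r; apply: mod_iso_sym; apply: nd.
pose f := cogen_proj e idx z r.
have ff x : f (f x) = f x.
  by apply: (fcoord_eq hz) => q; rewrite !(fcoord_cogen_proj he hz); case: (q == r).
have GC := quo_Grass hd Crad MC.
have GL : Grass J e d (lim_gen he hz r C).
  have dv i : dimvec e (quo (lim_gen he hz r C)) i = d i.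
    by rewrite (dimvec_lim _ _ _ ff); have [_ _ ->] := GC.
  by apply: (quo_Grass dv (lim_gen_rad he hz r Crad) (mod_iso_refl _)).
exists C, (lim_gen he hz r C), (diag_torus z); split=> //.
- exact: (diag_torus_maximal hJ he hz).
- split=> // Z; have [<- _ _] := GC => hZ ZY.
  apply: (lim_Gr_closed ff hZ) => s s0; apply: ZY; exists (lim_curve f s); split=> //.
  pose x q := if q == r then s else 1.
  suff -> : lim_curve f s = diag_elt e idx z x.
    by apply: (diag_elt_torus he hz) => q; rewrite /x; case: (q == r); rewrite ?oner_eq0.
  apply: (hom_eq hz); last 1 first.
  + move=> q; rewrite (diag_elt_gen he hz) lim_curveE /f cogen_projE.
    rewrite (fcoord_gen eid hz) /x eq_sym; case: eqP => [->|_].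
      by rewrite (free_gen hz) subrr subr0 add0r.
    by rewrite mact0l subr0 subrr scaler0 addr0 scale1r.
  + apply: hom_add; first exact: (cogen_proj_hom he hz).
    apply: hom_scale => a y; have hf := cogen_proj_hom he hz r.
    by rewrite !add_lfunE !opp_lfunE !id_lfunE hf linearB.
  exact: (diag_elt_hom he hz).
exact: mod_iso_refl.
Qed.

End Torus.
End Basic.

(** * Closures of torus orbits *)

Lemma tagged_ex n (t : 'I_n -> nat) (q : {i : 'I_n & 'I_(t i)}) i : tag q = i ->
  exists l : 'I_(t i), q = Tagged (fun i => 'I_(t i)) l.
Proof. by move=> <-; exists (tagged q); case: q. Qed.

(** A sum over all pairs with terms of one type only. *)
Lemma sum_block (V : nmodType) n (t : 'I_n -> nat) i (F : {i : 'I_n & 'I_(t i)} -> V) :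
  (forall r, tag r != i -> F r = 0) ->
  \sum_r F r = \sum_(j < t i) F (Tagged (fun i => 'I_(t i)) j).
Proof.
move=> F0; transitivity (\sum_k \sum_(l < t k) F (Tagged (fun i => 'I_(t i)) l)).
  by rewrite sig_big_dep /=; apply: eq_bigr => -[k l] _.
rewrite (bigD1 i) //= [X in _ + X]big1 ?addr0 // => k ki.
by rewrite big1 // => l _; apply: F0.
Qed.

Section Basic.
Variables (K : closedFieldType) (A : falgType K) (n : nat).
Variables (J : left_ideal A) (e : 'I_n -> A).
Hypothesis hJ : is_jacobson J.
Hypothesis he : basic_with e.
Local Notation inJ x := (x \in (J : {vspace A})).
Local Notation eid := (e_idem he).

Section Closure.
Variables (t : 'I_n -> nat) (P : fdmod A).
Local Notation sig := {i : 'I_n & 'I_(t i)}.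
Local Notation ET j := (Tagged (fun i => 'I_(t i)) j).
Variable zz : sig -> P.
Hypothesis hzz : free_basis e (fun p => tag p) zz.
Local Notation c_ := (fcoord e (fun p : sig => tag p) zz).
Variable C : sig -> left_ideal A.
Hypothesis CN : nested_ideals J e C.
Variable g : 'End(P).
Hypothesis hg : mod_hom g.
Hypothesis bg : bijective g.
Local Notation D := (Dsub zz C).

Let Ce p c : c \in (C p : {vspace A}) -> c * e (tag p) = c.
Proof. by have [+ _ _] := CN; apply. Qed.

(** The twist u needed when z_p is the only basis element of its type: then C_p need
    not be stable under e_i J e_i, and u is chosen to invert the coefficient of
    z_p in g^(-1) z_p. Otherwise u = e_i. *)
Lemma block_unit p : exists u v,
  [/\ e (tag p) * u = u, v * u = e (tag p), (2 <= t (tag p))%N -> u = e (tag p)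
    & t (tag p) = 1%N -> u * c_ p (g^-1 (zz p))%VF = e (tag p)].
Proof.
case: p => i s; have [t2|] := ltnP 1 (t i).
  by exists (e i), (e i); split; rewrite /= ?eid // => t1; rewrite t1 in t2.
move=> t1 /=; have hV := hom_inv hg bg.
have [c [d [_ gd cd _]]] := gamma_aut hJ he hzz (conj hg bg).
have only (r : sig) : tag r = i -> r = ET s.
  case: r => k l /= ki; case: i / ki s t1 => s t1.
  congr (existT _ _ _); apply/val_inj => /=; have := ltn_ord s; have := ltn_ord l.
  by case: (t k) t1 (s : nat) (l : nat) => [|[|//]] _; case=> [|?] [|?].
set v := c_ _ _.
have nJv : ~~ inJ v.
  have [Jv _] := gd (ET s) (ET s); apply: contra (e_notJ hJ he i) => Jv'.
  have d0 : d (ET s) (ET s) != 0.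
    apply/eqP => d0; have := cd (ET s) (ET s); rewrite eqxx big1 => [|r _].
      by move/esym/eqP; rewrite oner_eq0.
    have [ri|ri] := eqVneq (tag r) i; first by rewrite (only r ri) d0 mulr0.
    by rewrite (gd r (ET s)).2 ?mulr0.
  have : inJ (d (ET s) (ET s) *: e i).
    by rewrite -(rpredDl _ Jv) subrK.
  by move/(rpredZ (d (ET s) (ET s))^-1); rewrite scalerA mulVf // scale1r.
have [||u [eu _ vu uv]] := @e_local _ _ _ _ _ hJ he i v _ _ nJv.
- exact: (coord_gen_e he hzz hV (ET s)).
- exact: (fcoord_e eid).
exists u, v; split=> //.
Qed.

(** For a basis in which the torus is diagonal, each conjugate h (g D) contains
    s + 1 independent combinations of the C_(i,s) u z_(i,j), j < t_i: those which
    give the h (g z_(i,a)) modulo the radical, for a <= s and indices counted from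
    0. Here C_(i,s) <= C_(i,a), and the elements of the radical are absorbed by the
    conditions on C. *)
Lemma torus_incidence : exists u v : sig -> A,
  [/\ forall p, e (tag p) * u p = u p, forall p, v p * u p = e (tag p) &
   forall (h : 'End(P)) (al : sig -> K), mod_aut h ->
     (forall p, h (zz p) = al p *: zz p) ->
     forall i (s : 'I_(t i)), exists L : 'M[K]_(s.+1, t i), row_free L /\
       forall a (b : 'I_(\dim (C (ET s) : {vspace A}))),
         \sum_j L a j *: mact ((vbasis (C (ET s)))`_b * u (ET s)) (zz (ET j))
           \in (h @: (g @: D))%VS].
Proof.
have [u H] := fin_all_exists block_unit; have [v uvP] := fin_all_exists H.
exists u, v; split=> [p|p|]; [by have [] := uvP p | by have [] := uvP p | ].
move=> h al [hh bh] hal i s; have hV := hom_inv hg bg; have [_ gVK] := bij_lfunK bg.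
have [c [d [gc gd cd _]]] := gamma_aut hJ he hzz (conj hg bg).
have al0 p : al p != 0.
  apply/eqP => a0; have := hal p; rewrite a0 scale0r.
  have [hK _] := bij_lfunK bh => /(congr1 (h^-1)%VF); rewrite hK linear0 => z0.
  have := fcoord_gen eid hzz p p; rewrite z0 linear0 eqxx.
  by move/esym/eqP; rewrite (negbTE (e_neq0 he _)).
pose w (a : 'I_s.+1) : 'I_(t i) := widen_ord (ltn_ord s) a.
exists (\matrix_(a, j) (c (ET (w a)) (ET j) * al (ET j))); split.
  apply/row_freeP; exists (\matrix_(j, a) ((al (ET j))^-1 * d (ET j) (ET (w a)))).
  apply/matrixP => a a'; rewrite !mxE.
  transitivity (\sum_(j < t i) c (ET (w a)) (ET j) * d (ET j) (ET (w a'))).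
    by apply: eq_bigr => j _; rewrite !mxE -mulrA mulVKf.
  rewrite -(sum_block (i := i) (F := fun r => c (ET (w a)) r * d r (ET (w a')))).
    by rewrite cd eq_Tagged /= -val_eqE.
  by move=> r ri; rewrite (gc (ET (w a)) r).2 ?mul0r // eq_sym.
move=> a b; set x := _`_b.
have Cx : x \in (C (ET s) : {vspace A}).
  by apply: vbasis_mem; rewrite mem_nth // size_tuple.
have [eu vu u2 u1] := uvP (ET s); rewrite /= in eu vu u2 u1.
pose y := \sum_(j < t i) c (ET (w a)) (ET j) *: mact (x * u (ET s)) (zz (ET j)).
have -> : \sum_(j < t i) (\matrix_(a, j) (c (ET (w a)) (ET j) * al (ET j))) a j *:
    mact (x * u (ET s)) (zz (ET j)) = h y.
  rewrite linear_sum; apply: eq_bigr => j _.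
  by rewrite mxE linearZ /= hh hal linearZ /= scalerA.
rewrite -[y]gVK !memv_img //.
apply/(mem_Dsub eid hzz Ce) => q.
pose X := \sum_(j < t i) c (ET (w a)) (ET j) *: c_ q ((g^-1)%VF (zz (ET j))).
have -> : c_ q ((g^-1)%VF y) = x * (u (ET s) * X).
  rewrite /y /X !linear_sum /= !mulr_sumr; apply: eq_bigr => j _.
  by rewrite !linearZ /= hV (fcoordM eid hzz) !scalerAr mulrA.
have eX : e i * X = X.
  rewrite /X mulr_sumr; apply: eq_bigr => j _.
  by rewrite -scalerAr (coord_gen_e he hzz hV (ET j)).
have Xe : X * e (tag q) = X.
  by rewrite /X mulr_suml; apply: eq_bigr => j _; rewrite -scalerAl (fcoord_e eid).
pose dl : K := (ET (w a) == q)%:R.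
have JX : inJ (X - dl *: e i).
  have -> : dl = \sum_(j < t i) c (ET (w a)) (ET j) * d (ET j) q.
    rewrite -(sum_block (i := i) (F := fun r => c (ET (w a)) r * d r q)) ?cd //.
    by move=> r ri; rewrite (gc (ET (w a)) r).2 ?mul0r // eq_sym.
  rewrite /X scaler_suml -sumrB; apply: rpred_sum => j _.
  by rewrite -scalerA -scalerBr rpredZ // (gd (ET j) q).1.
have [_ Cdec Crad] := CN.
have [t2|t1] := ltnP 1 (t i).
  rewrite u2 // eX -(subrK (dl *: e i) X) mulrDr -scalerAr (Ce Cx).
  apply: rpredD; last first.
    rewrite /dl; case: eqP => [<-|_]; last by rewrite scale0r mem0v.
    rewrite rpredZ // (subvP (Cdec i (w a) s _)) //=.
    by rewrite -ltnS ltn_ord.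
  have e1 : e i * (X - dl *: e i) = X - dl *: e i.
    by rewrite mulrBr eX -scalerAr eid.
  have e2 : (X - dl *: e i) * e (tag q) = X - dl *: e i.
    rewrite mulrBl Xe -scalerAl /dl; case: eqP => [<-|_] /=; first by rewrite eid.
    by rewrite !scale0r.
  have [qi|qi] := eqVneq (tag q) i; last first.
    by apply: (Crad (ET s)) => //; apply: contra qi => /eqP<-.
  have [l ql] := tagged_ex qi; rewrite ql /= in e2 *.
  exact: nested_absorb CN t2 Cx JX e1 e2.
have ts (j : 'I_(t i)) : j = s.
  apply/val_inj => /=; have := ltn_ord s; have := ltn_ord j.
  by case: (t i) t1 (s : nat) (j : nat) => [|[|//]] _; case=> [|?] [|?].
have t1' : t i = 1%N by apply/eqP; rewrite eqn_leq t1 (leq_ltn_trans _ (ltn_ord s)).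
have [qs|qs] := eqVneq (ET s) q.
  rewrite /X -qs !mulr_sumr; apply: rpred_sum => j _.
  by rewrite (ts j) -!scalerAr u1 // (Ce Cx) rpredZ.
apply: (Crad (ET s)) => //=; last by rewrite -mulrA Xe.
  by move: JX; rewrite /dl (ts (w a)) (negbTE qs) scale0r subr0; apply: idealM.
by rewrite mulrA eu.
Qed.

(** This is a closed condition, so that it holds for C' as well. The dimension of the
    space of coefficients w with C_(i,s) u (sum of the w_j z_(i,j)) contained in C'
    being at least s + 1, independent coefficients w_s can be chosen for each i;
    they define an automorphism of P which maps D into C', hence onto C'. *)
Lemma closure_orbit (d : 'I_n -> nat) (G : 'End(P) -> Prop) (C0 C' : submod P) :
  (forall h, G h -> mod_aut h /\ exists al : sig -> K, forall p, h (zz p) = al p *: zz p) ->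
  C0 = (g @: D)%VS :> {vspace P} -> Grass J e d C0 ->
  Grass_closure J e d (orbit_of G C0) C' -> orbit_of (@mod_aut K A P) C0 C'.
Proof.
move=> hG C0E GC0 [GC' clC']; have [u [v [eu vu inc]]] := torus_incidence.
pose T p (w : 'rV[K]_(t (tag p))) (c : A) : P :=
  \sum_j w 0 j *: mact (c * u p) (zz (ET j)).
have HF i (s : 'I_(t i)) : exists F : {vspace 'rV[K]_(t i)}, (s < \dim F)%N /\
    forall w c, w \in F -> c \in (C (ET s) : {vspace A}) ->
      T (ET s) w c \in (C' : {vspace P}).
  have [L [fL LP]] : exists L : 'M[K]_(s.+1, t i), row_free L /\
       forall a (b : 'I_(\dim (C (ET s) : {vspace A}))),
         \sum_j L a j *: mact ((vbasis (C (ET s)))`_b * u (ET s)) (zz (ET j))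
           \in (C' : {vspace P}).
    apply: (clC' _ (incidence_closed _ _ (ltn_ord s))) => E [h [Gh ->]].
    have [ah [al hal]] := hG h Gh; rewrite C0E.
    exact: inc.
  (* the row space of L *)
  exists (limg (linfun (mulmxr L : 'rV_s.+1 -> 'rV_(t i)))); split.
    rewrite limg_dim_eq ?dimvf /dim /= ?mul1n //.
    apply/vspaceP => r; rewrite capfv memv_ker memv0 lfunE /=.
    apply/eqP/eqP => [r0|->]; last exact: mul0mx.
    by apply: (row_free_inj fL); rewrite mul0mx.
  move=> _ c /memv_imgP[r _ ->] Cc; rewrite lfunE /= /T.
  have La a : \sum_j L a j *: mact (c * u (ET s)) (zz (ET j)) \in (C' : {vspace P}).
    rewrite (coord_vbasis Cc).
    rewrite [X in X \in _](_ : _ = \sum_b coord (vbasis (C (ET s))) b c *: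
      \sum_j L a j *: mact ((vbasis (C (ET s)))`_b * u (ET s)) (zz (ET j))).
      by apply: rpred_sum => b _; apply: rpredZ; apply: LP.
    under [RHS]eq_bigr => b _ do rewrite scaler_sumr.
    rewrite exchange_big; apply: eq_bigr => j _ /=.
    rewrite mulr_suml mact_suml scaler_sumr; apply: eq_bigr => b _.
    by rewrite -scalerAl mactZl !scalerA mulrC.
  rewrite [X in X \in _](_ : _ = \sum_a r 0 a *:
      \sum_j L a j *: mact (c * u (ET s)) (zz (ET j))).
    by apply: rpred_sum => a _; apply: rpredZ.
  under [RHS]eq_bigr => a _ do rewrite scaler_sumr.
  rewrite exchange_big; apply: eq_bigr => j _ /=.
  by rewrite mxE scaler_suml; apply: eq_bigr => a _; rewrite scalerA.
have Hw i : exists w : 'I_(t i) -> 'rV[K]_(t i), free [tuple w l | l < t i] /\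
    forall s c, c \in (C (ET s) : {vspace A}) -> T (ET s) (w s) c \in (C' : {vspace P}).
  have [F FP] := fin_all_exists (HF i).
  have [w [wF fw]] := adapted_basis (fun l => (FP l).1).
  by exists w; split=> // s c Cc; apply: (FP s).2.
have [w wP] := fin_all_exists Hw.
pose y p := T p (w (tag p) (tagged p)) 1.
have yE p c : mact c (y p) = T p (w (tag p) (tagged p)) c.
  rewrite /y /T linear_sum; apply: eq_bigr => j _.
  by rewrite linearZ /= -mactM mul1r.
have ey p : mact (e (tag p)) (y p) = y p.
  by rewrite yE /y /T; apply: eq_bigr => j _; rewrite eu mul1r.
pose h := fext e (fun p => tag p) zz y.
have hh : mod_hom h by apply: (fext_hom eid hzz).
have hE p c : h (mact c (zz p)) = T p (w (tag p) (tagged p)) c.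
  exact: etrans (fext_mact eid hzz c (ey p)) (yE p c).
have imh : limg h = fullv.
  apply: (free_span_full (U := img_sub hh (full_sub P)) hzz) => -[i j] /=.
  have fw := (wP i).1.
  have delta_in : delta_mx 0 j \in <<[tuple w i l | l < t i]>>%VS.
    suff -> : <<[tuple w i l | l < t i]>>%VS = fullv by rewrite memvf.
    apply/eqP; rewrite eqEdim subvf (eqP fw) size_tuple dimvf /dim /=.
    by rewrite mul1n.
  have -> : zz (existT _ i j) = \sum_l coord [tuple w i l | l < t i] l (delta_mx 0 j) *:
      \sum_j' w i l 0 j' *: zz (ET j').
    under eq_bigr => l _ do rewrite scaler_sumr.
    rewrite exchange_big /= (bigD1 j) //= [X in _ + X]big1 => [|j' jj'].
      rewrite addr0; under eq_bigr => l _ do rewrite scalerA.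
      rewrite -scaler_suml -[LHS]scale1r; congr (_ *: _).
      have := congr1 (fun r : 'rV_(t i) => r 0 j) (coord_span delta_in).
      rewrite mxE !eqxx summxE => E; apply: etrans E _; apply: eq_bigr => l _.
      by rewrite mxE -tnth_nth tnth_mktuple.
    under eq_bigr => l _ do rewrite scalerA.
    rewrite -scaler_suml.
    have := congr1 (fun r : 'rV_(t i) => r 0 j') (coord_span delta_in).
    rewrite mxE (negbTE jj') andbF summxE => E.
    rewrite [X in X *: _](_ : _ = 0) ?scale0r //; apply: etrans _ (esym E).
    apply: eq_bigr => l _; by rewrite mxE -tnth_nth tnth_mktuple.
  apply: rpred_sum => l _; apply: rpredZ; apply/memv_imgP.
  exists (mact (v (ET l)) (zz (ET l))); first exact: memvf.
  rewrite hE /T; apply: eq_bigr => j' _; rewrite vu.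
  by rewrite -{1}(free_gen hzz (ET j')).
have bh := surj_bij imh.
have sub : (h @: D <= C')%VS.
  rewrite sub_limgP; apply: Dsub_sub => -[i s] c Cc; rewrite -memv_preim hE.
  exact: (wP i).2.
have hD : (C' : {vspace P}) = (h @: D)%VS.
  apply/esym/eqP; rewrite eqEdim sub bij_dim //= -(bij_dim D bg) -C0E.
  by have [dC _ _] := GC0; have [dC' _ _] := GC'; rewrite dC' dC.
exists (h \o g^-1)%VF; split.
  split; first exact: hom_comp hh (hom_inv hg bg).
  apply: (eq_bij (bij_comp bh (bij_lfunV bg))) => x.
  by rewrite comp_lfunE.
rewrite hD limg_comp C0E -limg_comp -limg_comp; congr (_ @: _)%VS.
apply/lfunP => x; rewrite !comp_lfunE.
by have [gK _] := bij_lfunK bg; rewrite gK.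
Qed.

End Closure.

Section Torus.
Variables (t : 'I_n -> nat) (m : nat) (idx : 'I_m -> 'I_n).
Hypothesis cnt : forall i, #|[pred r | idx r == i]| = t i.
Variables (P : fdmod A) (z : 'I_m -> P).
Hypothesis hz : free_basis e idx z.
Variables (d : 'I_n -> nat) (M : fdmod A).
Hypothesis topM : mod_iso (top J P) (top J M).

Lemma nested_torus_closures : nested_decomposition J e t M ->
  torus_closures_in_orbit J e d P M.
Proof.
move=> nM G tG C0 GC0 MC0 C' cl.
have [z' [hz' zG]] := torus_diag hJ he hz tG.
have [b [bb idxb]] := block_bij cnt.
have hzz : free_basis e (fun p => tag p) (z' \o b) by apply: (free_basis_reindex bb _ hz').
have [C [CN MC]] := iffLR (nested_decompositionP hJ he hzz M) nM.
have Crad := rad_of_top topM (mod_iso_refl _) MC.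
have C0rad : (C0 <= rad J P)%VS by have [] := GC0.
have [g [[hg bg] gE]] := lift_iso hJ he hzz Crad C0rad (mod_iso_trans (mod_iso_sym MC) MC0).
apply: (closure_orbit hzz CN hg bg _ gE GC0 cl) => h Gh.
have [[autG _ _ _ _] _] := tG; split; first exact: autG.
have H p : exists c, h ((z' \o b) p) = c *: (z' \o b) p by apply: zG.
exact: (fin_all_exists H).
Qed.

End Torus.
End Basic.

(** * The equivalences *)

Section Basic.
Variables (K : closedFieldType) (A : falgType K) (n : nat).
Variables (J : left_ideal A) (e : 'I_n -> A).

Lemma torus_closures_no_proper (P : fdmod A) (d : 'I_n -> nat) (M : fdmod A) :
  torus_closures_in_orbit J e d P M -> no_proper_torus_degeneration J e d P M.
Proof.
move=> H M' [C [C' [G [GC MC [tG _] cl M'C]]]].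
have [g [[hg bg] gE]] := H G tG C GC MC C' cl.
apply: mod_iso_trans M'C (mod_iso_sym (mod_iso_trans MC _)).
exact: aut_quo_iso hg bg gE.
Qed.

Hypothesis hJ : is_jacobson J.
Hypothesis he : basic_with e.
Variables (t : 'I_n -> nat) (m : nat) (idx : 'I_m -> 'I_n).
Hypothesis cnt : forall i, #|[pred r | idx r == i]| = t i.
Variables (P : fdmod A) (z : 'I_m -> P).
Hypothesis hz : free_basis e idx z.
Variables (d : 'I_n -> nat) (M : fdmod A).
Hypothesis hd : forall i, dimvec e M i = d i.
Hypothesis topM : mod_iso (top J P) (top J M).

Lemma no_proper_nested : no_proper_torus_degeneration J e d P M ->
  nested_decomposition J e t M.
Proof.
move=> nd; have [C0 [C0rad MC0]] := rad_presentation hJ he hz topM.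
have [C [Ce Ccmp Crad _ MC]] :=
  lim_stable_ideals hJ (no_proper_lim_stable hJ he hz hd nd) C0rad MC0.
have [b [bb idxb]] := block_bij cnt.
apply: (sort_nested hJ he (C := C \o b) (free_basis_reindex bb idxb hz)).
- by move=> p c Cc; rewrite -idxb; apply: Ce Cc.
- by move=> p q pq; apply: Ccmp; rewrite !idxb.
- move=> p q x c npq Jx ex xe; apply: Crad; rewrite ?idxb //.
  by rewrite (bij_eq bb).
by apply: mod_iso_trans MC _; apply: quo_eq_iso; apply: Dsub_reindex.
Qed.

End Basic.

Theorem theorem3p6
  (K : closedFieldType) (A : falgType K) (n : nat)
  (J : left_ideal A) (hJ : is_jacobson J)
  (e : 'I_n -> A) (he : basic_with e)
  (t : 'I_n -> nat) (P : fdmod A)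
  (hP : projective_cover P (semisimple_of J e t))
  (idx : 'I_(\sum_i t i)%N -> 'I_n) (z : 'I_(\sum_i t i)%N -> P)
  (hz : distinguished_sequence e idx z)
  (d : 'I_n -> nat) (M : fdmod A)
  (hT : mod_iso (top J M) (semisimple_of J e t))
  (hd : forall i, dimvec e M i = d i) :
  (no_proper_torus_degeneration J e d P M <->
     torus_closures_in_orbit J e d P M) /\
  (torus_closures_in_orbit J e d P M <-> nested_decomposition J e t M) /\
  (nested_decomposition J e t M <-> isotypic_decomposition J e t z M).
Proof.
have fz := distinguished_free he hz.
have [topP cnt] := cover_count hJ he fz hP.
have topM := mod_iso_trans topP (mod_iso_sym hT).
have [b [bb idxb]] := block_bij cnt.
have no_proper_nested : no_proper_torus_degeneration J e d P M ->
    nested_decomposition J e t M.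
  exact: (no_proper_nested hJ he cnt fz hd topM).
have nested_closures : nested_decomposition J e t M ->
    torus_closures_in_orbit J e d P M.
  exact: (nested_torus_closures hJ he cnt fz topM).
have closures_no_proper := @torus_closures_no_proper _ _ _ J e P d M.
split; first by split=> // H; apply/nested_closures/no_proper_nested.
split; first by split=> // H; apply/no_proper_nested/closures_no_proper.
split; first exact: (nested_isotypic hJ he bb idxb fz topM).
exact: (isotypic_nested hJ he bb idxb fz).
Qed.
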